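(* Let $p$ be a prime, $q$ a power of $p$, and $k$ an algebraically closed field of characteristic $p$. Let $\mathcal{X}' \subset \mathbb{P}^2$ be the projective closure, in the projective plane over $k$ with homogeneous coordinates $(X:Z:W)$ and affine coordinates $x=X/W$, $z=Z/W$, of the affine plane curve $$x^{q^3}+x-(x^q+x)^{q^2-q+1}-z^{q^3+1}=0.$$ Then the set of all Galois points for $\mathcal{X}'$ coincides with the set $$\{(0:1:0)\} \cup (\mathcal{X}' \cap \{Z=0\}).$$
   Context: The curve $\mathcal{X}'$ is an irreducible plane curve, a plane model of the Giulietti--Korchmáros curve. Namely, let $\mathcal{X} \subset \mathbb{P}^3$ (homogeneous coordinates $(X:Y:Z:W)$, $x=X/W$, $y=Y/W$, $z=Z/W$) be the complete intersection of the hypersurfaces with affine equations $x^q+x-y^{q+1}=0$ and $y((x^q+x)^{q-1}-1)-z^{q^2-q+1}=0$; then $\mathcal{X}'$ is the image of $\mathcal{X}$ under the projection $\pi_R:\mathbb{P}^3\dashrightarrow\mathbb{P}^2$, $(X:Y:Z:W)\mapsto(X:Z:W)$, from the point $R=(0:1:0:0)$, and $\pi_R:\mathcal{X}\to\mathcal{X}'$ is birational. Points of $\mathbb{P}^2$ are written in the coordinates $(X:Z:W)$, so $(0:1:0)$ is the point $X=W=0$. For a point $P \in \mathbb{P}^2$ (over $k$), let $\pi_P:\mathbb{P}^2\dashrightarrow\mathbb{P}^1$ denote the projection from $P$: if $P$ is the common zero of linearly independent linear forms $L_1,L_2$, then $\pi_P=(L_1:L_2)$. The point $P$ is called a Galois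 point for $\mathcal{X}'$ if the field extension $k(\mathcal{X}')/\pi_P^*k(\mathbb{P}^1)$ induced by the restriction of $\pi_P$ to $\mathcal{X}'$ is Galois; equivalently, $k(\mathcal{X}')/k(L_1/L_2)$ is a Galois extension. Here $P$ may be any point of $\mathbb{P}^2$: a smooth point of $\mathcal{X}'$, a singular point of $\mathcal{X}'$, or a point not on $\mathcal{X}'$. *)

(* Defs.v *)
From mathcomp Require Import all_boot all_order all_algebra all_field.
From mathcomp Require Export mpoly.

Set Implicit Arguments.
Unset Strict Implicit.
Unset Printing Implicit Defensive.

Import GRing.Theory.
Local Open Scope ring_scope.

(* A field extension given by an embedding [i : F -> E] is (finite) Galois when
   it is isomorphic over [F] to a Galois extension in the sense of
   [mathcomp.field.galois]; there, extensions of [F] carry their [F]-algebra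
   structure in their type. *)
Definition galois_extension (F E : fieldType) (i : {rmorphism F -> E}) : Prop :=
  exists (L : splittingFieldType F) (theta : {rmorphism E -> L}),
    [/\ bijective theta, forall a : F, theta (i a) = a%:A & galois 1 {:L}].

(* Points of the projective plane are represented by nonzero row vectors
   [(X, Z, W)]; two of them are the same point when they span the same line,
   which is [(P == Q)%MS]. *)
Definition proj_pt (k : fieldType) (a b c : k) : 'rV[k]_3 :=
  \row_(i < 3) [:: a; b; c]`_i.

Section PlaneCurve.

(* An affine plane curve is given by [f] in k[x, z], where [x = 'X_0] and
   [z = 'X_1]; in homogeneous coordinates, [X = 'X_0], [Z = 'X_1], [W = 'X_2]. *)
Variable k : fieldType.
Implicit Types (f : {mpoly k[2]}) (P : 'rV[k]_3).

(* [(msize f).-1] is the total degree of [f]. *)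
Definition homogenization f : {mpoly k[3]} :=
  \sum_(m <- msupp f)
     f@_m *: ('X_0 ^+ m 0 * 'X_1 ^+ m 1 * 'X_2 ^+ ((msize f).-1 - mdeg m)).

Definition on_proj_closure f P : Prop :=
  (homogenization f).@[fun i => P 0 i] = 0.

(* [phi] exhibits [K] as the fraction field of the coordinate ring
   k[x, z] / (f); such a [K] exists exactly when the ideal (f) is prime, and is
   then unique up to a unique isomorphism compatible with [phi]. *)
Definition is_function_field f (K : fieldType)
    (phi : {rmorphism {mpoly k[2]} -> K}) : Prop :=
  (forall g, phi g = 0 <-> exists h, g = h * f) /\
  (forall t : K, exists g h, phi h != 0 /\ t = phi g / phi h).

(* The linear form l_0 X + l_1 Z + l_2 W in the chart W = 1. *)
Definition affine_form (l : 'cV[k]_3) : {mpoly k[2]} :=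
  l 0 0 *: 'X_0 + l 1 0 *: 'X_1 + (l 2 0)%:MP.

(* [i] is the pullback k(P^1) = k(t) -> K along the rational map (L_1 : L_2),
   where the linear forms are the columns of [L]: it is the identity on k and
   maps t to L_1 / L_2. *)
Definition is_projection_pullback (K : fieldType)
    (phi : {rmorphism {mpoly k[2]} -> K}) (L : 'M[k]_(3, 2))
    (i : {rmorphism {fraction {poly k}} -> K}) : Prop :=
  (forall c : k, i (tofrac c%:P) = phi c%:MP) /\
  i (tofrac 'X) = phi (affine_form (col 0 L)) / phi (affine_form (col 1 L)).

(* The choices of the model [K] of the function field and of the two linearly
   independent linear forms vanishing at [P] do not matter. *)
Definition galois_point f P : Prop :=
  exists (K : fieldType) (phi : {rmorphism {mpoly k[2]} -> K})
         (L : 'M[k]_(3, 2)) (i : {rmorphism {fraction {poly k}} -> K}),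
    [/\ is_function_field f phi,
        \rank L = 2 /\ P *m L = 0,
        is_projection_pullback phi L i
      & galois_extension i].

End PlaneCurve.

Definition gk_plane_model (k : fieldType) (q : nat) : {mpoly k[2]} :=
  'X_0 ^+ (q ^ 3) + 'X_0 - ('X_0 ^+ q + 'X_0) ^+ (q ^ 2 - q + 1)
  - 'X_1 ^+ (q ^ 3 + 1).

(* Main.v *)
(* Put [alpha = 1 - (x^q + x)^(q - 1)]. The curve is [alpha^q (x - x^(q^2)) =
   z^(q^3 + 1)], so the tangent at a point with [z <> 0] meets it there with
   multiplicity exactly [q]. In a Galois projection, the multiplicity at a
   smooth point of a fibre divides both the degree and all other multiplicities
   of that fibre. If [P] is not on the curve and is not [(0:1:0)], the degree
   [q^3 + 1] is prime to [q], but some tangent passes through [P]. If [P] is on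
   the curve and [Z <> 0], the [q^4 + q - 1] other points whose tangent passes
   through [P] would split into sets of [q^2] points, one set on each line
   through [P].

   Conversely, the projection from [(0:1:0)] is a Kummer extension. The
   projections from the points with [Z = 0] have degree [q^3] or [q^3 - q], and
   all conjugates of a generator are given explicitly by linear substitutions
   preserving the Hermitian curve [x^q + x = y^(q + 1)]. *)

Require Import Defs.
From HB Require Import structures.
From Stdlib Require Import Classical_Prop.
From mathcomp Require Import all_boot all_algebra all_field all_fingroup.
From mathcomp Require Import ring zify.
From mathcomp Require Import mpoly.

Set Implicit Arguments.
Unset Strict Implicit.
Unset Printing Implicit Defensive.

Import GRing.Theory.
Local Open Scope ring_scope.

(** * Galois extensions and automorphisms *)

(** Ramification is read off an equation, without a theory of places. Let [t] be the parameter of a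
    Galois projection and [Phi] the equation of the curve over [k(t)] in the variable [T = z]; it is
    the product of [T - s g z] over the group. Where the [t]-derivative of [Phi] is nonzero, [T - c]
    is a local parameter of the curve, the local ring is a valuation ring, and the conjugates of
    [z], being integral, have residues in it. Reducing the product at [t0] therefore lists the fibre
    by group elements. As [T] is [z] itself, multiplicities in the fibre are those of the curve on
    lines parametrized by [z].

    The explicit conjugates rest on one identity: if [y ^ (q + 1) = x ^ q + x], the curve is [z ^ (q
    ^ 3 + 1) = (y - y ^ (q ^ 2)) ^ (q + 1)]. For the center [(1:0:0)] the difference
    [y - y ^ (q ^ 2)] is invariant under translations of [y] by the field with [q ^ 2] elements. For
    singular centers its place is taken by the Dickson invariant [n ^ (q ^ 2) m - n m ^ (q ^ 2)],
    which is invariant under matrices of determinant 1 over that field. *)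

Lemma bij_rmorph_inv (R S : nzRingType) (f : {rmorphism R -> S}) :
  bijective f -> exists g : {rmorphism S -> R}, cancel f g /\ cancel g f.
Proof.
case=> g fK gK.
pose gR : {rmorphism S -> R} := HB.pack g
  (GRing.isZmodMorphism.Build _ _ g (can2_zmod_morphism fK gK))
  (GRing.isMonoidMorphism.Build _ _ g (can2_monoid_morphism fK gK)).
by exists gR.
Qed.

(** Conjugation by [theta] turns the abstract Galois group into automorphisms of [E] itself, where
    residues of functions make sense. Products act as in [galM], left factor first. *)
Lemma galois_extension_automorphisms (F E : fieldType) (i : {rmorphism F -> E}) :
  galois_extension i ->
  exists (gT : finGroupType) (s : gT -> {rmorphism E -> E}),
    [/\ forall g h x, s (g * h)%g x = s h (s g x),
        forall g a, s g (i a) = i a,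
        forall x, (forall g, s g x = x) -> exists a, x = i a
      & forall g, (forall x, s g x = x) -> g = 1%g].
Proof.
case=> L [theta [/bij_rmorph_inv [psi [thK psK]] thi galL]].
exists (gal_of {:L}).
exists (fun g : gal_of {:L} => psi \o (g : {rmorphism L -> L}) \o theta).
split=> /=.
- by move=> g h x; rewrite psK galM ?memvf.
- move=> g a; rewrite thi linearZ /= rmorph1.
  by rewrite -thi thK.
- move=> x fixx; have /galois_fixedField fixE := galL.
  have : theta x \in fixedField ('Gal({:L} / 1))%g.
    apply/fixedFieldP; first exact: memvf.
    by move=> g _; rewrite -[RHS]psK -{2}(fixx g) ?thK !psK.
  rewrite fixE => /vlineP[a thx]; exists a.
  by rewrite -(thK x) thx -thi thK.
move=> g fixg; apply/eqP/gal_eqP => y _.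
by rewrite gal_id -[y]psK -[RHS]psK -{2}(fixg (psi y)) psK psK.
Qed.

(** * Multiplicities in a fibre of a Galois projection *)

Section FiberMultiplicity.
Variables (k K : fieldType) (ev : {rmorphism {poly {poly k}} -> K}).
Variable Phi : {poly {poly k}}.
Hypothesis ev_ker : forall g, ev g = 0 -> exists h, g = h * Phi.
Hypothesis ev_Phi : ev Phi = 0.
Hypothesis Phi_monic : Phi \is monic.
Hypothesis Phi_size : (2 < size Phi)%N.
Hypothesis ev_frac : forall y, exists g h, ev h != 0 /\ y = ev g / ev h.

(** The resultant of [Phi] and [g] lies in the ideal that they generate, so modulo [Phi] it is a
    multiple of [g] free of [T]. It is nonzero, since a common factor of positive degree would make
    [Phi] divide either its own cofactor or a nonzero polynomial in [t] alone. *)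
Lemma ev_norm g : ev g != 0 -> exists g' R, R != 0 /\ ev g * ev g' = ev R%:P.
Proof.
move=> gN0; have gn0 : g != 0 by apply: contraNneq gN0 => ->; rewrite rmorph0.
have Phi0 : Phi != 0 by rewrite monic_neq0.
have [g1|g1] := leqP (size g) 1.
  have /size_poly1P[R R0 gR] : size g == 1%N.
    by rewrite eqn_leq g1 size_poly_gt0.
  by exists 1, R; rewrite rmorph1 mulr1 gR.
have [[u v] /= _ e] := resultant_in_ideal (ltnW Phi_size) g1.
exists v, (resultant Phi g); split; last first.
  by rewrite e rmorphD !rmorphM /= ev_Phi mulr0 add0r mulrC.
rewrite resultant_eq0 -leqNgt; set d := gcdp _ _.
have d0 : d != 0 by rewrite gcdp_eq0 (negPf Phi0).
have [[c1 d1] /= c10 e1] := Pdiv.Idomain.dvdpP _ _ (dvdp_gcdl Phi g).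
have [[c2 d2] /= c20 e2] := Pdiv.Idomain.dvdpP _ _ (dvdp_gcdr Phi g).
have : ev d1 * ev d = 0.
  by rewrite -rmorphM -/d /= -e1 -mul_polyC rmorphM /= ev_Phi mulr0.
move/eqP; rewrite mulf_eq0 => /orP[/eqP evd1|/eqP evd]; last first.
  have : ev c2%:P * ev g = 0 by rewrite -rmorphM /= mul_polyC e2 rmorphM /= evd mulr0.
  move/eqP; rewrite mulf_eq0 (negPf gN0) orbF => /eqP /ev_ker[h e3].
  have: (size (h * Phi)%R <= 1)%N by rewrite -e3 size_polyC leq_b1.
  have hn0 : h != 0 by apply: contraNneq c20 => h0; rewrite -(@polyC_eq0 {poly k}) e3 h0 mul0r.
  rewrite size_Mmonic // => H.
  by move: (leq_trans Phi_size (leq_trans (leq_addl (size h) _) (leqSpred _))); lia.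
have [h e3] := ev_ker evd1.
have d10 : d1 != 0.
  apply/eqP => d10; move/eqP: e1.
  by rewrite d10 mul0r -mul_polyC mulf_eq0 (negPf Phi0) polyC_eq0 (negPf c10).
have hn0 : h != 0 by apply: contraNneq d10 => h0; rewrite e3 h0 mul0r.
have szE : size Phi = ((size h + size Phi).-1 + size d).-1.
  have := congr1 (fun p : {poly {poly k}} => size p) e1; rewrite -/d.
  by rewrite size_scale // size_mul // e3 size_Mmonic.
have aux (a b n : nat) : (0 < b)%N -> (0 < n)%N -> (2 < a)%N ->
  a = ((b + a).-1 + n).-1 -> (n <= 1)%N by lia.
by apply: aux szE => //; rewrite size_poly_gt0.
Qed.

Variables (gT : finGroupType) (s : gT -> {rmorphism K -> K}).
Hypothesis sM : forall g h x, s (g * h)%g x = s h (s g x).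
Hypothesis s_ev : forall g c, s g (ev c%:P) = ev c%:P.
Hypothesis Phi_split :
  map_poly (ev \o polyC) Phi = \prod_g ('X - (s g (ev 'X))%:P).
Variables (t0 c : k).
Let Phi0 := map_poly (horner_eval t0) Phi.
Hypothesis Phi0c : root Phi0 c.
Hypothesis smooth : (Phi.[c%:P])^`().[t0] != 0.

Let ev0 : {rmorphism {poly {poly k}} -> k} :=
  (horner_eval t0 : {rmorphism {poly k} -> k}) \o
  (horner_eval c%:P : {rmorphism {poly {poly k}} -> {poly k}}).

Let ev0E g : ev0 g = (map_poly (horner_eval t0) g).[c].
Proof.
have e : c = horner_eval t0 c%:P by rewrite /horner_eval hornerC.
by rewrite [in RHS]e horner_map.
Qed.

Let ev0_Phi : ev0 Phi = 0. Proof. by rewrite ev0E; apply/eqP. Qed.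

(** Expansion in [t]: the value of [U] at the point is the [t]-derivative of [Phi], so the
    hypothesis [smooth] makes [U] a local unit. *)
Let Phi_taylor : exists U, Phi = map_poly polyC Phi0 + ('X - t0%:P)%:P * U
  /\ ev0 U != 0.
Proof.
pose U := \poly_(i < size Phi)
  ((Phi`_i - (Phi`_i).[t0]%:P) %/ ('X - t0%:P)).
have e : Phi = map_poly polyC Phi0 + ('X - t0%:P)%:P * U.
  apply/polyP => i; rewrite coefD coefCM coef_map /= /Phi0 coef_map /= coef_poly.
  case: ltnP => [_|le]; last first.
    by rewrite nth_default // /horner_eval horner0 polyC0 mulr0 add0r.
  rewrite mulrC divpK ?dvdp_XsubCl; last first.
    by rewrite rootE !hornerE subrr.
  by rewrite /horner_eval addrC subrK.
exists U; split => //.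
apply: contraNneq smooth => U0; rewrite e hornerD hornerM hornerC.
rewrite horner_map derivD derivC add0r derivM derivXsubC mul1r hornerD hornerM.
by rewrite hornerXsubC subrr mul0r addr0 -[X in X == 0]/(ev0 U) U0.
Qed.

(** The function [r] is regular at the point [(t0, c)] of the curve with value [v]. Kept as a
    relation, so that no localization has to be built. *)
Definition residue (r : K) (v : k) :=
  exists g h, [/\ ev0 h != 0, r * ev h = ev g & ev0 g = v * ev0 h].

Let evN0 h : ev0 h != 0 -> ev h != 0.
Proof.
by apply: contraNneq => /ev_ker[h' ->]; rewrite rmorphM ev0_Phi mulr0.
Qed.

Let ev_eq g h : ev g = ev h -> ev0 g = ev0 h.
Proof.
move/eqP; rewrite -subr_eq0 -rmorphB => /eqP /ev_ker[a e].
by apply/eqP; rewrite -subr_eq0 -rmorphB e rmorphM ev0_Phi mulr0.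
Qed.

Lemma residue_uniq r v w : residue r v -> residue r w -> v = w.
Proof.
case=> [g [h [h0 e1 e2]]] [g' [h' [h'0 e1' e2']]].
have : ev0 (g * h') = ev0 (g' * h).
  by apply: ev_eq; rewrite !rmorphM /= -e1 -e1' mulrAC.
rewrite !rmorphM e2 e2' mulrAC => /(mulIf h0) /(mulIf h'0) //.
Qed.

Lemma residue_ev g : residue (ev g) (ev0 g).
Proof. by exists g, 1; rewrite !rmorph1 oner_neq0 !mulr1. Qed.

Lemma residueD r v r' v' :
  residue r v -> residue r' v' -> residue (r + r') (v + v').
Proof.
case=> [g [h [h0 e1 e2]]] [g' [h' [h'0 e1' e2']]].
exists (g * h' + g' * h), (h * h').
rewrite !rmorphD !rmorphM mulf_neq0 // -e1 -e1' e2 e2'; split=> //; ring.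
Qed.

Lemma residueM r v r' v' :
  residue r v -> residue r' v' -> residue (r * r') (v * v').
Proof.
case=> [g [h [h0 e1 e2]]] [g' [h' [h'0 e1' e2']]].
exists (g * g'), (h * h').
rewrite !rmorphM mulf_neq0 // -e1 -e1' e2 e2'; split=> //; ring.
Qed.

Lemma residue0 : residue 0 0.
Proof. by have := residue_ev 0; rewrite !rmorph0. Qed.

Lemma residue1 : residue 1 1.
Proof. by have := residue_ev 1; rewrite !rmorph1. Qed.

Lemma residueN r v : residue r v -> residue (- r) (- v).
Proof.
by move=> H; rewrite -mulN1r -[- v]mulN1r; apply: residueM => //;
  have := residue_ev (-1); rewrite !rmorphN1.
Qed.

Lemma residueX r v n : residue r v -> residue (r ^+ n) (v ^+ n).
Proof.
move=> H; elim: n => [|n IH]; first exact: residue1.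
by rewrite !exprS; apply: residueM.
Qed.

Lemma residue_sum (I : Type) (t : seq I) (P : pred I) F G :
  (forall i, P i -> residue (F i) (G i)) ->
  residue (\sum_(i <- t | P i) F i) (\sum_(i <- t | P i) G i).
Proof. by move=> H; apply: big_ind2 => //; [exact: residue0|exact: residueD]. Qed.

Let pi : {poly {poly k}} := 'X - c%:P%:P.

Let ev_pi : ev pi != 0.
Proof.
apply/eqP => /ev_ker[h e]; have : size pi = 2%N by rewrite size_XsubC.
have hn0 : h != 0.
  apply/eqP => h0; have := polyXsubC_eq0 c%:P; rewrite -/pi e h0 mul0r eqxx.
  by [].
rewrite e size_Mmonic //.
by have := Phi_size; have: (0 < size h)%N by [rewrite size_poly_gt0]; lia.
Qed.

(* Every nonzero element of the local ring at (t0, c) is a unit times a power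
   of pi = T - c; termination comes from the norm, a polynomial in t alone. *)
Lemma local_decomposition g : ev g != 0 -> exists n h1 h2,
  [/\ ev0 h1 != 0, ev0 h2 != 0 & ev g * ev h1 = ev pi ^+ n * ev h2].
Proof.
move=> gN0; have [U [PhiE U0]] := Phi_taylor.
have [m [V]] := multiplicity_XsubC Phi0 c.
have Phi00 : Phi0 != 0.
  rewrite monic_neq0 //; exact: monic_map.
rewrite Phi00 /= => Vc PhiV.
have evV : ev0 (map_poly polyC V) != 0.
  by rewrite ev0E -map_poly_comp map_poly_id // => x _ /=; rewrite /horner_eval hornerC.
(* The equation of the curve says that [t - t0] is [pi ^ m] times a local unit, where [m] is the
   multiplicity of [c] in the fibre. *)
have rel : ev ('X - t0%:P)%:P * ev U = - (ev pi ^+ m * ev (map_poly polyC V)).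
  apply/eqP; rewrite -subr_eq0 opprK -!rmorphXn -!rmorphM -rmorphD /=.
  rewrite -[X in _ == X]ev_Phi; apply/eqP; congr (ev _).
  rewrite [RHS]PhiE addrC PhiV rmorphM rmorphXn /= mulrC; congr (_ * _ ^+ _ + _).
  by rewrite rmorphB /= map_polyX map_polyC.
have m0 : (0 < m)%N.
  by rewrite lt0n; apply: contraTneq Phi0c => m0; rewrite PhiV m0 mulr1.
have step a : ev0 a = 0 -> exists b, ev a * ev U = ev pi * ev b.
  move=> a0.
  have /factor_theorem[a2 e2] : root (a - a.[c%:P]%:P) c%:P.
    by rewrite rootE hornerD hornerN hornerC subrr.
  have /factor_theorem[a1 e1] : root a.[c%:P] t0 by apply/eqP.
  exists (U * a2 - pi ^+ m.-1 * map_poly polyC V * a1%:P).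
  have -> : a = a1%:P * ('X - t0%:P)%:P + a2 * pi.
    by rewrite -e2 -rmorphM /= -e1 addrC subrK.
  have -> : ev (U * a2 - pi ^+ m.-1 * map_poly polyC V * a1%:P) =
      ev U * ev a2 - ev pi ^+ m.-1 * ev (map_poly polyC V) * ev a1%:P.
    by rewrite (rmorphB ev) !(rmorphM ev) (rmorphXn ev).
  rewrite (rmorphD ev) !(rmorphM ev).
  transitivity (ev a1%:P * (ev ('X - t0%:P)%:P * ev U) + ev a2 * ev pi * ev U).
    ring.
  rewrite rel; have -> : ev pi ^+ m = ev pi * ev pi ^+ m.-1 by rewrite -exprS prednK.
  ring.
have iter_step n : (exists j h1 h2,
      [/\ ev0 h1 != 0, ev0 h2 != 0 & ev g * ev h1 = ev pi ^+ j * ev h2]) \/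
    exists h1 b, ev0 h1 != 0 /\ ev g * ev h1 = ev pi ^+ n * ev b.
  elim: n => [|n [IH|[h1 [b [h10 e]]]]]; [|by left|].
    by right; exists 1, g; rewrite !rmorph1 oner_neq0 mulr1 mul1r.
  have [b0|b0] := eqVneq (ev0 b) 0; last by left; exists n, h1, b.
  have [b' e'] := step _ b0; right; exists (h1 * U), b'.
  by rewrite !rmorphM mulf_neq0 // mulrA e -mulrA e' exprSr mulrA.
have [g' [R [R0 eR]]] := ev_norm gN0.
have [M [R1]] := multiplicity_XsubC R t0; rewrite R0 /= rootE => R1t eR1.
(* The norm [R] has order [M] at [t0], and [t - t0] has order [m] in [pi]; so [g], a divisor of the
   norm, contains at most [m * M] factors [pi]. *)
have [//|[h1 [b [h10 e]]]] := iter_step (m * M).+1.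
exfalso; pose V' := map_poly polyC V.
suff : ev0 ((- V') ^+ M * R1%:P * h1) = ev0 (pi * b * U ^+ M * g').
  rewrite !(rmorphM ev0) (rmorphXn ev0) (rmorphN ev0) => /eqP.
  have -> : ev0 pi = 0 by rewrite /ev0 /= /horner_eval hornerXsubC subrr horner0.
  have -> : ev0 R1%:P = R1.[t0] by rewrite /ev0 /= /horner_eval hornerC.
  by rewrite !mul0r mulf_eq0 (negPf h10) orbF mulf_eq0 (negPf R1t) orbF
      expf_eq0 oppr_eq0 (negPf evV) andbF.
apply: ev_eq; apply: (mulfI (expf_neq0 (m * M) ev_pi)).
rewrite !(rmorphM ev) !(rmorphXn ev) (rmorphN ev).
transitivity ((- (ev pi ^+ m * ev V')) ^+ M * ev R1%:P * ev h1).
  by rewrite -mulrN exprMn -exprM; ring.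
rewrite -rel exprMn.
transitivity (ev R%:P * ev h1 * ev U ^+ M).
  by rewrite eR1 rmorphM rmorphXn /= rmorphM rmorphXn /=; ring.
transitivity (ev g * ev h1 * ev g' * ev U ^+ M); first by rewrite -eR; ring.
by rewrite e exprSr; ring.
Qed.

(** Comparing the exponents of [pi] in numerator and denominator shows that the local ring is a
    valuation ring. *)
Lemma residue_valuation y :
  (exists v, residue y v) \/ residue y^-1 0.
Proof.
have [->|y0] := eqVneq y 0; first by left; exists 0; exact: residue0.
have [a [b [b0 yab]]] := ev_frac y.
have a0 : ev a != 0 by apply: contraNneq y0; rewrite yab => ->; rewrite mul0r.
have [n [h1 [h2 [h10 h20 e]]]] := local_decomposition a0.
have [n' [h1' [h2' [h10' h20' e']]]] := local_decomposition b0.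
have H1 := evN0 h10; have H2 := evN0 h20.
have H1' := evN0 h10'; have H2' := evN0 h20'.
have yE : y * (ev pi ^+ n' * ev (h2' * h1)) = ev pi ^+ n * ev (h2 * h1').
  rewrite !rmorphM /= (mulrA (ev pi ^+ n')) -e'.
  transitivity (y * ev b * ev h1 * ev h1'); first by ring.
  by rewrite yab divfK // e mulrA.
have Q0 : ev0 (h2' * h1) != 0 by rewrite rmorphM mulf_neq0.
have Q0' : ev0 (h2 * h1') != 0 by rewrite rmorphM mulf_neq0.
have Q := evN0 Q0; have Q' := evN0 Q0'.
have [le|lt] := leqP n' n.
  left; exists (ev0 (pi ^+ (n - n') * (h2 * h1')) / ev0 (h2' * h1)).
  exists (pi ^+ (n - n') * (h2 * h1')), (h2' * h1); split=> //; last first.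
    by rewrite divfK.
  apply: (mulfI (expf_neq0 n' ev_pi)); rewrite mulrCA yE -{1}(subnKC le) exprD.
  by rewrite -mulrA; congr (_ * _); rewrite -(rmorphXn ev) -(rmorphM ev).
right; exists (pi ^+ (n' - n) * (h2' * h1)), (h2 * h1'); split=> //.
  apply: (mulfI (expf_neq0 n ev_pi)); rewrite mulrCA -yE.
  rewrite mulKf // -{1}(subnKC (ltnW lt)) exprD.
  by rewrite -mulrA; congr (_ * _); rewrite -(rmorphXn ev) -(rmorphM ev).
rewrite (rmorphM ev0 (pi ^+ _)) (rmorphXn ev0) mul0r.
have -> : ev0 pi = 0 by rewrite /ev0 /= /horner_eval hornerXsubC subrr horner0.
by rewrite expr0n subn_eq0 leqNgt lt mul0r.
Qed.

Lemma residue_poly r v (F : {poly {poly k}}) : residue r v ->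
  residue (map_poly (ev \o polyC) F).[r] (map_poly (horner_eval t0) F).[v].
Proof.
move=> rv; rewrite !(horner_coef_wide _ (size_poly _ _)).
apply: residue_sum => i _; rewrite !coef_map /=.
apply: residueM; last exact: residueX.
by have := residue_ev (F`_i)%:P; rewrite /ev0 /= /horner_eval hornerC.
Qed.

(** The conjugates are roots of the monic [Phi], hence integral over [k[t]], and a valuation ring is
    integrally closed: if [y] had a pole, dividing its equation by the top power of [y] would give
    [0] the residue [1]. *)
Lemma residue_conj g : exists v, residue (s g (ev 'X)) v.
Proof.
set y := s g (ev 'X); have [//|y0] := residue_valuation y; exfalso.
have yN0 : y != 0.
  apply/eqP => y00; have : ev 'X = 0.
    by apply: (fmorph_inj (s g)); rewrite rmorph0.
  case/ev_ker => h e; have hn0 : h != 0.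
    by apply/eqP => h0; have := polyX_eq0 {poly k}; rewrite e h0 mul0r eqxx.
  have := size_polyX {poly k}; rewrite e size_Mmonic // => H.
  have aux (a b : nat) : (0 < b)%N -> (2 < a)%N -> (b + a).-1 = 2 -> False by lia.
  by apply: aux Phi_size H; rewrite size_poly_gt0.
pose P := map_poly (ev \o polyC) Phi.
have Py : P.[y] = 0.
  by rewrite /P Phi_split horner_prod (bigD1 g) //= hornerXsubC subrr mul0r.
have Pmon : P \is monic by apply: monic_map.
have szP : (size P).-1.+1 = size P.
  by rewrite prednK // size_poly_gt0 monic_neq0.
set d := (size P).-1 in szP.
have Pd : P`_d = 1 by rewrite -[RHS](monicP Pmon) lead_coefE.
suff : residue 0 1.
  by move/residue_uniq/(_ residue0)/eqP; rewrite oner_eq0.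
have <- : y ^- d * P.[y] = 0 by rewrite Py mulr0.
rewrite horner_coef -szP big_ord_recr /= Pd mul1r mulrDr mulVf ?expf_neq0 //.
rewrite -[X in residue _ X]add0r; apply: residueD; last exact: residue1.
rewrite big_distrr /=.
have e0 : \sum_(i < d) (0 : k) = 0 by rewrite big1.
rewrite -[X in residue _ X]e0.
apply: residue_sum => i _.
rewrite mulrCA -(mulr0 (Phi`_i).[t0]); apply: residueM.
  rewrite /P coef_map /=.
  by have := residue_ev (Phi`_i)%:P; rewrite /ev0 /= /horner_eval hornerC.
have -> : y ^- d * y ^+ i = y^-1 ^+ (d - i).
  have H : y^-1 ^+ d = y^-1 ^+ (d - i) * y^-1 ^+ i.
    by rewrite -exprD subnK // ltnW.
  by rewrite -exprVn H -mulrA (exprVn _ i) mulVf ?mulr1 // expf_neq0.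
have -> : (0 : k) = 0 ^+ (d - i) by rewrite expr0n subn_eq0 leqNgt ltn_ord.
exact: residueX.
Qed.

(** Residues respect sums and products, so the factorization [Phi_split] reduces coefficient by
    coefficient; uniqueness of residues identifies the result with [Phi0]. *)
Lemma fiber_split : exists v : gT -> k,
  (forall g, residue (s g (ev 'X)) (v g)) /\ Phi0 = \prod_g ('X - (v g)%:P).
Proof.
have [v vP] := fin_all_exists residue_conj.
exists v; split=> //; pose resP (p : {poly K}) (r : {poly k}) :=
  forall j, residue p`_j r`_j.
have resM : forall p r p' r', resP p r -> resP p' r' -> resP (p * p') (r * r').
  move=> p r p' r' H H' j; rewrite !coefM; apply: residue_sum => i _.
  exact: residueM.
have H : resP (\prod_g ('X - (s g (ev 'X))%:P)) (\prod_g ('X - (v g)%:P)).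
  apply: big_ind2 => //.
    by move=> j; rewrite !coef1; case: (j == 0)%N; [exact: residue1|exact: residue0].
  move=> g _ j; rewrite !coefB !coefX !coefC.
  apply: residueD; first by case: (j == 1)%N; [exact: residue1|exact: residue0].
  by case: (j == 0)%N; apply: residueN; [exact: vP|exact: residue0].
apply/polyP => j; have := H j; rewrite -Phi_split coef_map /= => H1.
apply: residue_uniq H1; rewrite /Phi0 coef_map /=.
by have := residue_ev (Phi`_j)%:P; rewrite /ev0 /= /horner_eval hornerC.
Qed.

(* The elements of the group sending T to residue c form a subgroup H (the
   inertia group), and every set {g | g T has residue e} is a union of left
   cosets of H. *)
Lemma fiber_multiplicity : (mup c Phi0 %| #|gT|)%N /\
  forall e, (mup c Phi0 %| mup e Phi0)%N.
Proof.
have [v [vP PhiE]] := fiber_split.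
have muE e : mup e Phi0 = #|[set g | v g == e]|.
  rewrite PhiE -(big_map v xpredT (fun y => 'X - y%:P)) mu_prod_XsubC.
  by rewrite -sum1_count big_map -sum1_card; apply: eq_bigl => g; rewrite inE.
(* Such an automorphism acts on [ev f] by substituting for [T] a function that again has residue
   [c]; so it preserves the local ring and all residues. *)
have res_inertia h : v h = c -> forall r x, residue r x -> residue (s h r) x.
  move=> vh r x [a [b [b0 e1 e2]]].
  have evs f : s h (ev f) = (map_poly (ev \o polyC) f).[s h (ev 'X)].
    elim/poly_ind: f => [|f f0 IH]; first by rewrite !rmorph0 horner0.
    rewrite !(rmorphD, rmorphM) /= IH s_ev map_polyX map_polyC hornerD hornerM.
    by rewrite hornerX hornerC.
  have resf f : residue (s h (ev f)) (ev0 f).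
    by rewrite evs ev0E -vh; apply: residue_poly.
  have := resf a; rewrite -e1 rmorphM => resa.
  have [a' [b' [b'0 e1' e2']]] := resa.
  have [a1 [b1 [b10 e11 e12]]] := resf b.
  have evb : ev0 a1 != 0 by rewrite e12 mulf_neq0.
  exists (a' * b1), (b' * a1); rewrite !(rmorphM ev0) mulf_neq0 //; split=> //.
    by rewrite !(rmorphM ev) -e1' -e11; ring.
  by rewrite e2' e12 e2; ring.
have vM g h : v h = c -> v (g * h)%g = v g.
  move=> vh; apply: (residue_uniq (vP _)); rewrite sM.
  exact: res_inertia.
have v1 : [set g | v g == c] != set0.
  rewrite -card_gt0 -muE -XsubC_dvd ?dvdp_XsubCl //.
  by rewrite monic_neq0 //; exact: monic_map.
have [h0] := set0Pn _ v1; rewrite inE => /eqP vh0.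
(* In a finite group closure under products is enough; the identity is reached as the power of [h0]
   at its order. *)
have Hgrp : group_set [set g | v g == c].
  apply/group_setP; split; last first.
    by move=> g h; rewrite !inE => /eqP vg /eqP vh; rewrite vM ?vg.
  have vX n : v (h0 ^+ n.+1)%g = c.
    by elim: n => [|n IH]; rewrite ?expg1 // expgSr vM.
  by rewrite inE -(expg_order h0) -(prednK (order_gt0 h0)) vX.
pose H := Group Hgrp.
have cardH : mup c Phi0 = #|H| by rewrite muE.
split; first by rewrite cardH -cardsT cardSg ?subsetT.
move=> e; rewrite cardH muE.
have actH : [acts H, on [set g | v g == e] | 'R].
  apply/actsP => h; rewrite inE => /eqP vh g.
  by rewrite !inE /= vM.
rewrite -(acts_sum_card_orbit actH); apply: dvdn_sum => T /imsetP[x _ ->].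
by rewrite orbitR card_lcoset.
Qed.
End FiberMultiplicity.

(** Used to pull a polynomial with coefficients in the base field back to [{poly {poly k}}]; keeping
    the size is what allows the comparison of degrees with [Phi]. *)
Lemma common_denominator (R : idomainType) (K : fieldType) (f : {rmorphism R -> K})
    (Q : {poly K}) :
  (forall j, exists n d, f d != 0 /\ Q`_j = f n / f d) ->
  exists d (G : {poly R}), [/\ f d != 0, size G = size Q & map_poly f G = f d *: Q].
Proof.
move=> H.
suff [d [G [d0 e]]] : exists d (G : {poly R}), f d != 0 /\ map_poly f G = f d *: Q.
  exists d, (\poly_(i < size Q) G`_i); have e' : map_poly f (\poly_(i < size Q) G`_i) = f d *: Q.
    apply/polyP => i; rewrite coef_map /= coef_poly; case: ltnP => [_|le].
      by rewrite -e coef_map.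
    by rewrite rmorph0 coefZ nth_default // mulr0.
  split=> //; apply/eqP; rewrite eqn_leq size_poly /=.
  apply: (@leq_trans (size (f d *: Q))); first by rewrite size_scale.
  by rewrite -e'; exact: size_poly.
elim/poly_ind: Q H => [|Q c IH] H.
  by exists 1, 0; rewrite rmorph1 oner_neq0 rmorph0 scaler0.
have [|d [G [d0 e]]] := IH.
  by move=> j; have := H j.+1; rewrite coefD coefMX coefC /= addr0.
have [n [d' [d'0 e']]] := H 0%N.
rewrite coefD coefMX coefC /= add0r in e'.
exists (d * d'), (d' *: G * 'X + (n * d)%:P).
rewrite rmorphM mulf_neq0 //; split=> //.
rewrite rmorphD (rmorphM (map_poly f)) /= map_polyX map_polyC map_polyZ /= e.
rewrite !(rmorphM f) e' scalerDr -!mul_polyC; congr (_ + _).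
  by rewrite !polyCM; ring.
by rewrite -polyCM; congr (_%:P); field.
Qed.

Lemma rmorph_eq_on_fractions (R : nzRingType) (K : fieldType)
    (f : R -> K) (s s' : {rmorphism K -> K}) :
  (forall y, exists g h, f h != 0 /\ y = f g / f h) ->
  (forall g, s (f g) = s' (f g)) -> s =1 s'.
Proof.
by move=> H e y; have [g [h [_ ->]]] := H y; rewrite !fmorph_div !e.
Qed.

(** * The equation of the curve as a product over the Galois group *)

Section GaloisFiber.
Variables (k F K : fieldType) (ev : {rmorphism {poly {poly k}} -> K}).
Variable Phi : {poly {poly k}}.
Hypothesis ev_ker : forall g, ev g = 0 -> exists h, g = h * Phi.
Hypothesis ev_Phi : ev Phi = 0.
Hypothesis Phi_monic : Phi \is monic.
Hypothesis Phi_size : (2 < size Phi)%N.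
Hypothesis ev_frac : forall y, exists g h, ev h != 0 /\ y = ev g / ev h.
Variable i : {rmorphism F -> K}.
Hypothesis i_frac : forall a, exists n d, ev d%:P != 0 /\ i a = ev n%:P / ev d%:P.
Hypothesis i_ev : forall n, exists a, ev n%:P = i a.
Hypothesis i_galois : galois_extension i.

(** What remains is the hypothesis [Phi_split]. The product over the group divides [Phi], because
    the conjugates of [ev 'X] are distinct roots; its coefficients are invariant, so after clearing
    denominators it lies in the kernel of [ev] and is a multiple of [Phi]. Hence both have the same
    degree. *)
Lemma galois_fiber t0 c :
  let Phi0 := map_poly (horner_eval t0) Phi in
  root Phi0 c -> (Phi.[c%:P])^`().[t0] != 0 ->
  (mup c Phi0 %| (size Phi).-1)%N /\ forall e, (mup c Phi0 %| mup e Phi0)%N.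
Proof.
move=> Phi0 Phi0c smooth.
have [gT [s [sM s_i s_fix s_faithful]]] := galois_extension_automorphisms i_galois.
have s_ev g n : s g (ev n%:P) = ev n%:P.
  by have [a ->] := i_ev n; rewrite s_i.
have ev_poly (f : {poly {poly k}}) : ev f = (map_poly (ev \o polyC) f).[ev 'X].
  elim/poly_ind: f => [|f f0 IH]; first by rewrite !rmorph0 horner0.
  rewrite !(rmorphD, rmorphM) /= IH map_polyX map_polyC hornerD hornerM.
  by rewrite hornerX hornerC.
pose Q := \prod_g ('X - (s g (ev 'X))%:P).
have szQ : size Q = #|gT|.+1.
  by rewrite /Q size_prod_XsubC -sum1_size -sum1_card; congr _.+1; apply: eq_bigl.
have Qmon : Q \is monic by apply: monic_prod_XsubC.
pose P := map_poly (ev \o polyC) Phi.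
have Pmon : P \is monic by apply: monic_map.
have szP : size P = size Phi.
  by rewrite size_map_poly_id0 //= (monicP Phi_monic) rmorph1 oner_neq0.
have QdvdP : Q %| P.
  rewrite /Q -(big_map (fun g => s g (ev 'X)) xpredT (fun y => 'X - y%:P)).
  apply: uniq_roots_dvdp.
    apply/allP => _ /mapP[g _ ->]; rewrite rootE.
    have -> : P = map_poly (s g) P.
      by rewrite /P -map_poly_comp; apply: eq_map_poly => n /=; rewrite s_ev.
    by rewrite horner_map -ev_poly ev_Phi rmorph0.
  (* An automorphism over the base is determined by the image of [ev 'X], which generates [K]; so
     equal roots come from equal group elements. *)
  rewrite uniq_rootsE map_inj_uniq ?index_enum_uniq // => g h e.
  have H : s g =1 s h.
    apply: rmorph_eq_on_fractions ev_frac _ => f.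
    rewrite ev_poly -!horner_map -!map_poly_comp e.
    by congr (_.[_]); apply: eq_map_poly => n /=; rewrite !s_ev.
  suff : (g * h^-1)%g = 1%g by move/(canRL (mulgK _)); rewrite mul1g invgK.
  have s1 x : s 1%g x = x.
    by apply: (fmorph_inj (s 1%g)); rewrite -sM mulg1.
  by apply: s_faithful => x; rewrite sM H -sM mulgV s1.
have : exists d (G : {poly {poly k}}), [/\ (ev \o polyC) d != 0, size G = size Q
    & map_poly (ev \o polyC) G = (ev \o polyC) d *: Q].
  apply: (common_denominator (f := ev \o polyC)) => j.
  have [|a ->] := s_fix Q`_j; last exact: i_frac.
  move=> h; rewrite -coef_map /Q rmorph_prod /=.
  congr (polyseq _)`_j; rewrite [RHS](reindex_inj (mulIg h)) /=.
  by apply: eq_bigr => g _; rewrite rmorphB /= map_polyX map_polyC /= sM.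
case=> d [G [d0 szG e]].
have /ev_ker[h e'] : ev G = 0.
  rewrite ev_poly e hornerZ /Q horner_prod (bigD1 1%g) //=.
  have -> : s 1%g (ev 'X) = ev 'X.
    by apply: (fmorph_inj (s 1%g)); rewrite -sM mulg1.
  by rewrite hornerXsubC subrr mul0r mulr0.
have leP : (size Phi <= size Q)%N.
  have hn0 : h != 0.
    apply/eqP => h0; move: szG; rewrite e' h0 mul0r size_poly0 szQ.
    by [].
  rewrite -szG e' size_Mmonic //.
  have : (0 < size h)%N by rewrite size_poly_gt0.
  have := Phi_size; have aux (a b : nat) : (2 < a)%N -> (0 < b)%N -> (a <= (b + a).-1)%N.
    by lia.
  exact: aux.
have PQ : P = Q.
  apply/eqP; rewrite -eqp_monic // eqp_sym -dvdp_size_eqp //.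
  rewrite eqn_leq szP leP andbT -szP.
  by apply: dvdp_leq => //; exact: monic_neq0.
have -> : (size Phi).-1 = #|gT| by rewrite -szP PQ szQ.
exact: (fiber_multiplicity ev_ker ev_Phi Phi_monic Phi_size ev_frac sM s_ev PQ).
Qed.
End GaloisFiber.

(** * The polynomial of the curve *)

Section CurvePolynomial.
Variables (q : nat) (R : comNzRingType).
Implicit Types x y : R.

Definition trace_q x : R := x ^+ q + x.
Definition alpha x : R := 1 - trace_q x ^+ (q - 1).
(* The curve is [curve_A x = z ^ (q ^ 3 + 1)]; in this factored form
   [alpha ^ q] and [x ^ (q ^ 2)] have zero derivative. *)
Definition curve_A x : R := alpha x ^+ q * (x - x ^+ (q ^ 2)).
End CurvePolynomial.

Section RMorphism.
Variables (q : nat) (R S : comNzRingType) (f : {rmorphism R -> S}).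
Lemma rmorph_trace_q x : f (trace_q q x) = trace_q q (f x).
Proof. by rewrite rmorphD rmorphXn. Qed.
Lemma rmorph_alpha x : f (alpha q x) = alpha q (f x).
Proof. by rewrite rmorphB rmorph1 rmorphXn rmorph_trace_q. Qed.
Lemma rmorph_curve_A x : f (curve_A q x) = curve_A q (f x).
Proof. by rewrite rmorphM rmorphXn rmorph_alpha rmorphB rmorphXn. Qed.
End RMorphism.

Definition pchar_power q (R : nzRingType) :=
  exists p e, [/\ prime p, (0 < e)%N, q = (p ^ e)%N & p \in [pchar R]].

Lemma pchar_power_gt1 q R : pchar_power q R -> (1 < q)%N.
Proof.
case=> p [e [hp he -> _]]; have -> : 1%N = (p ^ 0)%N by [].
by rewrite ltn_exp2l ?prime_gt1.
Qed.

Lemma pchar_power_poly q R : pchar_power q R -> pchar_power q {poly R}.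
Proof. by case=> p [e [hp he hq hR]]; exists p, e; rewrite pchar_poly. Qed.

Lemma pchar_power_rmorph q (R S : nzRingType) (f : {rmorphism R -> S}) :
  pchar_power q R -> pchar_power q S.
Proof.
by case=> p [e [hp he hq hR]]; exists p, e; split=> //; exact: rmorph_pchar f _ hR.
Qed.

Section Frobenius.
Variables (q : nat) (R : comNzRingType) (hR : pchar_power q R).
Implicit Types x y : R.

Let q_gt1 : (1 < q)%N := pchar_power_gt1 hR.

Lemma qX_pnat n : [pchar R].-nat (q ^ n)%N.
Proof.
case: hR => p [e [hp he -> hpR]].
by rewrite -expnM (eq_pnat _ (pcharf_eq hpR)) pnatX pnat_id.
Qed.

Lemma frobD n x y : (x + y) ^+ (q ^ n) = x ^+ (q ^ n) + y ^+ (q ^ n).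
Proof. exact: exprDn_pchar (qX_pnat n). Qed.

Lemma frobN n x : (- x) ^+ (q ^ n) = - x ^+ (q ^ n).
Proof.
apply/eqP; rewrite -addr_eq0 addrC -frobD subrr expr0n.
by rewrite expn_eq0 (gtn_eqF (ltnW q_gt1)).
Qed.

Lemma frobD1 x y : (x + y) ^+ q = x ^+ q + y ^+ q.
Proof. by have := frobD 1 x y; rewrite expn1. Qed.

Lemma frobN1 x : (- x) ^+ q = - x ^+ q.
Proof. by have := frobN 1 x; rewrite expn1. Qed.

Lemma frobB1 x y : (x - y) ^+ q = x ^+ q - y ^+ q.
Proof. by rewrite frobD1 frobN1. Qed.

Lemma natq0 : q%:R = 0 :> R.
Proof.
case: hR => p [e [hp he -> hpR]].
have : (p %| p ^ e)%N by rewrite -[X in (X %| _)%N]expn1 dvdn_exp2l.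
by rewrite (dvdn_pcharf hpR) => /eqP.
Qed.

Lemma natqX0 n : (q ^ n.+1)%:R = 0 :> R.
Proof. by rewrite expnS natrM natq0 mul0r. Qed.

Lemma trace_alpha x : trace_q q x * alpha q x = x - x ^+ (q ^ 2).
Proof.
rewrite /alpha mulrBr mulr1 -exprS subn1 prednK ?(ltnW q_gt1) //.
by rewrite {2}/trace_q frobD1 -exprM mulnn /trace_q; ring.
Qed.

(** Over a field this separates the two kinds of points with [z = 0]: zeros of [trace_q], simple for
    [curve_A], and zeros of [alpha], of order [q + 1]. Both factors have simple zeros, as
    [trace_q * alpha] is [x - x ^ (q ^ 2)]. *)
Lemma curve_A_trace x : curve_A q x = trace_q q x * alpha q x ^+ q.+1.
Proof. by rewrite /curve_A -trace_alpha exprS; ring. Qed.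

Lemma curve_AE x : curve_A q x =
  x ^+ (q ^ 3) + x - (x ^+ q + x) ^+ (q ^ 2 - q + 1).
Proof.
have q0 := ltnW q_gt1.
rewrite /curve_A /alpha frobB1 expr1n -exprM -trace_alpha /alpha.
rewrite mulrBr mulr1 -exprS subn1 prednK // -/(trace_q q x).
set u := trace_q q x.
have -> : (q ^ 2 - q + 1 = (q.-1 * q).+1)%N by rewrite -subn1 mulnBl mul1n mulnn addn1.
have e1 : u ^+ (q.-1 * q) * u ^+ q = x ^+ (q ^ 3) + x ^+ (q ^ 2).
  rewrite -exprD -[X in (_ + X)%N]mul1n -mulnDl addn1 prednK // mulnn.
  by rewrite frobD -exprM -expnS addrC.
have e2 : u ^+ q = x ^+ (q ^ 2) + x ^+ q by rewrite frobD1 -exprM mulnn.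
rewrite exprSr mulrBr mulrBl mul1r mulrBl e1 mul1r e2 /u /trace_q; ring.
Qed.
End Frobenius.

Section Derivative.
Variables (q : nat) (R : comNzRingType) (hR : pchar_power q R).
Implicit Types l : {poly R}.
Let q1 := pchar_power_gt1 hR.
Let hRX : pchar_power q {poly R} := pchar_power_poly hR.

Lemma deriv_frob n l : (l ^+ (q ^ n.+1))^`() = 0.
Proof. by rewrite deriv_exp -mulr_natr (natqX0 hRX) mulr0. Qed.

Lemma deriv_frob1 l : (l ^+ q)^`() = 0.
Proof. by have := deriv_frob 0 l; rewrite expn1. Qed.

Lemma deriv_trace_q l : (trace_q q l)^`() = l^`().
Proof. by rewrite derivD deriv_frob1 add0r. Qed.

(** The factor [- (q - 1)] is [1] in characteristic [p]. *)
Lemma deriv_alpha l : (alpha q l)^`() = l^`() * trace_q q l ^+ (q - 2).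
Proof.
rewrite derivB deriv_exp -[1]/(1%:P) derivC deriv_trace_q sub0r.
have -> : (q - 1).-1 = (q - 2)%N by lia.
by rewrite -mulr_natr natrB ?(ltnW q1) // (natq0 hRX) sub0r mulrN1 opprK.
Qed.

Lemma deriv_curve_A l : (curve_A q l)^`() = alpha q l ^+ q * l^`().
Proof.
by rewrite derivM deriv_frob1 mul0r add0r derivB (deriv_frob 1) subr0.
Qed.
End Derivative.

(** * Restriction of the curve to a line *)

Lemma size_curve_A q (R : comNzRingType) (l : {poly R}) : pchar_power q R ->
  (size l <= 2)%N -> (size (curve_A q l) <= (q ^ 3).+1)%N.
Proof.
move=> hR sl; have q1 := pchar_power_gt1 hR.
rewrite (curve_AE (pchar_power_poly hR)).
have sX n : (size (l ^+ n) <= n.+1)%N.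
  apply: leq_trans (size_poly_exp_leq _ _) _; rewrite ltnS -{2}[n]mul1n leq_mul2r.
  by case: (size l) sl => [|[|[]]] // _; rewrite orbT.
have q3 : (q <= q ^ 3)%N by rewrite -{1}[q]expn1 leq_pexp2l // ltnW.
have q31 : (1 <= q ^ 3)%N by rewrite expn_gt0 (ltnW q1).
rewrite (leq_trans (size_polyD _ _)) // geq_max size_polyN; apply/andP; split.
  rewrite (leq_trans (size_polyD _ _)) // geq_max sX (leq_trans sl) //.
apply: leq_trans (size_poly_exp_leq _ _) _.
have st : (size (l ^+ q + l)%R <= q.+1)%N.
  rewrite (leq_trans (size_polyD _ _)) // geq_max sX (leq_trans sl) //.
  by rewrite ltnS (ltnW q1).
rewrite ltnS; apply: leq_trans (_ : q * (q ^ 2 - q + 1) <= _)%N.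
  by rewrite leq_mul2r; apply/orP; right; move: st; case: (size _).
have -> : (q * (q ^ 2 - q + 1) = q ^ 3 - q ^ 2 + q)%N.
  by rewrite mulnDr mulnBr muln1 -expnS mulnn.
have h1 : (q <= q ^ 2)%N by rewrite -{1}[q]expn1 leq_pexp2l // ltnW.
have h2 : (q ^ 2 <= q ^ 3)%N by rewrite leq_pexp2l // ltnW.
lia.
Qed.

Section LineRestriction.
Variables (q : nat) (k : fieldType) (hk : pchar_power q k).
Let q1 : (1 < q)%N := pchar_power_gt1 hk.
Let hkX : pchar_power q {poly k} := pchar_power_poly hk.
Let N := (q ^ 3).+1.

Lemma curve_A_eq0 (x : k) : (curve_A q x == 0) = (x ^+ (q ^ 2) == x).
Proof.
rewrite (curve_A_trace hk) mulf_eq0 expf_eq0 /= -mulf_eq0 (trace_alpha hk).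
by rewrite subr_eq0 eq_sym.
Qed.

Lemma horner_trace_q (l : {poly k}) v : (trace_q q l).[v] = trace_q q l.[v].
Proof. exact: (rmorph_trace_q q (horner_eval v)). Qed.

(** Lines are parametrized by [z], with slope [tau = dx / dz]; only the lines through [(1:0:0)] are
    left out. *)
Definition line (x0 z0 tau : k) : {poly k} := x0%:P + tau *: ('X - z0%:P).

Definition line_restriction x0 z0 tau : {poly k} :=
  'X^N - curve_A q (line x0 z0 tau).

Lemma lineE x0 z0 tau v : (line x0 z0 tau).[v] = x0 + tau * (v - z0).
Proof. by rewrite !hornerE. Qed.

Lemma deriv_line x0 z0 tau : (line x0 z0 tau)^`() = tau%:P.
Proof. by rewrite derivD derivC add0r derivZ derivXsubC alg_polyC. Qed.

Lemma horner_curve_A (l : {poly k}) v : (curve_A q l).[v] = curve_A q l.[v].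
Proof. exact: (rmorph_curve_A q (horner_eval v)). Qed.

Lemma horner_alpha (l : {poly k}) v : (alpha q l).[v] = alpha q l.[v].
Proof. exact: (rmorph_alpha q (horner_eval v)). Qed.

Lemma line_restrictionE x0 z0 tau v :
  (line_restriction x0 z0 tau).[v] = v ^+ N - curve_A q (x0 + tau * (v - z0)).
Proof. by rewrite hornerD hornerN hornerXn horner_curve_A lineE. Qed.

Lemma deriv_line_restriction x0 z0 tau v :
  (line_restriction x0 z0 tau)^`().[v] =
  v ^+ (q ^ 3) - alpha q (x0 + tau * (v - z0)) ^+ q * tau.
Proof.
rewrite derivB derivXn (deriv_curve_A hk) deriv_line.
rewrite !(hornerD, hornerN, hornerM, hornerMn, hornerXn, hornerC) /=.
rewrite -mulr_natr -natr1 (natqX0 hk) add0r mulr1.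
by rewrite horner_exp horner_alpha lineE.
Qed.

(** Differentiating the curve gives [z ^ (q ^ 3) dz = alpha x ^ q dx]: the exponent [N] is [1] in
    [k], and powers with exponent divisible by [q] are constants for the derivation. *)
Definition tangent_slope x0 z0 tau := alpha q x0 ^+ q * tau = z0 ^+ (q ^ 3) :> k.

(** Put [S = z - z0]. Up to multiples of [S ^ q], the curve restricted to the line has degree at
    most one in [S], and its two coefficients vanish by incidence and tangency. The cofactor of
    [S ^ q] takes at [z0] the value [- a1(z0) ^ q * (x0 - x0 ^ (q ^ 2))], where [a1] is the
    difference quotient of [alpha]; this is nonzero because [curve_A x0] is. *)
Lemma tangent_mup x0 z0 tau : z0 != 0 -> z0 ^+ N = curve_A q x0 ->
  tangent_slope x0 z0 tau -> mup z0 (line_restriction x0 z0 tau) = q.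
Proof.
move=> z00 onC tan.
have q0 := ltnW q1.
have A0 : curve_A q x0 != 0 by rewrite -onC expf_neq0.
have tau0 : tau != 0.
  apply/eqP => t0; have := expf_neq0 (q ^ 3) z00.
  by rewrite -tan t0 mulr0 eqxx.
have u0 : trace_q q x0 != 0.
  by apply: contraNneq A0 => u0; rewrite (curve_A_trace hk) u0 mul0r.
have B0 : x0 - x0 ^+ (q ^ 2) != 0.
  by apply: contraNneq A0 => B0; rewrite /curve_A B0 mulr0.
set S : {poly k} := 'X - z0%:P; set l := line x0 z0 tau.
have lz0 : l.[z0] = x0 by rewrite lineE subrr mulr0 addr0.
have /factor_theorem[a1 e1] : root (alpha q l - (alpha q x0)%:P) z0.
  by rewrite rootE hornerD hornerN hornerC horner_alpha lz0 subrr.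
have a1z0 : a1.[z0] = tau * trace_q q x0 ^+ (q - 2).
  have := congr1 (fun p : {poly k} => p^`().[z0]) e1.
  rewrite derivB derivC subr0 (deriv_alpha hk) deriv_line derivM derivXsubC.
  rewrite mulr1 hornerD !hornerM hornerXsubC subrr mulr0 add0r => <-.
  rewrite hornerC horner_exp.
  by rewrite horner_trace_q lz0.
have alE : alpha q l ^+ q = (alpha q x0 ^+ q)%:P + S ^+ q * a1 ^+ q.
  have -> : alpha q l = (alpha q x0)%:P + S * a1.
    by rewrite mulrC -e1 addrC subrK.
  by rewrite (frobD1 hkX) exprMn -rmorphXn.
have lE : l - l ^+ (q ^ 2) = (x0 - x0 ^+ (q ^ 2))%:P + tau%:P * S
    - (tau ^+ (q ^ 2))%:P * S ^+ (q ^ 2).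
  rewrite /l /line -mul_polyC -/S (frobD hkX) exprMn -!rmorphXn rmorphB /=; ring.
have XE : 'X = z0%:P + S :> {poly k} by rewrite addrC subrK.
have XNE : 'X^N = ((z0 ^+ (q ^ 3))%:P + S ^+ (q ^ 3)) * 'X.
  by rewrite exprSr {1}XE (frobD hkX) -rmorphXn.
(* The three summands are the higher terms of ['X^N], of [l ^ (q ^ 2)] and of [alpha ^ q], each
   divided by [S ^ q]. *)
pose V := S ^+ (q ^ 3 - q) * 'X
  + (alpha q x0 ^+ q * tau ^+ (q ^ 2))%:P * S ^+ (q ^ 2 - q)
  - a1 ^+ q * (l - l ^+ (q ^ 2)).
have le2 : (q < q ^ 2)%N by rewrite -[X in (X < _)%N]expn1 ltn_exp2l.
have le3 : (q < q ^ 3)%N by rewrite -[X in (X < _)%N]expn1 ltn_exp2l.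
have LE : line_restriction x0 z0 tau = S ^+ q * V.
  rewrite /line_restriction -/l /curve_A alE XNE.
  have -> : S ^+ (q ^ 3) = S ^+ q * S ^+ (q ^ 3 - q) by rewrite -exprD subnKC // ltnW.
  rewrite /V lE.
  have -> : S ^+ (q ^ 2) = S ^+ q * S ^+ (q ^ 2 - q) by rewrite -exprD subnKC // ltnW.
  have h1 : (z0 ^+ (q ^ 3))%:P = (alpha q x0 ^+ q)%:P * tau%:P :> {poly k}.
    by rewrite -rmorphM /= tan.
  have h2 : (z0 ^+ (q ^ 3))%:P * z0%:P =
      (alpha q x0 ^+ q)%:P * (x0 - x0 ^+ (q ^ 2))%:P :> {poly k}.
    by rewrite -!rmorphM /= -exprSr onC.
  have -> : ((z0 ^+ (q ^ 3))%:P + S ^+ q * S ^+ (q ^ 3 - q)) * 'X =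
      (alpha q x0 ^+ q)%:P * (x0 - x0 ^+ (q ^ 2))%:P +
      (alpha q x0 ^+ q)%:P * tau%:P * S + S ^+ q * S ^+ (q ^ 3 - q) * 'X.
    by rewrite mulrDl {1}XE mulrDr h2 h1.
  rewrite rmorphM /=; ring.
rewrite LE mupMl.
  by rewrite mup_XsubCX eqxx.
have lz : (l - l ^+ (q ^ 2)).[z0] = x0 - x0 ^+ (q ^ 2).
  by rewrite hornerD hornerN horner_exp lz0.
have Sz n : (0 < n)%N -> (S ^+ n).[z0] = 0.
  by move=> n0; rewrite horner_exp hornerXsubC subrr expr0n gtn_eqF.
rewrite rootE /V 2!hornerD hornerN 3!hornerM lz (horner_exp a1) !Sz ?subn_gt0 //.
rewrite mul0r mulr0 !add0r oppr_eq0 a1z0.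
by rewrite mulf_neq0 // expf_neq0 // mulf_neq0 // expf_neq0.
Qed.

Lemma mup_deriv (r : {poly k}) v : (1 < mup v r)%N -> r^`().[v] = 0.
Proof.
move=> m1; have [->|r0] := eqVneq r 0; first by rewrite deriv0 horner0.
move: m1; rewrite mup_geq // => /dvdpP[s ->].
rewrite expr2 !derivM derivXsubC mul1r mulr1 hornerD !hornerM hornerXsubC.
by rewrite (hornerD ('X - _)) hornerXsubC subrr !(mulr0, addr0).
Qed.

Lemma line_restriction_shift x0 z0 tau v :
  line_restriction (x0 + tau * (v - z0)) v tau = line_restriction x0 z0 tau.
Proof.
rewrite /line_restriction /line; congr (_ - curve_A q _).
by rewrite -!mul_polyC !(rmorphD, rmorphM, rmorphB) /=; ring.
Qed.

Lemma tangent_of_mup x0 z0 tau v : (1 < mup v (line_restriction x0 z0 tau))%N ->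
  v ^+ N = curve_A q (x0 + tau * (v - z0)) /\
  tangent_slope (x0 + tau * (v - z0)) v tau.
Proof.
move=> m1; split.
  apply/eqP; rewrite -subr_eq0 -line_restrictionE -[_ == 0]/(root _ v).
  by apply: contraTT m1 => /mupNroot ->.
apply/eqP; rewrite eq_sym -subr_eq0 -deriv_line_restriction; apply/eqP.
exact: mup_deriv.
Qed.

Lemma size_line x0 z0 tau : (size (line x0 z0 tau) <= 2)%N.
Proof.
rewrite (leq_trans (size_polyD _ _)) // geq_max (leq_trans (size_polyC_leq1 _)) //.
by rewrite (leq_trans (size_scale_leq _ _)) ?size_XsubC.
Qed.

(* At [z = 0] the factor [x - x ^ (q ^ 2)] has a simple zero and [alpha ^ q] a
   zero of order divisible by [q]. *)
Lemma mup_at_z0 x0 z0 tau : tau != 0 -> root (line_restriction x0 z0 tau) 0 ->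
  ~~ (q %| mup 0%R (line_restriction x0 z0 tau))%N.
Proof.
move=> tau0 r0; set l := line x0 z0 tau; pose x1 := x0 - tau * z0.
have lE : l = x1%:P + tau%:P * 'X.
  by rewrite /l /line -mul_polyC rmorphB rmorphM /=; ring.
have Ax1 : curve_A q x1 == 0.
  move: r0; rewrite rootE line_restrictionE expr0n sub0r oppr_eq0.
  by rewrite sub0r mulrN.
have BE : l - l ^+ (q ^ 2) = 'X * (tau%:P - (tau ^+ (q ^ 2))%:P * 'X^(q ^ 2 - 1)).
  rewrite lE (frobD hkX) exprMn -!rmorphXn /=.
  move: Ax1; rewrite curve_A_eq0 => /eqP ->.
  have -> : 'X^(q ^ 2) = 'X * 'X^(q ^ 2 - 1) :> {poly k}.
    by rewrite -exprS subn1 prednK // expn_gt0 (ltnW q1).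
  ring.
have B1 : ~~ root (tau%:P - (tau ^+ (q ^ 2))%:P * 'X^(q ^ 2 - 1)) 0.
  rewrite rootE !(hornerE, horner_exp) expr0n subn_eq0 leqNgt.
  by rewrite -(exp1n 2) ltn_exp2r // q1 mulr0 subr0.
have B0 : l - l ^+ (q ^ 2) != 0.
  rewrite BE mulf_neq0 ?polyX_eq0 //.
  by apply: contraNneq B1 => ->; rewrite root0.
have mupX n : mup 0 ('X^n : {poly k}) = n.
  by have := mup_XsubCX n (0 : k) 0; rewrite subr0 eqxx.
have mB : mup 0 (l - l ^+ (q ^ 2)) = 1%N.
  by rewrite BE mupMl // (mupX 1).
have al0 : alpha q l != 0.
  apply: contraNneq B0 => al0; by rewrite -(trace_alpha hkX) al0 mulr0.
have mX n : mup 0 (alpha q l ^+ n) = (n * mup 0%R (alpha q l))%N.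
  elim: n => [|n IH]; first by rewrite mupNroot // root1.
  by rewrite exprS mupM ?expf_neq0 // IH mulSn.
have AN0 : curve_A q l != 0 by rewrite mulf_neq0 // expf_neq0.
have mA : mup 0 (curve_A q l) = (q * mup 0%R (alpha q l) + 1)%N.
  by rewrite /curve_A mupM ?expf_neq0 // mX mB.
have [m [g]] := multiplicity_XsubC (curve_A q l) 0; rewrite AN0 /= => g0 gE.
rewrite subr0 in gE.
have mE : m = (q * mup 0%R (alpha q l) + 1)%N by rewrite -mA gE mupMr // mupX.
(* The order of [curve_A l] at [0] is at most its degree, so ['X^N] vanishes to higher order and
   does not change it. *)
have mN : (m < N)%N.
  have : (m < size (curve_A q l))%N.
    rewrite gE size_Mmonic ?monicXn //; last by apply: contraNneq g0 => ->; rewrite root0.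
    rewrite size_polyXn addnS /=; have : (0 < size g)%N.
      by rewrite size_poly_gt0; apply: contraNneq g0 => ->; rewrite root0.
    by rewrite -[X in _ -> (X < _)%N]add0n ltn_add2r.
  by move=> /leq_trans; apply; rewrite size_curve_A // size_line.
have -> : line_restriction x0 z0 tau = ('X^(N - m) - g) * 'X^m.
  by rewrite /line_restriction -/l gE mulrBl -exprD subnK // ltnW.
rewrite mupMr; first by rewrite mupX mE dvdn_addr ?dvdn_mulr // dvdn1 gtn_eqF.
rewrite rootE hornerD hornerN hornerXn expr0n subn_eq0 leqNgt mN sub0r oppr_eq0.
by [].
Qed.

End LineRestriction.

(** * Tangent lines through a given point *)

Lemma closed_field_nth_root (k : closedFieldType) n (a : k) :
  (0 < n)%N -> exists x, x ^+ n = a.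
Proof.
move=> n0; have [|x] := @closed_rootP k ('X^n - a%:P) _.
  by rewrite size_XnsubC // eqSS gtn_eqF.
by rewrite rootE !hornerE subr_eq0 => /eqP; exists x.
Qed.

Section TangentPoints.
Variables (q : nat) (k : closedFieldType) (hk : pchar_power q k).
Let q1 : (1 < q)%N := pchar_power_gt1 hk.
Let q0 : (0 < q)%N := ltnW q1.
Let hkX : pchar_power q {poly k} := pchar_power_poly hk.
Let N := (q ^ 3).+1.

Lemma frob_inj : injective (fun x : k => x ^+ q).
Proof.
move=> x y /= e; apply/eqP; rewrite -subr_eq0; have := frobB1 hk x y; rewrite e subrr.
by move/eqP; rewrite expf_eq0 => /andP[].
Qed.

(* [tangent_poly a' b'] vanishes exactly at the abscissas of the curve points
   whose tangent passes through [(a' ^ q, b' ^ q)]. *)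
Definition tangent_poly (a' b' : k) : {poly k} :=
  (a'%:P - 'X^q) ^+ N
  - (b' ^+ N)%:P * (trace_q q 'X ^+ (q ^ 2) * alpha q 'X ^+ (q ^ 2 - 1)).

Lemma tangent_polyE a' b' x : (tangent_poly a' b').[x] = (a' - x ^+ q) ^+ N
  - b' ^+ N * (trace_q q x ^+ (q ^ 2) * alpha q x ^+ (q ^ 2 - 1)).
Proof.
rewrite /tangent_poly hornerD hornerN !hornerM !horner_exp hornerD hornerN.
by rewrite !hornerC hornerXn horner_trace_q horner_alpha hornerX.
Qed.

(** The degree is at most [q ^ 3 + q (q - 1) (q ^ 2 - 1) = q ^ 4 - q ^ 2 + q], below [q * N]; hence
    the first term of [tangent_poly] dominates. *)
Lemma size_trace_alpha : let t := trace_q q ('X : {poly k}) in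
  let al := alpha q ('X : {poly k}) in
  [/\ t != 0, al != 0 & (size (t ^+ (q ^ 2) * al ^+ (q ^ 2 - 1))%R <= q * N)%N].
Proof.
move=> t al.
have st : size t = q.+1.
  by rewrite /t /trace_q size_polyDl ?size_polyXn // size_polyX.
have t0 : t != 0 by rewrite -size_poly_eq0 st.
have sal : (size al <= (q * (q - 1)).+1)%N.
  rewrite (leq_trans (size_polyD _ _)) // geq_max size_polyN size_poly1 ltnS leq0n /=.
  by rewrite (leq_trans (size_poly_exp_leq _ _)) // st.
have al0 : al != 0.
  apply/eqP => al0.
  move/eqP: al0; rewrite /al /alpha subr_eq0 eq_sym -/t => /eqP.
  move/(congr1 (fun p : {poly k} => (size p).-1)); rewrite size_poly1 => /eqP.
  have q10 : (0 < q - 1)%N by rewrite subn_gt0.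
  by rewrite size_exp st /= muln_eq0 (gtn_eqF q0) (gtn_eqF q10).
split=> //.
apply: leq_trans (size_polyMleq _ _) _.
have h1 := size_poly_exp_leq t (q ^ 2); have h2 := size_poly_exp_leq al (q ^ 2 - 1).
rewrite st /= in h1.
have h3 : (size (al ^+ (q ^ 2 - 1))%R <= (q * (q - 1) * (q ^ 2 - 1)).+1)%N.
  apply: leq_trans h2 _; rewrite ltnS leq_mul2r; apply/orP; right.
  by move: sal; case: (size al).
apply: (@leq_trans ((q * q ^ 2).+1 + (q * (q - 1) * (q ^ 2 - 1)).+1).-1).
  by rewrite -!subn1 leq_sub2r // leq_add.
have -> : N = (q ^ 2 * q).+1 by rewrite /N -expnSr.
have : (q <= q ^ 2)%N by rewrite -{1}[q]expn1 leq_pexp2l.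
rewrite -mulnn; nia.
Qed.

Lemma size_tangent_poly a' b' : size (tangent_poly a' b') = (q * N).+1.
Proof.
have [_ _ s2] := size_trace_alpha.
have s1 : size ((a'%:P - 'X^q) ^+ N : {poly k}) = (q * N).+1.
  have sl : size (a'%:P - 'X^q : {poly k}) = q.+1.
    by rewrite -opprB size_polyN size_XnsubC.
  have : (a'%:P - 'X^q) ^+ N != 0 :> {poly k}.
    by rewrite expf_neq0 // -size_poly_eq0 sl.
  by move=> n0; rewrite (polySpred n0) size_exp sl.
rewrite /tangent_poly size_polyDl ?s1 // size_polyN.
by rewrite mul_polyC ltnS (leq_trans (size_scale_leq _ _)).
Qed.

(** Only the factor [alpha ^ (q ^ 2 - 1)] has a nonzero derivative. For nonzero [b'], multiple roots
    can thus occur only where [trace_q] or [alpha] vanishes. *)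
Lemma deriv_tangent_poly a' b' x : (tangent_poly a' b')^`().[x] =
  b' ^+ N * (trace_q q x ^+ (q ^ 2) *
    (trace_q q x ^+ (q - 2) * alpha q x ^+ (q ^ 2 - 2))).
Proof.
rewrite /tangent_poly derivB deriv_exp derivB derivC sub0r (deriv_frob1 hk).
rewrite oppr0 mul0r mul0rn sub0r derivM derivC mul0r add0r derivM.
rewrite (deriv_frob hk) mul0r add0r deriv_exp (deriv_alpha hk) derivX mul1r.
have -> : ((q ^ 2 - 1).-1 = q ^ 2 - 2)%N by lia.
rewrite -(mulr_natr (_ * _)) natrB ?expn_gt0 ?q0 // (natqX0 hkX) sub0r.
rewrite !mulrN1 !mulrN opprK !hornerM !horner_exp horner_trace_q horner_alpha.
by rewrite hornerX hornerC.
Qed.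

(* The tangent to the curve at [(x, z)] passes through [(a, b)]. *)
Definition tangent_through (a b x z : k) :=
  [/\ z != 0, z ^+ N = curve_A q x
    & alpha q x ^+ q * (x - a) = z ^+ (q ^ 3) * (z - b)].

(** This is the quotient of [b * z ^ N] by [b * z ^ (q ^ 3)], both of which incidence and tangency
    express by [x]. *)
Definition tangent_ordinate (a b x : k) :=
  b * (trace_q q x * alpha q x) / (a - x ^+ (q ^ 2)).

(** Incidence and tangency combine to [b * z ^ (q ^ 3) = alpha x ^ q * (a - x ^ (q ^ 2))], an
    equality of [q]-th powers once [a = a' ^ q] and [b = b' ^ q]. Its [q]-th root, raised to the
    power [N], contains [z] only through [z ^ N], which the curve eliminates; this is the origin of
    [tangent_poly]. *)
Lemma tangent_point_root a' b' x z : b' != 0 -> tangent_through (a' ^+ q) (b' ^+ q) x z ->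
  root (tangent_poly a' b') x /\
  z = tangent_ordinate (a' ^+ q) (b' ^+ q) x.
Proof.
move=> b0 [z0 onC tan].
have A0 : curve_A q x != 0 by rewrite -onC expf_neq0.
have al0 : alpha q x != 0.
  by apply: contraNneq A0 => al0; rewrite (curve_A_trace hk) al0 expr0n mulr0.
have e1 : b' ^+ q * z ^+ (q ^ 3) = alpha q x ^+ q * (a' ^+ q - x ^+ (q ^ 2)).
  have : z ^+ (q ^ 3) * (z - b' ^+ q) = z ^+ N - b' ^+ q * z ^+ (q ^ 3).
    by rewrite /N exprS; ring.
  rewrite -tan onC /curve_A => h.
  transitivity (alpha q x ^+ q * (x - x ^+ (q ^ 2)) -
     (alpha q x ^+ q * (x - x ^+ (q ^ 2)) - b' ^+ q * z ^+ (q ^ 3))); first by ring.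
  by rewrite -h; ring.
have e2 : b' * z ^+ (q ^ 2) = alpha q x * (a' - x ^+ q).
  apply: frob_inj; rewrite /= !exprMn -exprM -expnSr e1 (frobB1 hk a') -exprM.
  by rewrite mulnn.
split.
  rewrite rootE tangent_polyE subr_eq0; apply/eqP.
  apply: (mulfI (expf_neq0 N al0)); rewrite -exprMn -e2 exprMn -exprM mulnC.
  rewrite [z ^+ _]exprM onC (curve_A_trace hk) exprMn -exprM.
  (* Cancelling [alpha ^ N] leaves the exponent [q ^ 2 - 1] of [alpha] in [tangent_poly]. *)
  have -> : (q.+1 * q ^ 2 = N + (q ^ 2 - 1))%N.
    rewrite mulSn -expnS addnC /N; have : (0 < q ^ 2)%N by rewrite expn_gt0 q0.
    lia.
  by rewrite exprD; ring.
have d0 : a' ^+ q - x ^+ (q ^ 2) != 0.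
  apply/eqP => d0; move: e1; rewrite d0 mulr0 => /eqP.
  by rewrite mulf_eq0 !expf_eq0 (negPf z0) (negPf b0) !andbF.
apply: (mulIf d0); rewrite /tangent_ordinate divfK //.
apply: (mulfI (expf_neq0 q al0)).
rewrite mulrCA -e1.
transitivity (b' ^+ q * z ^+ N); first by rewrite /N exprS; ring.
by rewrite onC (curve_A_trace hk) exprS; ring.
Qed.

(** The elimination read backwards. It needs [trace_q * alpha] nonzero, because [alpha] was
    cancelled and the ordinate has to be nonzero. *)
Lemma tangent_root_point a' b' x : b' != 0 ->
  root (tangent_poly a' b') x -> trace_q q x * alpha q x != 0 ->
  tangent_through (a' ^+ q) (b' ^+ q) x (tangent_ordinate (a' ^+ q) (b' ^+ q) x).
Proof.
move=> b0; rewrite rootE tangent_polyE subr_eq0 => /eqP rt.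
rewrite mulf_eq0 negb_or => /andP[t0 al0].
set d := a' - x ^+ q.
have d0 : d != 0.
  apply/eqP => d00; move/eqP: rt; rewrite -/d d00 expr0n /= eq_sym.
  by rewrite !(mulf_eq0, expf_eq0) (negPf b0) (negPf t0) (negPf al0) !andbF.
have dq : a' ^+ q - x ^+ (q ^ 2) = d ^+ q by rewrite /d (frobB1 hk) -exprM mulnn.
rewrite /tangent_through /tangent_ordinate dq.
set z := b' ^+ q * (trace_q q x * alpha q x) / d ^+ q.
have z0 : z != 0 by rewrite !mulf_neq0 ?invr_eq0 ?expf_neq0.
have dz : d ^+ q * z = b' ^+ q * (trace_q q x * alpha q x).
  by rewrite mulrC divfK // expf_neq0.
clearbody z.
have e2 : b' * z ^+ (q ^ 2) = alpha q x * d.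
  have dN : d ^+ N = d ^+ (q ^ 3) * d by rewrite exprSr.
  apply: (mulfI (expf_neq0 (q ^ 3) d0)).
  transitivity (b' * (d ^+ q * z) ^+ (q ^ 2)).
    by rewrite exprMn -exprM -expnS; ring.
  rewrite dz !exprMn -exprM -expnS.
  have -> : alpha q x ^+ (q ^ 2) = alpha q x * alpha q x ^+ (q ^ 2 - 1).
    by rewrite -exprS subn1 prednK // expn_gt0 q0.
  transitivity (alpha q x * (b' ^+ N *
    (trace_q q x ^+ (q ^ 2) * alpha q x ^+ (q ^ 2 - 1)))).
    by rewrite /N exprS; ring.
  by rewrite -rt -/d dN; ring.
have e3 : b' ^+ q * z ^+ (q ^ 3) = alpha q x ^+ q * d ^+ q.
  by rewrite -exprMn -e2 exprMn -exprM -expnSr.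
have onC : z ^+ N = curve_A q x.
  apply: (mulfI (expf_neq0 q (mulf_neq0 b0 d0))).
  transitivity (d ^+ q * z * (b' ^+ q * z ^+ (q ^ 3))).
    by rewrite /N exprS exprMn; ring.
  by rewrite dz e3 (curve_A_trace hk) exprS exprMn; ring.
split=> //.
transitivity (z ^+ N - b' ^+ q * z ^+ (q ^ 3)); last by rewrite /N exprS; ring.
rewrite onC e3 /curve_A -dq; ring.
Qed.

Lemma tangent_point_exists a b : b ^+ N != curve_A q a ->
  exists x z : k, tangent_through a b x z.
Proof.
move=> outer.
have [b' bE] := closed_field_nth_root b q0.
have [a' aE] := closed_field_nth_root a q0.
(* For a center with [b = 0], any [x] with [x ^ (q ^ 2) = a] works: then [alpha x ^ q * (x - a)] is
   [curve_A x = z ^ N]. *)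
have [b0|b0] := eqVneq b' 0.
  have [x xE] := closed_field_nth_root a' q0.
  have xE2 : x ^+ (q ^ 2) = a by rewrite -mulnn exprM xE aE.
  have [z onC] := @closed_field_nth_root _ N (curve_A q x) isT.
  have bb : b = 0 by rewrite -bE b0 expr0n gtn_eqF.
  exists x, z; split=> //.
    apply: contraNneq outer => z0.
    have : curve_A q x == 0 by rewrite -onC z0 expr0n.
    rewrite (curve_A_eq0 hk) => /eqP e.
    by rewrite bb -xE2 e -onC z0.
  rewrite bb subr0 -exprSr -/N onC /curve_A xE2; ring.
have [t0 al0 s2] := size_trace_alpha.
have S0 : tangent_poly a' b' != 0 by rewrite -size_poly_eq0 size_tangent_poly.
suff [x [rx tx]] : exists x, root (tangent_poly a' b') x /\ trace_q q x * alpha q x != 0.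
  exists x, (tangent_ordinate a b x).
  by rewrite -aE -bE; apply: tangent_root_point.
have [r rE] := closed_field_poly_normal (tangent_poly a' b').
set lc := lead_coef _ in rE; have lc0 : lc != 0 by rewrite lead_coef_eq0.
clearbody lc.
have [/hasP[x xr tx]|/hasPn all0] := boolP (has (fun x => trace_q q x * alpha q x != 0) r).
  exists x; split=> //; rewrite rE rootZ //.
  by rewrite root_prod_XsubC.
(* Otherwise every root satisfies [x ^ q = a'], so [tangent_poly] is a multiple of
   [('X - a2) ^ (q * N)]. So is its first term, hence also the second, which is nonzero and of
   smaller degree. *)
exfalso; have [a2 a2E] := closed_field_nth_root a' q0.
have ra x : x \in r -> x = a2.
  move=> xr; have /negPn/eqP tx := all0 _ xr.
  have : root (tangent_poly a' b') x.
    by rewrite rE rootZ // root_prod_XsubC.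
  rewrite rootE tangent_polyE.
  have -> : trace_q q x ^+ (q ^ 2) * alpha q x ^+ (q ^ 2 - 1) = 0.
    have q20 : (0 < q ^ 2 - 1)%N.
      by rewrite subn_gt0 -(exp1n 2) ltn_exp2r.
    move/eqP: tx; rewrite mulf_eq0 => /orP[] /eqP ->.
      by rewrite expr0n expn_eq0 (gtn_eqF q0) mul0r.
    by rewrite expr0n (gtn_eqF q20) mulr0.
  rewrite mulr0 subr0 expf_eq0 /= subr_eq0 -a2E => /eqP e.
  by apply/esym/frob_inj.
have prE : \prod_(x <- r) ('X - x%:P) = ('X - a2%:P) ^+ size r.
  elim: r ra {rE all0} => [|x r IH] ra; first by rewrite big_nil.
  rewrite big_cons exprS IH => [|y yr]; last by apply: ra; rewrite inE yr orbT.
  by rewrite (ra x) // mem_head.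
have szr : size r = (q * N)%N.
  have := size_tangent_poly a' b'.
  by rewrite rE size_scale // prE size_exp_XsubC => -[].
have e1 : (a'%:P - 'X^q) ^+ N = (-1) ^+ (q * N) *: ('X - a2%:P) ^+ (q * N).
  have -> : a'%:P - 'X^q = (a2%:P - 'X) ^+ q :> {poly k}.
    by rewrite (frobB1 hkX) -rmorphXn /= a2E.
  by rewrite -exprM -opprB -scaleN1r exprZn.
have := rE; rewrite /tangent_poly e1 prE szr.
move=> e2.
have e3 : (b' ^+ N)%:P * (trace_q q 'X ^+ (q ^ 2) * alpha q 'X ^+ (q ^ 2 - 1)) =
   ((-1) ^+ (q * N) - lc) *: ('X - a2%:P) ^+ (q * N).
  by rewrite scalerBl -e2 opprB addrC subrK.
have nz : (b' ^+ N)%:P * (trace_q q 'X ^+ (q ^ 2) * alpha q 'X ^+ (q ^ 2 - 1)) != 0 :> {poly k}.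
  by rewrite !mulf_neq0 ?expf_neq0 // polyC_eq0 expf_neq0.
move: s2; rewrite -(size_scale _ (expf_neq0 N b0)) -mul_polyC e3.
have [c0|c0] := eqVneq ((-1) ^+ (q * N) - lc) 0.
  by move: nz; rewrite e3 c0 scale0r eqxx.
by rewrite size_scale // size_exp_XsubC ltnn.
Qed.

(** The analogue for the center [(1 : b : 0)]. The same elimination gives [b' ^ N * trace_q ^ (q ^
    2) * alpha ^ (q ^ 2 - 1) = 1], and dividing [z ^ N] by [z ^ (q ^ 3)] gives the ordinate
    [b * trace_q * alpha]. *)
Lemma tangent_direction_exists (b : k) : b != 0 -> exists x z : k,
  [/\ z != 0, z ^+ N = curve_A q x & alpha q x ^+ q = b * z ^+ (q ^ 3)].
Proof.
move=> b0; have [b' bE] := closed_field_nth_root b q0.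
have b'0 : b' != 0.
  by apply: contraNneq b0 => b'0; rewrite -bE b'0 expr0n gtn_eqF.
have [t0 al0 _] := size_trace_alpha.
pose P : {poly k} := (b' ^+ N)%:P *
  (trace_q q ('X : {poly k}) ^+ (q ^ 2) * alpha q ('X : {poly k}) ^+ (q ^ 2 - 1)) - 1.
(* The product vanishes at [0], as [trace_q] does, but is not the zero polynomial; so it is not
   constant. *)
have szP : (1 < size P)%N.
  rewrite ltnNge; apply/negP => /size1_polyC; set c := P`_0 => Pc.
  have e : (b' ^+ N)%:P * (trace_q q 'X ^+ (q ^ 2) * alpha q 'X ^+ (q ^ 2 - 1))
      = (1 + c)%:P :> {poly k}.
    by rewrite rmorphD /= -Pc /P addrC subrK.
  have := congr1 (fun p : {poly k} => p.[0]) e.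
  rewrite !hornerM !horner_exp !hornerC horner_trace_q hornerX.
  have -> : trace_q q (0 : k) = 0 by rewrite /trace_q addr0 expr0n gtn_eqF.
  rewrite expr0n expn_eq0 (gtn_eqF q0) /= mul0r mulr0 => c0.
  have : (b' ^+ N)%:P * (trace_q q 'X ^+ (q ^ 2) * alpha q 'X ^+ (q ^ 2 - 1)) != 0 :> {poly k}.
    by rewrite !mulf_neq0 ?expf_neq0 // polyC_eq0 expf_neq0.
  by rewrite e -c0 eqxx.
have [|x] := @closed_rootP _ P _; first by rewrite gtn_eqF.
rewrite rootE /P hornerD hornerN !hornerM !horner_exp !hornerC.
rewrite horner_trace_q horner_alpha hornerX subr_eq0 => /eqP rt.
set t := trace_q q x in rt *; set al := alpha q x in rt *.
have q20 : (0 < q ^ 2 - 1)%N by rewrite subn_gt0 -(exp1n 2) ltn_exp2r.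
have q21 : (0 < q ^ 2)%N by rewrite expn_gt0 q0.
have al0' : al != 0.
  apply/eqP => e; move/eqP: rt.
  by rewrite e expr0n (gtn_eqF q20) !mulr0 eq_sym oner_eq0.
have t0' : t != 0.
  apply/eqP => e; move/eqP: rt.
  by rewrite e expr0n (gtn_eqF q21) mul0r mulr0 eq_sym oner_eq0.
have e3 : al ^+ q = b * (b * (t * al)) ^+ (q ^ 3).
  have -> : (q ^ 3 = q ^ 2 * q)%N by rewrite -expnSr.
  rewrite exprM -{1}bE -exprMn; congr (_ ^+ q).
  rewrite -[LHS]mulr1 -rt -bE !exprMn -exprM -expnS.
  have -> : al ^+ (q ^ 2) = al * al ^+ (q ^ 2 - 1) by rewrite -exprS subn1 prednK.
  by rewrite /N exprS; ring.
exists x, (b * (t * al)); split; [by rewrite !mulf_neq0| |exact: e3].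
by rewrite /N exprS (curve_A_trace hk) -/t -/al exprS e3; ring.
Qed.

End TangentPoints.

(** * Affine charts of the projection *)

Lemma fraction_quotient (R : idomainType) (a : {fraction R}) :
  exists n d : R, d != 0 /\ a = tofrac n / tofrac d.
Proof.
elim/quotW: a => x; exists \n_x, \d_x.
have d0 := denom_ratioP x; split=> //.
apply: (canRL (mulfK _)); first by rewrite tofrac_eq0.
apply/eqP; rewrite !piE /FracField.equivf /FracField.mulf.
by rewrite !numden_Ratio ?mulf_neq0 ?oner_neq0 //= !mulr1 mulrC.
Qed.

Section Substitution.
Variables (k : fieldType) (K : comNzRingType) (phi : {rmorphism {mpoly k[2]} -> K}).

Lemma mpoly2_rmorph_ext (phi' : {rmorphism {mpoly k[2]} -> K}) :
  (forall c, phi c%:MP = phi' c%:MP) -> phi 'X_0 = phi' 'X_0 ->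
  phi 'X_1 = phi' 'X_1 -> phi =1 phi'.
Proof.
move=> hc h0 h1 g; elim/mpolyind: g => [|c m g _ _ IH]; first by rewrite !rmorph0.
rewrite !rmorphD IH -mul_mpolyC !rmorphM hc mpolyXE_id !rmorph_prod.
congr (_ * _ + _); apply: eq_bigr => i _; rewrite !rmorphXn; congr (_ ^+ _).
have [->|->] // : i = 0 \/ i = 1.
by case: i => [[|[|[]]] //= lt]; [left|right]; apply/val_inj.
Qed.
End Substitution.

Lemma gk_plane_modelE (k : fieldType) q : pchar_power q k ->
  gk_plane_model k q = curve_A q 'X_0 - 'X_1 ^+ (q ^ 3).+1.
Proof.
move=> hk; rewrite curve_AE; first by rewrite /gk_plane_model (addn1 (q ^ 3)).
exact: (pchar_power_rmorph (@mpolyC 2 k : {rmorphism k -> {mpoly k[2]}}) hk).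
Qed.

Section PolyEvaluation.
Variables (k : fieldType) (K : comNzRingType) (kap : {rmorphism k -> K}) (t z : K).

Definition eval_t : {rmorphism {poly k} -> K} :=
  (horner_eval t : {rmorphism {poly K} -> K}) \o (map_poly kap : {rmorphism {poly k} -> {poly K}}).

Definition eval_tz : {rmorphism {poly {poly k}} -> K} :=
  (horner_eval z : {rmorphism {poly K} -> K}) \o
  (map_poly eval_t : {rmorphism {poly {poly k}} -> {poly K}}).

Lemma eval_tC c : eval_t c%:P = kap c.
Proof. by rewrite /eval_t /= /horner_eval map_polyC hornerC. Qed.

Lemma eval_tX : eval_t 'X = t.
Proof. by rewrite /eval_t /= /horner_eval map_polyX hornerX. Qed.

Lemma eval_tzC c : eval_tz c%:P = eval_t c.
Proof. by rewrite -[LHS]/((map_poly eval_t c%:P).[z]) map_polyC hornerC. Qed.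

Lemma eval_tzX : eval_tz 'X = z.
Proof. by rewrite -[LHS]/((map_poly eval_t 'X).[z]) map_polyX hornerX. Qed.

End PolyEvaluation.

Section Chart.
Variables (q : nat) (k : closedFieldType) (hk : pchar_power q k).
Let N := (q ^ 3).+1.
Variables (K : fieldType) (phi : {rmorphism {mpoly k[2]} -> K}).
Hypothesis hphi : is_function_field (gk_plane_model k q) phi.
Variables (t : K) (xi : {poly {poly k}}).

Let kap : {rmorphism k -> K} := phi \o (@mpolyC 2 k : {rmorphism k -> {mpoly k[2]}}).
Let ev := eval_tz kap t (phi 'X_1).
Hypothesis ev_xi : ev xi = phi 'X_0.

Definition chart : {rmorphism {mpoly k[2]} -> {poly {poly k}}} :=
  mmap (polyC \o polyC : {rmorphism k -> {poly {poly k}}})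
    (fun i : 'I_2 => if i == 0 then xi else 'X).

Lemma chartC c : chart c%:MP = c%:P%:P. Proof. exact: mmapC. Qed.
Lemma chart0 : chart 'X_0 = xi. Proof. by rewrite /chart /= mmapX mmap1U. Qed.
Lemma chart1 : chart 'X_1 = 'X. Proof. by rewrite /chart /= mmapX mmap1U. Qed.

Lemma ev_chart g : ev (chart g) = phi g.
Proof.
apply: (mpoly2_rmorph_ext (phi := ev \o chart)) => [c||].
- by rewrite -[LHS]/(ev (chart c%:MP)) chartC /ev eval_tzC eval_tC.
- by rewrite -[LHS]/(ev (chart 'X_0)) chart0 ev_xi.
by rewrite -[LHS]/(ev (chart 'X_1)) chart1 /ev eval_tzX.
Qed.

Definition chart_poly : {poly {poly k}} := 'X^N - curve_A q xi.

Lemma chart_f : chart (gk_plane_model k q) = - chart_poly.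
Proof.
by rewrite gk_plane_modelE // rmorphB rmorphXn chart1 rmorph_curve_A chart0 opprB.
Qed.

(* [den] clears the denominators of [t] in terms of [x] and [z]; [Phi] is the
   equation of the curve in the chart, without its factor [den ^+ j]. *)
Variables (den Phi : {poly {poly k}}) (j : nat).
Hypothesis chart_lift : exists n g, chart g = 'X%:P * den ^+ n.
Hypothesis ev_den : ev den != 0.
Hypothesis PhiE : chart_poly = Phi * den ^+ j.
Hypothesis Phi_monic : Phi \is monic.
Hypothesis Phi_size : (2 < size Phi)%N.
Hypothesis Phi_den : forall g h, g * den = h * Phi -> exists h', g = h' * Phi.
Hypothesis chart_den : exists g, chart g = den.

Lemma ev_Phi : ev Phi = 0.
Proof.
have : ev chart_poly = 0.
  have := ev_chart (gk_plane_model k q); rewrite chart_f rmorphN.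
  have -> : phi (gk_plane_model k q) = 0.
    by apply/hphi.1; exists 1; rewrite mul1r.
  by move/eqP; rewrite oppr_eq0 => /eqP.
rewrite PhiE rmorphM rmorphXn => /eqP.
by rewrite mulf_eq0 expf_eq0 (negPf ev_den) andbF orbF => /eqP.
Qed.

Let liftable g := exists n h, chart h = g * den ^+ n.

Let liftD g h : liftable g -> liftable h -> liftable (g + h).
Proof.
have [d dE] := chart_den.
case=> n [a e] [m [b e']]; exists (n + m)%N, (a * d ^+ m + b * d ^+ n).
by rewrite rmorphD !rmorphM !rmorphXn dE e e' exprD; ring.
Qed.

Let liftM g h : liftable g -> liftable h -> liftable (g * h).
Proof.
case=> n [a e] [m [b e']]; exists (n + m)%N, (a * b).
by rewrite rmorphM e e' exprD; ring.
Qed.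

Let lift_all g : liftable g.
Proof.
elim/poly_ind: g => [|g c IH]; first by exists 0%N, 0; rewrite rmorph0 mul0r.
apply: liftD.
  by apply: liftM => //; exists 0%N, 'X_1; rewrite chart1 mulr1.
elim/poly_ind: c => [|c a IHc]; first by exists 0%N, 0; rewrite rmorph0 mul0r.
rewrite rmorphD rmorphM /=; apply: liftD; first exact: liftM.
by exists 0%N, a%:MP; rewrite chartC mulr1.
Qed.

(** Multiplied by a power of [den], every [g] lifts to [k[x, z]], where the kernel is known;
    [Phi_den] then removes the factors [den] one at a time. *)
Lemma ev_ker g : ev g = 0 -> exists h, g = h * Phi.
Proof.
move=> g0; have [n [a e]] := lift_all g.
have /hphi.1[h ah] : phi a = 0 by rewrite -ev_chart e rmorphM g0 mul0r.
have : exists h', g * den ^+ n = h' * Phi.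
  exists (- (chart h * den ^+ j)).
  by rewrite -e ah rmorphM chart_f PhiE; ring.
elim: n {e} => [|n IH] [h' e]; first by exists h'; rewrite -e mulr1.
by apply: IH; apply: (@Phi_den _ h'); rewrite -e exprSr mulrA.
Qed.

Lemma ev_frac y : exists g h, ev h != 0 /\ y = ev g / ev h.
Proof.
have [g [h [h0 ->]]] := hphi.2 y.
by exists (chart g), (chart h); rewrite !ev_chart.
Qed.

Variables (L : 'M[k]_(3, 2)) (i : {rmorphism {fraction {poly k}} -> K}).
Hypothesis hi : is_projection_pullback phi L i.
Variables (w : K) (al be : 'I_2 -> k).
Hypothesis formE : forall c : 'I_2,
  phi (affine_form (col c L)) = (kap (al c) * t + kap (be c)) * w.
Hypothesis w0 : w != 0.
Hypothesis det0 : al 0 * be 1 - al 1 * be 0 != 0.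

Let T := i (tofrac 'X).
Let iC c : i (tofrac c%:P) = kap c. Proof. exact: hi.1. Qed.
Let evC c : ev c%:P%:P = kap c. Proof. by rewrite /ev eval_tzC eval_tC. Qed.
Let evX : ev 'X%:P = t. Proof. by rewrite /ev eval_tzC eval_tX. Qed.

Let T_nonconst c : T != kap c.
Proof.
rewrite -iC (inj_eq (fmorph_inj i)) tofrac_eq.
apply/eqP => /(congr1 (fun p : {poly k} => size p)).
by rewrite size_polyX size_polyC; case: (c != 0).
Qed.

Let num c := kap (al c) * t + kap (be c).

Let TE : T = num 0 / num 1.
Proof. by rewrite /T hi.2 !formE invfM mulrACA divff // mulr1. Qed.

Let num1 : num 1 != 0.
Proof.
apply/eqP => n1; have := T_nonconst 0.
by rewrite TE n1 invr0 mulr0 rmorph0 eqxx.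
Qed.

Let tE : t = (kap (be 0) - kap (be 1) * T) / (kap (al 1) * T - kap (al 0)).
Proof.
have e : T * num 1 = num 0 by rewrite TE divfK.
have d0 : kap (al 1) * T - kap (al 0) != 0.
  apply/eqP => d0; have [a1|a1] := eqVneq (al 1) 0.
    move: d0; rewrite a1 rmorph0 mul0r sub0r => /eqP.
    rewrite oppr_eq0 fmorph_eq0 => /eqP a0.
    by move: det0; rewrite a0 a1 !mul0r subrr eqxx.
  have := T_nonconst (al 0 / al 1); rewrite fmorph_div.
  have ka1 : kap (al 1) != 0 by rewrite fmorph_eq0.
  suff -> : T = kap (al 0) / kap (al 1) by rewrite eqxx.
  by apply: (canRL (mulfK ka1)); rewrite mulrC; apply/eqP; rewrite -subr_eq0 d0.
apply: (canRL (mulfK d0)); move: e; rewrite /num => e.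
have -> : t * (kap (al 1) * T - kap (al 0)) =
  T * (kap (al 1) * t + kap (be 1)) - (kap (al 0) * t + kap (be 0))
  + (kap (be 0) - kap (be 1) * T) by ring.
by rewrite e subrr add0r.
Qed.

(** By [formE] the ratio of the two linear forms is a fractional linear function of [t], invertible
    by [det0]. It generates the same field as [t]; this lemma and [chart_i_ev] give the two
    inclusions. *)
Lemma chart_i_frac a : exists n d, ev d%:P != 0 /\ i a = ev n%:P / ev d%:P.
Proof.
pose S y := exists n d, ev d%:P != 0 /\ y = ev n%:P / ev d%:P.
have SC c : S (kap c) by exists c%:P, 1; rewrite rmorph1 oner_neq0 evC divr1.
have SD y y' : S y -> S y' -> S (y + y').
  case=> [n [d [d0 ->]]] [n' [d' [d'0 ->]]].
  exists (n * d' + n' * d), (d * d').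
  rewrite polyCD !polyCM (rmorphD ev) !(rmorphM ev) mulf_neq0 //; split=> //.
  by field; rewrite d0 d'0.
have SM y y' : S y -> S y' -> S (y * y').
  case=> [n [d [d0 ->]]] [n' [d' [d'0 ->]]].
  exists (n * n'), (d * d').
  rewrite !polyCM !(rmorphM ev) mulf_neq0 //; split=> //.
  by field; rewrite d0 d'0.
have SV y : S y -> S y^-1.
  case=> [n [d [d0 ->]]]; have [n0|n0] := eqVneq (ev n%:P) 0.
    by rewrite n0 mul0r invr0 -(rmorph0 kap).
  by exists d, n; rewrite invf_div.
have St : S t by exists 'X, 1; rewrite rmorph1 oner_neq0 evX divr1.
have ST : S T.
  by rewrite TE; apply: (SM _ _ _ (SV _ _)); apply: (SD _ _ _ (SC _)); apply: (SM _ _ (SC _)).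
have Spoly n : S (i (tofrac n)).
  elim/poly_ind: n => [|n c IH]; first by rewrite !rmorph0 -(rmorph0 kap).
  rewrite !(rmorphD, rmorphM) /=; apply: SD; last by rewrite iC.
  exact: SM.
have [n [d [_ ->]]] := fraction_quotient a.
by rewrite fmorph_div; apply: SM => //; apply: SV.
Qed.

Lemma chart_i_ev n : exists a, ev n%:P = i a.
Proof.
have it : exists a, t = i a.
  exists ((tofrac (be 0)%:P - tofrac (be 1)%:P * tofrac 'X) /
     (tofrac (al 1)%:P * tofrac 'X - tofrac (al 0)%:P)).
  by rewrite fmorph_div !rmorphB !rmorphM !iC -tE.
have [a tEa] := it.
elim/poly_ind: n => [|n c [b IH]]; first by exists 0; rewrite !rmorph0.
exists (b * a + tofrac c%:P).
by rewrite polyCD polyCM (rmorphD ev) (rmorphM ev) (rmorphD i) (rmorphM i) iC -IH -tEa evC evX.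
Qed.

Lemma chart_galois_fiber t0 c : galois_extension i ->
  let Phi0 := map_poly (horner_eval t0) Phi in
  root Phi0 c -> (Phi.[c%:P])^`().[t0] != 0 ->
  (mup c Phi0 %| (size Phi).-1)%N /\ forall e, (mup c Phi0 %| mup e Phi0)%N.
Proof.
move=> gal.
exact: (galois_fiber ev_ker ev_Phi Phi_monic Phi_size ev_frac chart_i_frac
  chart_i_ev gal).
Qed.
End Chart.

(** * Points that are not Galois *)

(** The second hypothesis says that the remaining row depends on rows [r] and [s], as it does when
    both columns vanish at a suitable point. If the minor were zero, [(L s 1, - L s 0)] and
    [(L r 1, - L r 0)] would be annihilated by the injective [L], hence zero, and then every vector
    would be annihilated. *)
Lemma rank2_minor (k : fieldType) (L : 'M[k]_(3, 2)) (r s : 'I_3) :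
  \rank L = 2 ->
  (forall v : 'cV_2, (row r L *m v = 0) -> (row s L *m v = 0) -> L *m v = 0) ->
  L r 0 * L s 1 - L r 1 * L s 0 != 0.
Proof.
move=> rk H; apply/eqP => det0.
have inj (v : 'cV_2) : L *m v = 0 -> v = 0.
  move=> Lv; have Lf : row_free L^T by rewrite /row_free mxrank_tr rk.
  have : v^T *m L^T = 0 by rewrite -trmx_mul Lv trmx0.
  by move/eqP; rewrite mulmx_free_eq0 // => /eqP/(congr1 trmx); rewrite trmxK trmx0.
pose vec (x y : k) : 'cV_2 := \col_i (if i == 0 then x else y).
have rowE t x y : L t 0 * x + L t 1 * y = 0 -> row t L *m vec x y = 0.
  move=> e; apply/matrixP => i j; rewrite !mxE big_ord_recl big_ord1 !mxE /=.
  by rewrite -[RHS]e; congr (_ + L t _ * _); apply/val_inj.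
have e1 : vec (L s 1) (- L s 0) = 0.
  by apply/inj/H; apply: rowE; [rewrite -[RHS]det0|]; ring.
have e2 : vec (L r 1) (- L r 0) = 0.
  apply/inj/H; apply: rowE; first by ring.
  by rewrite -[RHS]oppr0 -det0; ring.
have z0 x y : vec x y = 0 -> x = 0 /\ y = 0.
  by move=> /matrixP e; have := e 0 0; have := e 1 0; rewrite !mxE.
have [s1 /eqP] := z0 _ _ e1; rewrite oppr_eq0 => /eqP s0.
have [r1 /eqP] := z0 _ _ e2; rewrite oppr_eq0 => /eqP r0.
have : vec 1 0 = 0.
  by apply/inj/H; apply: rowE; rewrite ?r1 ?r0 ?s1 ?s0 !mul0r addr0.
by case/z0 => /eqP; rewrite oner_eq0.
Qed.

Lemma size_curve_AX q (k : closedFieldType) : pchar_power q k ->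
  (1 < size (curve_A q ('X : {poly k})))%N.
Proof.
move=> hk; have q1 := pchar_power_gt1 hk.
have q2 : (1 < q ^ 2)%N by rewrite -{1}(exp1n 2) ltn_exp2r.
have [_ al0 _] := size_trace_alpha hk.
have sB : size ('X - 'X^(q ^ 2) : {poly k}) = (q ^ 2).+1.
  by rewrite addrC size_polyDl size_polyN size_polyXn // size_polyX ltnS.
have al1 : (0 < size (alpha q ('X : {poly k}) ^+ q))%N.
  by rewrite size_poly_gt0 expf_neq0.
have B0 : 'X - 'X^(q ^ 2) != 0 :> {poly k} by rewrite -size_poly_eq0 sB.
rewrite /curve_A size_mul ?expf_neq0 // sB addnS /=.
by rewrite (leq_trans _ (leq_addl _ _)).
Qed.

Lemma curve_A_surj q (k : closedFieldType) (c : k) : pchar_power q k ->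
  exists x, curve_A q x = c.
Proof.
move=> hk; have sA := size_curve_AX hk.
have [|x] := closed_rootP (curve_A q ('X : {poly k}) - c%:P) _.
  rewrite size_polyDl ?gtn_eqF // size_polyN.
  exact: leq_ltn_trans (size_polyC_leq1 _) sA.
by rewrite rootE hornerD hornerN hornerC horner_curve_A hornerX subr_eq0 => /eqP; exists x.
Qed.

Lemma dvdn_size_fibers (T U : eqType) (f : T -> U) m (s : seq T) :
  (forall x, x \in s -> (m %| count (fun y => f y == f x) s)%N) -> (m %| size s)%N.
Proof.
have [n] := ubnP (size s); elim: n s => // n IH [|x s] lt H; first exact: dvdn0.
pose a := [pred y | f y == f x].
rewrite -(count_predC a) dvdn_addr ?H ?mem_head // -size_filter.
apply: IH => [|y].
  rewrite size_filter -ltnS; apply: leq_trans lt; rewrite ltnS -(count_predC a (x :: s)).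
  by rewrite -[X in (X < _)%N]add0n ltn_add2r /= eqxx.
rewrite mem_filter => /andP[ay ys].
rewrite count_filter; have := H y ys; congr (_ %| _)%N; apply: eq_count => z /=.
by case: eqP => //= ->.
Qed.

Lemma size_undup_count (T : eqType) (s : seq T) m :
  (forall x, x \in s -> count_mem x s = m) -> size s = (size (undup s) * m)%N.
Proof.
move=> H; rewrite -sum1_size -big_undup_iterop_count.
rewrite big_seq (eq_bigr (fun=> m)); last first.
  by move=> x; rewrite mem_undup => /H ->; rewrite Monoid.iteropE iter_addn mul1n addn0.
by rewrite -big_seq big_const_seq count_predT iter_addn addn0 mulnC.
Qed.

Section Forward.
Variables (q : nat) (k : closedFieldType) (hk : pchar_power q k).
Let q1 : (1 < q)%N := pchar_power_gt1 hk.
Let q0 : (0 < q)%N := ltnW q1.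
Let hkX : pchar_power q {poly k} := pchar_power_poly hk.
Let N := (q ^ 3).+1.
Variables (K : fieldType) (phi : {rmorphism {mpoly k[2]} -> K}).
Hypothesis hphi : is_function_field (gk_plane_model k q) phi.
Let kap : {rmorphism k -> K} := phi \o (@mpolyC 2 k : {rmorphism k -> {mpoly k[2]}}).

Lemma affine_formE (l : 'cV[k]_3) : phi (affine_form l) =
  kap (l 0 0) * phi 'X_0 + kap (l 1 0) * phi 'X_1 + kap (l 2 0).
Proof. by rewrite /affine_form !rmorphD -!mul_mpolyC !rmorphM. Qed.

Lemma curve_pointP g x0 z0 : phi g = 0 -> z0 ^+ N = curve_A q x0 ->
  g.@[fun i => if i == 0 then x0 else z0] = 0.
Proof.
move=> /hphi.1[h ->] onC; rewrite gk_plane_modelE // mevalM mevalB.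
rewrite (rmorph_curve_A q (meval _)) rmorphXn /= !mevalXU /= -/N onC subrr.
by rewrite mulr0.
Qed.

(** A function that is zero in [K] vanishes at every point of the affine curve, but the curve has
    points of every ordinate because [curve_A] is onto. *)
Lemma z_nonconst c : phi 'X_1 != kap c.
Proof.
apply/eqP => e; have [x0 xE] := curve_A_surj ((c + 1) ^+ N) hk.
have : phi ('X_1 - c%:MP) = 0 by rewrite rmorphB e subrr.
move/curve_pointP/(_ (esym xE)); rewrite mevalB mevalXU mevalC /= addrAC subrr add0r.
by move/eqP; rewrite oner_eq0.
Qed.

Variables (L : 'M[k]_(3, 2)) (i : {rmorphism {fraction {poly k}} -> K}).
Hypothesis hL : \rank L = 2.
Hypothesis hi : is_projection_pullback phi L i.
Hypothesis gal : galois_extension i.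

Lemma chart_poly_monic (xi : {poly {poly k}}) : (size xi <= 2)%N ->
  chart_poly q xi \is monic /\ size (chart_poly q xi) = N.+1.
Proof.
move=> sxi; have s : (size (- curve_A q xi)%R < size ('X^N : {poly {poly k}}))%N.
  by rewrite size_polyN size_polyXn ltnS size_curve_A.
by split; rewrite ?monicE /chart_poly ?lead_coefDl ?size_polyDl // ?lead_coefXn ?size_polyXn.
Qed.

Lemma chart_poly_restrict (xi : {poly {poly k}}) t0 :
  map_poly (horner_eval t0) (chart_poly q xi) =
  'X^N - curve_A q (map_poly (horner_eval t0) xi).
Proof. by rewrite rmorphB rmorphXn rmorph_curve_A /= map_polyX. Qed.

Lemma deriv_chart_poly (xi : {poly {poly k}}) t0 c :
  ((chart_poly q xi).[c%:P])^`().[t0] =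
  - (alpha q (xi.[c%:P]).[t0] ^+ q * (xi.[c%:P])^`().[t0]).
Proof.
rewrite /chart_poly hornerD hornerN hornerXn.
have -> : (curve_A q xi).[c%:P] = curve_A q xi.[c%:P].
  exact: (rmorph_curve_A q (horner_eval c%:P)).
rewrite derivB (deriv_curve_A hk) -rmorphXn derivC sub0r.
by rewrite hornerN hornerM horner_exp horner_alpha.
Qed.

(** * Affine centers of projection *)

Section Affine.
Variables a b : k.
Hypothesis hP : forall c, a * L 0 c + b * L 1 c + L 2 c = 0.

(** The lines through the center are [x = a + t * (z - b)], with their slope as parameter; clearing
    the denominator of [t] costs the factor [T - b]. *)
Let xi : {poly {poly k}} := a%:P%:P + 'X%:P * ('X - b%:P%:P).
Let t : K := (phi 'X_0 - kap a) / (phi 'X_1 - kap b).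
Let ev := eval_tz kap t (phi 'X_1).
Let den : {poly {poly k}} := 'X - b%:P%:P.
Let evC c : ev c%:P%:P = kap c. Proof. by rewrite /ev eval_tzC eval_tC. Qed.
Let evX : ev 'X%:P = t. Proof. by rewrite /ev eval_tzC eval_tX. Qed.
Let evT : ev 'X = phi 'X_1. Proof. by rewrite /ev eval_tzX. Qed.
Let w0 : phi 'X_1 - kap b != 0. Proof. by rewrite subr_eq0 z_nonconst. Qed.

Let ev_xi : ev xi = phi 'X_0.
Proof.
rewrite /xi (rmorphD ev) (rmorphM ev) (rmorphB ev) !evC evX evT.
by rewrite /t divfK // addrC subrK.
Qed.

Let xi_size : (size xi <= 2)%N.
Proof.
rewrite (leq_trans (size_polyD _ _)) // geq_max (leq_trans (size_polyC_leq1 _)) //=.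
by rewrite mul_polyC (leq_trans (size_scale_leq _ _)) // size_XsubC.
Qed.

Let formE (c : 'I_2) : phi (affine_form (col c L)) =
  (kap (L 0 c) * t + kap (L 1 c)) * (phi 'X_1 - kap b).
Proof.
rewrite affine_formE !mxE mulrDl -mulrA divfK //.
have -> : L 2 c = - (a * L 0 c + b * L 1 c).
  by apply/eqP; rewrite -addr_eq0 addrC hP.
by rewrite rmorphN rmorphD !rmorphM; ring.
Qed.

Let det0 : L 0 0 * L 1 1 - L 0 1 * L 1 0 != 0.
Proof.
apply: rank2_minor => // v /matrixP e0 /matrixP e1; apply/matrixP => r c.
have := e0 0 c; have := e1 0 c; rewrite !mxE !big_ord_recl !big_ord0 !mxE !addr0.
set u0 : 'I_2 := lift _ _; move=> f1 f0.
have [->|[->|->]] : r = 0 \/ r = 1 \/ r = 2.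
- case: r => [[|[|[|]]]] // lt; [left|right; left|right; right]; exact/val_inj.
- exact: f0.
- exact: f1.
have L2 c' : L 2 c' = - (a * L 0 c' + b * L 1 c').
  by apply/eqP; rewrite -addr_eq0 addrC hP.
rewrite !L2; transitivity (- a * (L 0 0 * v 0 c + L 0 u0 * v u0 c)
   - b * (L 1 0 * v 0 c + L 1 u0 * v u0 c)); first by ring.
by rewrite f0 f1 !mulr0 subr0.
Qed.

Let chart_den : exists g, chart xi g = den.
Proof. by exists ('X_1 - b%:MP); rewrite rmorphB chart1 chartC. Qed.

Let chart_lift : exists n g, chart xi g = 'X%:P * den ^+ n.
Proof.
exists 1%N, ('X_0 - a%:MP); rewrite rmorphB chart0 chartC expr1 /xi /den.
by rewrite addrAC subrr add0r.
Qed.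

Let ev_den : ev den != 0.
Proof. by rewrite /den (rmorphB ev) evC evT. Qed.

Lemma affine_chart_fiber Phi j t0 c :
  chart_poly q xi = Phi * den ^+ j -> Phi \is monic -> (2 < size Phi)%N ->
  Phi.[b%:P] != 0 ->
  let Phi0 := map_poly (horner_eval t0) Phi in
  root Phi0 c -> (Phi.[c%:P])^`().[t0] != 0 ->
  (mup c Phi0 %| (size Phi).-1)%N /\ forall e, (mup c Phi0 %| mup e Phi0)%N.
Proof.
move=> PhiE Phim Phis Phib.
apply: (chart_galois_fiber hk hphi ev_xi chart_lift ev_den PhiE) => //.
- move=> g h e; have hb : h.[b%:P] = 0.
    have := congr1 (fun p : {poly {poly k}} => p.[b%:P]) e.
    rewrite !hornerM hornerXsubC subrr mulr0 => /esym/eqP.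
    by rewrite mulf_eq0 (negPf Phib) orbF => /eqP.
  have /factor_theorem[h' hE] : root h b%:P by apply/eqP.
  exists h'; apply: (mulIf (_ : den != 0)); first by rewrite polyXsubC_eq0.
  by rewrite e hE mulrAC.
- exact: hi.
- exact: formE.
- exact: w0.
- exact: det0.
exact: gal.
Qed.

Lemma outer_point_not_galois : b ^+ N = curve_A q a.
Proof.
apply/eqP; apply/negPn/negP => outer.
have [x0 [z0 [z00 onC tan]]] := tangent_point_exists hk outer.
have A0 : curve_A q x0 != 0 by rewrite -onC expf_neq0.
have al0 : alpha q x0 != 0.
  by apply: contraNneq A0 => e; rewrite (curve_A_trace hk) e expr0n mulr0.
(* If [z0 = b], tangency would force [x0 = a], and the center would be on the curve. This also makes
   the [t]-derivative, [- alpha x0 ^ q * (z0 - b)], nonzero. *)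
have zb : z0 - b != 0.
  apply/eqP => e; move: tan; rewrite e mulr0 => /eqP.
  rewrite mulf_eq0 expf_eq0 (negPf al0) andbF subr_eq0 /= => /eqP xa.
  by case/eqP: outer; rewrite -xa -onC; move/eqP: e; rewrite subr_eq0 => /eqP ->.
pose t0 := (x0 - a) / (z0 - b).
have [Phim Phis] := chart_poly_monic xi_size.
have PhiE : chart_poly q xi = chart_poly q xi * den ^+ 0 by rewrite mulr1.
have Phib : (chart_poly q xi).[b%:P] != 0.
  rewrite /chart_poly hornerD hornerN hornerXn.
  have -> : (curve_A q xi).[b%:P] = curve_A q xi.[b%:P].
    exact: (rmorph_curve_A q (horner_eval b%:P)).
  have -> : xi.[b%:P] = a%:P by rewrite /xi !hornerE subrr mulr0 addr0.
  by rewrite -rmorphXn -rmorph_curve_A -rmorphB polyC_eq0 subr_eq0.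
have tE : t0 * (z0 - b) = x0 - a by rewrite divfK.
have restrE : map_poly (horner_eval t0) (chart_poly q xi) = line_restriction q x0 z0 t0.
  rewrite chart_poly_restrict /line_restriction; congr (_ - curve_A q _).
  rewrite /xi rmorphD rmorphM rmorphB /= !map_polyC map_polyX /= /horner_eval !hornerC hornerX.
  rewrite /line -mul_polyC; transitivity ((a + t0 * (z0 - b))%:P + t0%:P * ('X - z0%:P)).
    by rewrite !(rmorphD, rmorphM, rmorphB) /=; ring.
  by rewrite tE (addrC a) subrK.
have slope : tangent_slope q x0 z0 t0.
  by apply: (mulIf zb); rewrite -mulrA tE tan.
have mq := tangent_mup hk z00 onC slope.
have Phis2 : (2 < size (chart_poly q xi))%N.
  by rewrite Phis !ltnS expn_gt0 q0.
have := @affine_chart_fiber _ 0 t0 z0 PhiE Phim Phis2 Phib.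
rewrite /= restrE mq Phis /= deriv_chart_poly.
have xz : xi.[z0%:P] = a%:P + 'X * (z0 - b)%:P.
  by rewrite /xi !hornerE rmorphB.
rewrite xz derivD derivC add0r derivM derivX derivC mulr0 addr0 mul1r hornerC.
rewrite !hornerE tE (addrC a) subrK oppr_eq0 mulf_neq0 ?expf_neq0 //.
case=> //.
  by rewrite rootE line_restrictionE subrr mulr0 addr0 onC subrr.
move=> dv _; move: dv; rewrite /N -addn1 dvdn_addr ?dvdn_exp // dvdn1.
by rewrite gtn_eqF.
Qed.

Section OnCurve.
Hypotheses (b0 : b != 0) (onP : b ^+ N = curve_A q a).

Let ala : alpha q a != 0.
Proof.
apply: contraNneq (expf_neq0 N b0) => e.
by rewrite onP (curve_A_trace hk) e expr0n mulr0.
Qed.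

(** Every line passes through the center, so [T - b] splits off. It does so only once: [Phi.[b]] is
    the derivative of [chart_poly] at [b], namely [b ^ (q ^ 3) - alpha a ^ q * t], and [alpha a] is
    nonzero. *)
Lemma smooth_point_Phi : exists Phi, [/\ chart_poly q xi = Phi * den ^+ 1,
  Phi \is monic, size Phi = N & Phi.[b%:P] != 0].
Proof.
have [Psim Psis] := chart_poly_monic xi_size.
have /factor_theorem[Phi PhiE] : root (chart_poly q xi) b%:P.
  rewrite rootE /chart_poly hornerD hornerN hornerXn.
  have -> : (curve_A q xi).[b%:P] = curve_A q xi.[b%:P].
    exact: (rmorph_curve_A q (horner_eval b%:P)).
  have -> : xi.[b%:P] = a%:P by rewrite /xi !hornerE subrr mulr0 addr0.
  by rewrite -rmorphXn -rmorph_curve_A -rmorphB polyC_eq0 subr_eq0 onP.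
have denm : den \is monic by rewrite monicXsubC.
have Phim : Phi \is monic by move: Psim; rewrite PhiE (monicMr _ denm).
exists Phi; rewrite expr1; split=> //.
  by move: Psis; rewrite PhiE size_Mmonic // ?monic_neq0 // size_XsubC addn2 => -[].
have : (chart_poly q xi)^`().[b%:P] = Phi.[b%:P].
  rewrite PhiE derivM derivXsubC mulr1 hornerD hornerM hornerXsubC subrr mulr0.
  by rewrite add0r.
move=> <-; apply/eqP => /(congr1 (fun p : {poly k} => p`_1)); rewrite coef0.
rewrite /chart_poly derivB derivXn (deriv_curve_A hkX) hornerD hornerN hornerMn.
rewrite hornerXn hornerM horner_exp -mulr_natr -[N%:R]natr1 (natqX0 hkX) add0r mulr1.
have -> : (alpha q xi).[b%:P] = alpha q xi.[b%:P].
  exact: (rmorph_alpha q (horner_eval b%:P)).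
have -> : xi.[b%:P] = a%:P by rewrite /xi !hornerE subrr mulr0 addr0.
have -> : xi^`() = 'X%:P.
  by rewrite /xi derivD derivC add0r derivM derivC mul0r add0r derivXsubC mulr1.
rewrite hornerC -rmorph_alpha -!rmorphXn coefB coefC coefCM coefX /= sub0r mulr1.
by move/eqP; rewrite oppr_eq0 expf_eq0 (negPf ala) andbF.
Qed.

Lemma tangent_through_off x z : tangent_through q a b x z -> x != a -> z != b.
Proof.
move=> [z0 onC tan] xa; apply/eqP => zb; move/eqP: tan.
rewrite zb subrr mulr0 mulf_eq0 subr_eq0 (negPf xa) orbF expf_eq0 => /andP[_ /eqP al0].
by move/eqP: onC; rewrite (curve_A_trace hk) al0 expr0n mulr0 expf_eq0 (negPf z0) andbF.
Qed.

Let slope x z := (x - a) / (z - b).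

Lemma tangent_slopeP x z : tangent_through q a b x z -> x != a ->
  tangent_slope q x z (slope x z) /\ x = a + slope x z * (z - b).
Proof.
move=> tt xa; have zb := tangent_through_off tt xa; case: tt => z0 onC tan.
have zb' : z - b != 0 by rewrite subr_eq0.
split; last by rewrite divfK // addrC subrK.
by apply: (mulIf zb'); rewrite -mulrA divfK.
Qed.

(** One tangency outside the center makes all multiplicities in the fibre multiples of [q]. The
    center does not occur, since the line would be tangent there and meet the curve with
    multiplicity above [q]; ordinate [0] is excluded by [mup_at_z0]. Every remaining point is then a
    point of tangency and counts exactly [q]. *)
Lemma tangent_line_fiber Phi x z :
  chart_poly q xi = Phi * den ^+ 1 -> Phi \is monic -> size Phi = N ->
  Phi.[b%:P] != 0 -> tangent_through q a b x z -> x != a ->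
  let t0 := slope x z in let Phi0 := map_poly (horner_eval t0) Phi in
  forall v, root Phi0 v ->
    [/\ v != b, mup v Phi0 = q & tangent_through q a b (a + t0 * (v - b)) v].
Proof.
move=> PhiE Phim Phis Phib tt xa t0 Phi0.
have zb := tangent_through_off tt xa.
have [sl xE] := tangent_slopeP tt xa; rewrite -/t0 in sl xE.
have [z0 onC tan] := tt.
have PhiE0 : Phi0 * ('X - b%:P) = line_restriction q a b t0.
  have <- : map_poly (horner_eval t0) (chart_poly q xi) = line_restriction q a b t0.
    rewrite chart_poly_restrict /line_restriction; congr (_ - curve_A q _).
    rewrite /xi rmorphD rmorphM rmorphB /= !map_polyC map_polyX /= /horner_eval.
    by rewrite !hornerC hornerX /line -mul_polyC.
  rewrite PhiE expr1 rmorphM /den rmorphB /= map_polyX map_polyC /=.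
  by rewrite /horner_eval hornerC.
have Phi0m : Phi0 \is monic by apply: monic_map.
have mE v : v != b -> mup v Phi0 = mup v (line_restriction q a b t0).
  move=> vb; rewrite -PhiE0 mupMl // root_XsubC.
  by [].
have t00 : t0 != 0.
  apply/eqP => t00; have := expf_neq0 (q ^ 3) z0.
  by rewrite -sl t00 mulr0 eqxx.
have mz : mup z Phi0 = q.
  by rewrite mE // -(line_restriction_shift q a b t0 z) -xE tangent_mup.
have rz : root Phi0 z.
  by apply: contraTT q0 => /mupNroot; rewrite mz => ->.
have Phis2 : (2 < size Phi)%N.
  by rewrite Phis ltnS; apply: (leq_trans q1); rewrite -{1}[q]expn1 leq_pexp2l.
have sm : (Phi.[z%:P])^`().[t0] != 0.
  have := deriv_chart_poly xi t0 z; rewrite PhiE expr1 hornerM hornerXsubC -rmorphB.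
  rewrite mulrC mul_polyC derivZ hornerZ => e.
  have xz : xi.[z%:P] = a%:P + 'X * (z - b)%:P by rewrite /xi !hornerE rmorphB.
  rewrite xz derivD derivC add0r derivM derivX derivC mulr0 addr0 mul1r hornerC in e.
  rewrite !hornerE -xE in e.
  apply/eqP => e0; move/eqP: e; rewrite e0 mulr0 eq_sym oppr_eq0 mulf_eq0.
  rewrite subr_eq0 (negPf zb) orbF expf_eq0 => /andP[_ /eqP al0].
  by move/eqP: onC; rewrite (curve_A_trace hk) al0 expr0n mulr0 expf_eq0 (negPf z0) andbF.
have [_ dv] := affine_chart_fiber PhiE Phim Phis2 Phib rz sm.
rewrite -/Phi0 mz in dv.
move=> v rv.
have mv : (0 < mup v Phi0)%N by rewrite -XsubC_dvd ?dvdp_XsubCl // monic_neq0.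
have mqv : (q <= mup v Phi0)%N by apply: dvdn_leq => //; exact: dv.
have vb : v != b.
  apply/eqP => vb; have mb : mup b (line_restriction q a b t0) = (mup v Phi0).+1.
    rewrite -PhiE0 mupM ?monic_neq0 ?monicXsubC // vb.
    by have := mup_XsubCX 1 b b; rewrite eqxx expr1 => ->; rewrite addn1.
  have [|_ slb] := @tangent_of_mup q k hk a b t0 b.
    by rewrite mb ltnS.
  rewrite subrr mulr0 addr0 in slb.
  have := tangent_mup hk b0 onP slb; rewrite mb => e.
  by move: mqv; rewrite -e ltnn.
have v0 : v != 0.
  apply/eqP => v0; have := dv 0; rewrite mE 1?eq_sym //.
  apply/negP; apply: mup_at_z0 => //.
  by rewrite -PhiE0 rootM -{1}v0 rv.
have [|onv slv] := @tangent_of_mup q k hk a b t0 v.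
  by rewrite -mE // (leq_trans q1).
split=> //.
  by rewrite mE // -(line_restriction_shift q a b t0 v) tangent_mup.
split=> //; rewrite -slv; ring.
Qed.

Lemma smooth_point_not_galois : False.
Proof.
have [Phi [PhiE Phim Phis Phib]] := smooth_point_Phi.
have [b' bE] := closed_field_nth_root b q0.
have [a' aE] := closed_field_nth_root a q0.
have b'0 : b' != 0.
  by apply: contraNneq b0 => e; rewrite -bE e expr0n gtn_eqF.
pose S := tangent_poly q a' b'.
have S0 : S != 0 by rewrite -size_poly_eq0 size_tangent_poly.
(* An exceptional root would satisfy both [x ^ (q ^ 2) = x] and [x ^ q = a'], hence equal [a], where
   [curve_A] does not vanish. *)
have good x : root S x -> trace_q q x * alpha q x != 0.
  rewrite rootE tangent_polyE => rx; apply/eqP => e.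
  move: rx; have -> : trace_q q x ^+ (q ^ 2) * alpha q x ^+ (q ^ 2 - 1) = 0.
    have q20 : (0 < q ^ 2 - 1)%N by rewrite subn_gt0 -{1}(exp1n 2) ltn_exp2r.
    move/eqP: e; rewrite mulf_eq0 => /orP[] /eqP ->.
      by rewrite expr0n expn_eq0 (gtn_eqF q0) mul0r.
    by rewrite expr0n (gtn_eqF q20) mulr0.
  rewrite mulr0 subr0 expf_eq0 /= subr_eq0 => /eqP ax.
  have xa : x = a.
    move: e; rewrite (trace_alpha hk) => /eqP; rewrite subr_eq0 => /eqP ->.
    by rewrite -mulnn exprM -ax aE.
  have := expf_neq0 N b0; rewrite onP (curve_A_trace hk) exprS mulrA -xa e.
  by rewrite mul0r eqxx.
have tang x : root S x -> tangent_through q a b x (tangent_ordinate q a b x).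
  by move=> rx; rewrite -aE -bE; apply: tangent_root_point => //; exact: good.
have [r rE] := closed_field_poly_normal S.
have rootr x : (x \in r) = root S x.
  by rewrite [in RHS]rE rootZ ?lead_coef_eq0 // root_prod_XsubC.
have szr : size r = (q * N)%N.
  have := size_tangent_poly hk a' b'; rewrite -/S rE.
  by rewrite size_scale ?lead_coef_eq0 // size_prod_XsubC => -[].
have r_uniq : uniq r.
  apply: count_mem_uniq => x; rewrite -mu_prod_XsubC.
  have -> : mup x (\prod_(y <- r) ('X - y%:P)) = mup x S.
    rewrite rE -mul_polyC mupMr // rootE hornerC lead_coef_eq0.
    by [].
  have [xr|xr] := boolP (x \in r); last by rewrite mupNroot // -rootr.
  have rx : root S x by rewrite -rootr.
  apply/eqP; rewrite eqn_leq -XsubC_dvd // dvdp_XsubCl rx andbT leqNgt.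
  apply/negP => /mup_deriv /eqP; rewrite (deriv_tangent_poly hk).
  have := good x rx; rewrite mulf_eq0 negb_or => /andP[t0 al0].
  by apply/negP; rewrite !mulf_neq0 ?expf_neq0.
(* The center lies on its own tangent and is one of the [q * N] points; removing it leaves a number
   that is [-1] modulo [q]. *)
have ar : a \in r.
  rewrite rootr; have [] := @tangent_point_root q k hk a' b' a b b'0 => //.
  by rewrite aE bE; split=> //; rewrite !subrr !mulr0.
pose s := rem a r.
have s_uniq : uniq s by apply: rem_uniq.
have sP x : (x \in s) = root S x && (x != a).
  by rewrite mem_rem_uniq // inE /= rootr andbC.
pose zz := tangent_ordinate q a b.
pose T x := slope x (zz x).
suff : (q %| size s)%N.
  rewrite size_rem // szr; have : (0 < q * N)%N by rewrite muln_gt0 q0.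
  move=> qN dvs; have : (q %| (q * N).-1 + 1)%N.
    by rewrite addn1 prednK // dvdn_mulr.
  by rewrite dvdn_addr // dvdn1 gtn_eqF.
apply: (dvdn_size_fibers (f := T)) => x; rewrite sP => /andP[rx xa].
have tt := tang _ rx; set t0 := T x.
pose Phi0 := map_poly (horner_eval t0) Phi.
have fib v : root Phi0 v ->
    [/\ v != b, mup v Phi0 = q & tangent_through q a b (a + t0 * (v - b)) v].
  exact: (tangent_line_fiber PhiE Phim Phis Phib tt xa).
have Phi0m : Phi0 \is monic by apply: monic_map.
have [r0 r0E] := closed_field_poly_normal Phi0.
rewrite (monicP Phi0m) scale1r in r0E.
have rootr0 v : (v \in r0) = root Phi0 v by rewrite r0E root_prod_XsubC.
have szr0 : size r0 = (q ^ 3)%N.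
  have : size Phi0 = N.
    by rewrite size_map_poly_id0 // (monicP Phim) /horner_eval hornerC oner_neq0.
  by rewrite r0E size_prod_XsubC => -[].
have : size r0 = (size (undup r0) * q)%N.
  apply: size_undup_count => v; rewrite rootr0 -mu_prod_XsubC -r0E.
  by case/fib.
rewrite szr0 expnSr => /eqP; rewrite eqn_pmul2r // => /eqP szu.
rewrite -size_filter -(size_map zz) (_ : size _ = size (undup r0)).
  by rewrite -szu dvdn_exp.
have inF y : y \in filter (fun y => T y == t0) s ->
    [/\ tangent_through q a b y (zz y), y != a & y = a + t0 * (zz y - b)].
  rewrite mem_filter sP => /and3P[/eqP Ty ry ya]; have ty := tang _ ry; split=> //.
  by have [_] := tangent_slopeP ty ya; rewrite -/(T y) Ty.
have [slx _] := tangent_slopeP tt xa; rewrite -/(T x) -/t0 in slx.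
have t00 : t0 != 0.
  case: tt => zx _ _; apply/eqP => e; have := expf_neq0 (q ^ 3) zx.
  by rewrite -slx e mulr0 eqxx.
have Phi0E v : Phi0.[v] * (v - b) = v ^+ N - curve_A q (a + t0 * (v - b)).
  rewrite -line_restrictionE -hornerXsubC -hornerM; congr (_.[_]).
  have <- : map_poly (horner_eval t0) (chart_poly q xi) = line_restriction q a b t0.
    rewrite chart_poly_restrict /line_restriction; congr (_ - curve_A q _).
    rewrite /xi rmorphD rmorphM rmorphB /= !map_polyC map_polyX /= /horner_eval.
    by rewrite !hornerC hornerX /line -mul_polyC.
  rewrite PhiE expr1 rmorphM /den rmorphB /= map_polyX map_polyC /=.
  by rewrite /horner_eval hornerC.
(* On the line of slope [t0], abscissa and ordinate determine each other, so [zz] matches the points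
   of tangency with the distinct roots of the fibre. *)
apply: perm_size; apply: uniq_perm; last first.
- move=> v; rewrite mem_undup rootr0; apply/mapP/idP => [[y /inF[ty ya yE] ->]|rv].
    have zb := tangent_through_off ty ya; case: ty => _ onC _.
    have /eqP := Phi0E (zz y); rewrite -yE onC subrr mulf_eq0 subr_eq0.
    by rewrite (negPf zb) orbF.
  have [vb mv tv] := fib v rv; set y := a + t0 * (v - b) in tv.
  have ya : y != a.
    by rewrite -subr_eq0 addrAC subrr add0r mulf_neq0 // subr_eq0.
  have [ry vE] : root S y /\ v = zz y.
    by have := @tangent_point_root q k hk a' b' y v b'0; rewrite aE bE; apply.
  exists y => //; rewrite mem_filter sP ry ya /= andbT /T -vE /slope.
  by rewrite addrAC subrr add0r mulfK // subr_eq0.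
- exact: undup_uniq.
rewrite map_inj_in_uniq ?filter_uniq // => y y' /inF[_ _ yE] /inF[_ _ yE'] e.
by rewrite yE yE' e.
Qed.
End OnCurve.
End Affine.

(** * Centers [(1 : b : 0)] with [b] nonzero *)

Section AtInfinity.
Variable b : k.
Hypothesis b0 : b != 0.
Hypothesis hP : forall c, L 0 c + b * L 1 c = 0.

(** The lines through this center are [z - b * x = t]; the parameter is a polynomial in the
    coordinates, so [den] is [1] here. *)
Let xi : {poly {poly k}} := b^-1%:P%:P * ('X - 'X%:P).
Let t : K := phi 'X_1 - kap b * phi 'X_0.
Let ev := eval_tz kap t (phi 'X_1).
Let evC c : ev c%:P%:P = kap c. Proof. by rewrite /ev eval_tzC eval_tC. Qed.
Let evX : ev 'X%:P = t. Proof. by rewrite /ev eval_tzC eval_tX. Qed.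
Let evT : ev 'X = phi 'X_1. Proof. by rewrite /ev eval_tzX. Qed.

Let ev_xi : ev xi = phi 'X_0.
Proof.
rewrite /xi (rmorphM ev) (rmorphB ev) evC evX evT /t opprB addrC subrK.
by rewrite mulrA -rmorphM mulVf // rmorph1 mul1r.
Qed.

Let xi_size : (size xi <= 2)%N.
Proof. by rewrite /xi mul_polyC (leq_trans (size_scale_leq _ _)) // size_XsubC. Qed.

Let formE (c : 'I_2) : phi (affine_form (col c L)) =
  (kap (L 1 c) * t + kap (L 2 c)) * 1.
Proof.
rewrite affine_formE !mxE.
have -> : L 0 c = - (b * L 1 c) by apply/eqP; rewrite -addr_eq0 hP.
by rewrite rmorphN rmorphM /t; ring.
Qed.

Let det0 : L 1 0 * L 2 1 - L 1 1 * L 2 0 != 0.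
Proof.
apply: rank2_minor => // v /matrixP e0 /matrixP e1; apply/matrixP => r c.
have := e0 0 c; have := e1 0 c; rewrite !mxE !big_ord_recl !big_ord0 !mxE !addr0.
set u0 : 'I_2 := lift _ _; move=> f1 f0.
have [->|[->|->]] : r = 0 \/ r = 1 \/ r = 2.
- case: r => [[|[|[|]]]] // lt; [left|right; left|right; right]; exact/val_inj.
- have L0 c' : L 0 c' = - (b * L 1 c') by apply/eqP; rewrite -addr_eq0 hP.
  rewrite !L0; transitivity (- b * (L 1 0 * v 0 c + L 1 u0 * v u0 c)); first by ring.
  by rewrite f0 mulr0.
- exact: f0.
exact: f1.
Qed.

Let chart_den : exists g, chart xi g = 1. Proof. by exists 1; rewrite rmorph1. Qed.

Let chart_lift : exists n g, chart xi g = 'X%:P * 1 ^+ n.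
Proof.
exists 0%N, ('X_1 - b%:MP * 'X_0).
rewrite rmorphB rmorphM chart0 chart1 chartC mulr1 /xi mulrA -!polyCM divff //.
by rewrite mul1r opprB addrC subrK.
Qed.

Lemma infinite_point_not_galois : False.
Proof.
have [x0 [z0 [z00 onC tan]]] := tangent_direction_exists hk b0.
have A0 : curve_A q x0 != 0 by rewrite -onC expf_neq0.
have al0 : alpha q x0 != 0.
  by apply: contraNneq A0 => e; rewrite (curve_A_trace hk) e expr0n mulr0.
pose t0 := z0 - b * x0.
have [Phim Phis] := chart_poly_monic xi_size.
have PhiE : chart_poly q xi = chart_poly q xi * 1 ^+ 0 by rewrite mulr1.
have xE : b^-1 * (z0 - t0) = x0 by rewrite /t0 opprB addrC subrK mulKf.
have restrE : map_poly (horner_eval t0) (chart_poly q xi) = line_restriction q x0 z0 b^-1.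
  rewrite chart_poly_restrict /line_restriction; congr (_ - curve_A q _).
  rewrite /xi rmorphM rmorphB /= !map_polyC map_polyX /= /horner_eval !hornerC hornerX.
  by rewrite /line -mul_polyC -{1}xE !(rmorphM, rmorphB) /=; ring.
have slope : tangent_slope q x0 z0 b^-1.
  by rewrite /tangent_slope tan mulrAC divff // mul1r.
have mq := tangent_mup hk z00 onC slope.
have Phis2 : (2 < size (chart_poly q xi))%N.
  by rewrite Phis !ltnS expn_gt0 q0.
have xz : xi.[z0%:P] = b^-1%:P * (z0%:P - 'X).
  by rewrite /xi hornerM hornerXsubC hornerC.
have [] := @chart_galois_fiber q k hk K phi hphi t xi ev_xi 1 (chart_poly q xi) 0
  chart_lift _ PhiE Phim Phis2 _ chart_den L i hi 1 _ _ formE (oner_neq0 _) det0 t0 z0 gal.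
- by rewrite rmorph1 oner_neq0.
- by move=> g h; rewrite mulr1 => ->; exists h.
- rewrite restrE rootE line_restrictionE subrr mulr0 addr0 onC subrr.
  exact: eqxx.
- have -> : ((chart_poly q xi).[z0%:P])^`().[t0] = alpha q x0 ^+ q * b^-1.
    rewrite deriv_chart_poly xz derivM derivC mul0r add0r derivB derivC derivX.
    rewrite sub0r mulrN1 hornerN hornerC mulrN opprK hornerM hornerC hornerD.
    by rewrite hornerN hornerC hornerX xE.
  by rewrite mulf_neq0 ?expf_neq0 ?invr_eq0.
rewrite restrE mq Phis /= /N => dv _; move: dv.
by rewrite -addn1 dvdn_addr ?dvdn_exp // dvdn1 gtn_eqF.
Qed.
End AtInfinity.
End Forward.

(** * The projective closure *)

Section Closure.
Variable k : fieldType.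
Implicit Types (f : {mpoly k[2]}) (P : 'rV[k]_3).

Lemma mdeg2 (m : 'X_{1..2}) : mdeg m = (m 0%R + m 1%R)%N.
Proof. by rewrite mdegE !big_ord_recl big_ord0 addn0; congr (_ + m _)%N; apply/val_inj. Qed.

Lemma homogenizationE f P : (homogenization f).@[fun i => P 0 i] =
  \sum_(m <- msupp f) f@_m *
    (P 0 0 ^+ m 0 * P 0 1 ^+ m 1 * P 0 2 ^+ ((msize f).-1 - mdeg m)).
Proof.
rewrite /homogenization raddf_sum; apply: eq_bigr => m _ /=.
by rewrite mevalZ !mevalM !rmorphXn /= !mevalXU.
Qed.

Lemma dehomogenize_monomial (a b w : k) i j e : w != 0 ->
  a ^+ i * b ^+ j * w ^+ e = w ^+ e * (w ^+ i * w ^+ j) * ((a / w) ^+ i * (b / w) ^+ j).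
Proof.
move=> w0; rewrite -[RHS]mulrA mulrACA -!exprMn ![w * _]mulrC !divfK //.
by rewrite [RHS]mulrC.
Qed.

Lemma homogenization_affine f P : P 0 2 != 0 ->
  (homogenization f).@[fun i => P 0 i] = P 0 2 ^+ (msize f).-1 *
  f.@[fun i => if i == 0 then P 0 0 / P 0 2 else P 0 1 / P 0 2].
Proof.
move=> w0; rewrite homogenizationE mevalE big_distrr /=.
rewrite big_seq [RHS]big_seq; apply: eq_bigr => m /msize_mdeg_lt lt.
have le : (mdeg m <= (msize f).-1)%N by case: (msize f) lt.
rewrite !big_ord_recl big_ord0 mulr1 /= [RHS]mulrCA; congr (_ * _).
have -> : lift ord0 ord0 = 1 :> 'I_2 by apply/val_inj.
rewrite -[X in _ = _ ^+ X * _](subnK le) exprD {3}mdeg2 exprD.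
exact: dehomogenize_monomial.
Qed.

(** Setting the other coordinate to [0] isolates the pure powers of one variable, whose coefficients
    decide the degree and the behaviour at [(1:0:0)]. *)
Definition restrict (j : 'I_2) : {rmorphism {mpoly k[2]} -> {poly k}} :=
  mmap (polyC : {rmorphism k -> {poly k}}) (fun i => if i == j then 'X else 0).

Lemma coef_restrict j f n : (restrict j f)`_n = f@_(U_(j) *+ n).
Proof.
elim/mpolyind: f => [|c m f _ _ IH]; first by rewrite rmorph0 coef0 mcoeff0.
rewrite rmorphD coefD IH mcoeffD; congr (_ + _).
rewrite -mul_mpolyC rmorphM mul_mpolyC mcoeffZ mcoeffX /= mmapC coefCM mmapX.
congr (_ * _); rewrite /mmap1.
have [mE|mE] := boolP [forall i, (i == j) || (m i == 0%N)].
  have -> : \prod_(i < 2) (if i == j then 'X else 0 : {poly k}) ^+ m i = 'X^(m j).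
    rewrite (bigD1 j) //= eqxx big1 ?mulr1 // => i ij.
    by have /forallP/(_ i) := mE; rewrite (negPf ij) /= => /eqP ->.
  rewrite coefXn eq_sym; congr (_%:R); congr nat_of_bool.
  apply/eqP/eqP => [<-|->]; last by rewrite mulmnE mnmE eqxx mul1n.
  apply/mnmP => i; rewrite mulmnE mnmE; have /forallP/(_ i) := mE.
  by rewrite eq_sym; case: eqP => [-> _|_ /= /eqP ->]; rewrite ?mul1n ?mul0n.
have /forallPn[i] := mE; rewrite negb_or => /andP[ij mi].
rewrite (bigD1 i) //= (negPf ij) expr0n (negPf mi) mul0r coef0.
case: eqP => // e; move: mi; rewrite e mulmnE mnmE (eq_sym j) (negPf ij) mul0n.
by [].
Qed.
End Closure.

Section CurveClosure.
Variables (q : nat) (k : fieldType) (hk : pchar_power q k).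
Let q1 : (1 < q)%N := pchar_power_gt1 hk.
Let N := (q ^ 3).+1.
Local Notation f := (gk_plane_model k q).

Lemma curve_A0 : curve_A q (0 : k) = 0.
Proof.
by apply/eqP; rewrite (curve_A_eq0 hk) expr0n expn_eq0 (gtn_eqF (ltnW q1)).
Qed.

Lemma msize_gk : (N < msize f)%N.
Proof.
rewrite gk_plane_modelE //; set g := curve_A q _ - _.
have := coef_restrict 1 g N; rewrite rmorphB rmorphXn.
rewrite rmorph_curve_A /= !mmapX !mmap1U /=.
have -> : curve_A q (0 : {poly k}) = 0.
  by rewrite -(rmorph0 polyC) -rmorph_curve_A curve_A0.
rewrite sub0r coefN coefXn eqxx => e.
have : (U_(1) *+ N)%MM \in msupp g.
  by rewrite mcoeff_msupp -e oppr_eq0 oner_neq0.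
by move/msize_mdeg_lt; rewrite mdegMn mdeg1 mul1n.
Qed.

Lemma on_closure_affine (P : 'rV[k]_3) : P 0 2 != 0 ->
  on_proj_closure f P <->
  (P 0 1 / P 0 2) ^+ N = curve_A q (P 0 0 / P 0 2).
Proof.
move=> w0; rewrite /on_proj_closure homogenization_affine //.
rewrite gk_plane_modelE // mevalB rmorphXn (rmorph_curve_A q (meval _)) /=.
rewrite !mevalXU /= -/N; split=> [/eqP|->]; last by rewrite subrr mulr0.
by rewrite mulf_eq0 expf_eq0 (negPf w0) andbF subr_eq0 => /eqP.
Qed.

(** At such a point only a pure power of [x] of top total degree could survive. That degree is at
    least [N] because of [z ^ N], whereas [curve_A] has degree below [N]. *)
Lemma on_closure_infinite (P : 'rV[k]_3) : P 0 1 = 0 -> P 0 2 = 0 ->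
  on_proj_closure f P.
Proof.
move=> z0 w0; rewrite /on_proj_closure homogenizationE z0 w0 big_seq big1 // => m mf.
have lt := msize_mdeg_lt mf.
rewrite !expr0n subn_eq0.
have [m1|m1] := eqVneq (m 1) 0%N; last by rewrite mulr0 mul0r mulr0.
case: leqP => [le|_]; last by rewrite !mulr0.
have m0 : (N <= m 0%R)%N.
  have mE := mdeg2 m; rewrite m1 addn0 in mE; rewrite -mE; apply: leq_trans le.
  by have := msize_gk; case: (msize f).
have -> : f@_m = 0; last by rewrite mul0r.
have -> : m = (U_(0%R) *+ m 0%R)%MM.
  apply/mnmP => i; rewrite mulmnE mnmE.
  have [->|->] : i = 0 \/ i = 1.
    by case: i => [[|[|[]]] //= lt']; [left|right]; apply/val_inj.
    by rewrite eqxx mul1n.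
  by rewrite m1.
rewrite -coef_restrict gk_plane_modelE // rmorphB rmorphXn rmorph_curve_A.
rewrite /= !mmapX !mmap1U /= expr0n /= subr0 nth_default //.
by apply: leq_trans m0; rewrite size_curve_A // size_polyX.
Qed.
End CurveClosure.

Lemma galois_point_only (q : nat) (k : closedFieldType) (hk : pchar_power q k)
    (P : 'rV[k]_3) : P != 0 ->
  galois_point (gk_plane_model k q) P ->
  (P == proj_pt 0 1 0)%MS \/ (on_proj_closure (gk_plane_model k q) P /\ P 0 1 = 0).
Proof.
move=> P0 [K [phi [L [i [hphi [rk PL] hi gal]]]]].
have {}PL c : P 0 0 * L 0 c + P 0 1 * L 1 c + P 0 2 * L 2 c = 0.
  have := congr1 (fun M : 'rV_2 => M 0 c) PL; rewrite !mxE !big_ord_recl big_ord0 addr0.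
  have -> : lift ord0 ord0 = 1 :> 'I_3 by apply/val_inj.
  have -> : lift ord0 (lift ord0 ord0) = 2 :> 'I_3 by apply/val_inj.
  by rewrite addrA.
have [w0|w0] := eqVneq (P 0 2) 0; last first.
  have hP c : P 0 0 / P 0 2 * L 0 c + P 0 1 / P 0 2 * L 1 c + L 2 c = 0.
    apply: (mulfI w0); rewrite mulr0 -(PL c); by field.
  have onP := outer_point_not_galois hk hphi rk hi gal hP.
  right; split; first exact/on_closure_affine.
  apply/eqP; apply: contraT => z0; exfalso.
  apply: (smooth_point_not_galois hk hphi rk hi gal hP _ onP).
  by rewrite mulf_neq0 ?invr_eq0.
have [x0|x0] := eqVneq (P 0 0) 0; last first.
  have [z0|z0] := eqVneq (P 0 1) 0.
    by right; split=> //; exact: on_closure_infinite.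
  exfalso; apply: (@infinite_point_not_galois q k hk K phi hphi L i rk hi gal (P 0 1 / P 0 0)).
    by rewrite mulf_neq0 ?invr_eq0.
  move=> c; apply: (mulfI x0); rewrite mulr0 -(PL c) w0; by field.
left.
have PE : P = P 0 1 *: proj_pt 0 1 0.
  apply/rowP => c; rewrite !mxE.
  case: c => [[|[|[|]]]] //= lt.
  - by rewrite mulr0 -x0; congr (P _ _); apply/val_inj.
  - by rewrite mulr1; congr (P _ _); apply/val_inj.
  - by rewrite mulr0 -w0; congr (P _ _); apply/val_inj.
have z0 : P 0 1 != 0.
  by apply: contraNneq P0 => z0; rewrite PE z0 scale0r.
by rewrite PE; apply/eqmxP/eqmx_scale.
Qed.

(** * Galois extensions from split polynomials *)

Lemma minimal_annihilator (F E : fieldType) (i : {rmorphism F -> E}) (w : E)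
    (p : {poly F}) : p != 0 -> root (map_poly i p) w ->
  exists2 p0, irreducible_poly p0 & root (map_poly i p0) w.
Proof.
have [n] := ubnP (size p); elim: n p => // n IH p lt p0 rp.
have [[r [r0 rr ltr]]|H] := classic (exists r : {poly F},
  [/\ r != 0, root (map_poly i r) w & (size r < size p)%N]).
  by apply: (IH r) => //; rewrite -ltnS (leq_trans _ lt).
exists p => //; apply/(subfx_irreducibleP rp p0) => r rr r0.
by rewrite leqNgt; apply/negP => ltr; apply: H; exists r.
Qed.

(** An induction principle in place of a generated subfield. Opposites need no clause of their own:
    in all uses the constant [-1] is a generator. *)
Definition field_generated (E : fieldType) (A : E -> Prop) := forall S : E -> Prop,
  (forall a, A a -> S a) -> (forall x y, S x -> S y -> S (x + y)) ->
  (forall x y, S x -> S y -> S (x * y)) -> (forall x, S x -> S x^-1) ->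
  forall y, S y.

(** The simple extension of [F] by a root of an irreducible annihilator of [w] maps onto [E],
    because [w] generates [E]. In this model [p] splits with simple roots, so the extension is the
    splitting field of a separable polynomial. *)
Lemma galois_of_splitting (F E : fieldType) (i : {rmorphism F -> E}) (w c : E)
    (p : {poly F}) (rs : seq E) :
  c != 0 -> map_poly i p = c *: \prod_(r <- rs) ('X - r%:P) -> uniq rs -> w \in rs ->
  field_generated (fun a => a = w \/ exists b, a = i b) ->
  galois_extension i.
Proof.
move=> c0 pE rs_uniq wrs gen.
have p0 : p != 0.
  rewrite -(map_poly_eq0 i) pE scaler_eq0 (negPf c0) /=.
  by rewrite monic_neq0 ?monic_prod_XsubC.
have rp : root (map_poly i p) w by rewrite pE rootZ // root_prod_XsubC.
have [m irr_m rm] := minimal_annihilator p0 rp.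
have m0 : m != 0 := irredp_neq0 irr_m.
pose L : fieldExtType F := SubFieldExtType rm irr_m.
pose inj : {rmorphism L -> E} := subfx_inj.
have injA a : inj a%:A = i a by exact: subfx_inj_base.
have inj_root : inj (subfx_root i w m) = w by exact: subfx_inj_root.
have surj y : exists x, y = inj x.
  move: y; apply: gen.
  - move=> a [->|[b ->]]; first by exists (subfx_root i w m).
    by exists b%:A; rewrite injA.
  - by move=> _ _ [x ->] [y ->]; exists (x + y); rewrite rmorphD.
  - by move=> _ _ [x ->] [y ->]; exists (x * y); rewrite rmorphM.
  by move=> _ [x ->]; exists x^-1; rewrite fmorphV.
have ex_pre y : exists x, inj x == y by have [x ->] := surj y; exists x.
have inj_bij : bijective inj.
  exists (fun y => xchoose (ex_pre y)) => [x|y]; last exact/eqP/(xchooseP (ex_pre y)).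
  by apply: (fmorph_inj inj); apply/eqP/(xchooseP (ex_pre (inj x))).
have [theta [thK injK]] := bij_rmorph_inv inj_bij.
have thA a : theta (i a) = a%:A by rewrite -injA thK.
pose p' := map_poly (in_alg L) p.
have p'E : p' = theta c *: \prod_(r <- map theta rs) ('X - r%:P).
  have -> : p' = map_poly theta (map_poly i p).
    by rewrite -map_poly_comp; apply: eq_map_poly => a /=; rewrite thA.
  rewrite pE map_polyZ rmorph_prod big_map; congr (_ *: _).
  by apply: eq_bigr => r _; rewrite rmorphB /= map_polyX map_polyC.
have p'1 : p' \is a polyOver 1%VS.
  by apply/polyOverP => j; rewrite coef_map; apply: memvZ; apply: mem1v.
have p'eq : p' %= \prod_(r <- map theta rs) ('X - r%:P).
  by rewrite p'E eqp_scale // fmorph_eq0.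
have full : <<1 & map theta rs>>%VS = {:L}%VS.
  apply/vspaceP => y; rewrite memvf; have [g ->] := subfxEroot rm m0 y.
  apply: rpred_horner.
    apply/polyOverP => j; rewrite coef_map; apply: memvZ.
    by apply: (subvP (subv_adjoin_seq _ _)); apply: mem1v.
  apply: seqv_sub_adjoin; apply/mapP; exists w => //.
  by apply: (fmorph_inj inj); rewrite injK inj_root.
have split : splittingFieldFor 1 p' {:L} by exists (map theta rs).
pose Ls : splittingFieldType F :=
  HB.pack L (FieldExt_isSplittingField.Build F L (ex_intro2 _ _ p' p'1 split)).
exists Ls, theta; split=> //; first by exists inj.
apply/splitting_galoisField; exists p'; split=> //.
by rewrite (eqp_separable p'eq) separable_prod_XsubC map_inj_uniq //; exact: fmorph_inj.
Qed.

Lemma fraction_extend (R : idomainType) (K : fieldType) (f : {rmorphism R -> K}) :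
  (forall r, f r = 0 -> r = 0) ->
  exists i : {rmorphism {fraction R} -> K}, forall r, i (tofrac r) = f r.
Proof.
move=> f_inj.
have ex a : exists nd : R * R, (nd.2 != 0) && (a == tofrac nd.1 / tofrac nd.2).
  by have [n [d [d0 ->]]] := fraction_quotient a; exists (n, d); rewrite d0 eqxx.
pose nd a := xchoose (ex a); pose i a := f (nd a).1 / f (nd a).2.
have fN0 d : d != 0 -> f d != 0 by apply: contraNneq => /f_inj ->.
have iE n d : d != 0 -> i (tofrac n / tofrac d) = f n / f d.
  move=> d0; have /andP[d'0 /eqP e] := xchooseP (ex (tofrac n / tofrac d)).
  rewrite /i -/(nd _) in e d'0 *; move: (nd _) => [n' d'] /= in e d'0 *.
  have td0 : tofrac d != 0 by rewrite tofrac_eq0.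
  have td'0 : tofrac d' != 0 by rewrite tofrac_eq0.
  move/eqP: e; rewrite eqr_div // -!tofracM tofrac_eq => /eqP e2.
  have := fN0 _ d0; have := fN0 _ d'0 => h' h.
  by apply/eqP; rewrite eqr_div // -!rmorphM e2.
have i_add : zmod_morphism i.
  move=> a b; have [n [d [d0 ->]]] := fraction_quotient a.
  have [n' [d' [d'0 ->]]] := fraction_quotient b.
  have td0 : tofrac d != 0 by rewrite tofrac_eq0.
  have td'0 : tofrac d' != 0 by rewrite tofrac_eq0.
  rewrite -mulNr -tofracN addf_div // -!tofracM -tofracD !iE ?mulf_neq0 //.
  by rewrite -mulNr -rmorphN addf_div ?fN0 // -!rmorphM -rmorphD.
have i_mul : monoid_morphism i.
  split; first by rewrite -[1]divr1 -tofrac1 iE ?oner_neq0 // rmorph1 divr1.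
  move=> a b; have [n [d [d0 ->]]] := fraction_quotient a.
  have [n' [d' [d'0 ->]]] := fraction_quotient b.
  by rewrite mulf_div -!tofracM !iE ?mulf_neq0 // !rmorphM mulf_div.
exists (HB.pack i (GRing.isZmodMorphism.Build _ _ i i_add)
  (GRing.isMonoidMorphism.Build _ _ i i_mul) : {rmorphism {fraction R} -> K}).
by move=> r /=; rewrite -[tofrac r]divr1 -tofrac1 iE ?oner_neq0 // rmorph1 divr1.
Qed.

(** As [k] is algebraically closed, an element of [K] outside [k] is transcendental, so [k[t]]
    embeds in [K]. *)
Lemma pullback_exists (k : closedFieldType) (K : fieldType) (kap : {rmorphism k -> K})
    (t : K) : (forall c, t != kap c) ->
  exists i : {rmorphism {fraction {poly k}} -> K},
    (forall c, i (tofrac c%:P) = kap c) /\ i (tofrac 'X) = t.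
Proof.
move=> tN; have [|i iE] := @fraction_extend _ _ (eval_t kap t).
  move=> r; have [s ->] := closed_field_poly_normal r => /eqP.
  rewrite -mul_polyC rmorphM eval_tC mulf_eq0 fmorph_eq0 => /orP[/eqP ->|].
    by rewrite polyC0 mul0r.
  rewrite rmorph_prod prodf_seq_eq0 => /hasP[c _].
  rewrite -[X in X -> _]/(is_true (true && (eval_t kap t ('X - c%:P) == 0))).
  by rewrite rmorphB eval_tX eval_tC subr_eq0 (negPf (tN c)).
by exists i; split=> [c|]; rewrite iE ?eval_tC ?eval_tX.
Qed.

Lemma prod_roots (K : fieldType) (p : {poly K}) (rs : seq K) :
  p \is monic -> size p = (size rs).+1 -> uniq rs -> (forall r, r \in rs -> root p r) ->
  p = \prod_(r <- rs) ('X - r%:P).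
Proof.
move=> pm sp ru rr; rewrite {1}(all_roots_prod_XsubC sp).
- by rewrite (monicP pm) scale1r.
- exact/allP.
by rewrite uniq_rootsE.
Qed.

Lemma irreducible_factor (F : fieldType) (p : {poly F}) : (1 < size p)%N ->
  exists2 m, irreducible_poly m & m %| p.
Proof.
have [n] := ubnP (size p); elim: n p => // n IH p lt p1.
have [[d [d1 dp ld]]|H] := classic (exists d : {poly F},
    [/\ (1 < size d)%N, d %| p & (size d < size p)%N]).
  have [|m mi md] := IH d _ d1; first by rewrite -ltnS (leq_trans _ lt).
  by exists m => //; exact: dvdp_trans dp.
exists p; last exact: dvdpp.
have p0 : p != 0 by rewrite -size_poly_gt0 ltnW.
split=> // d d1 dp; rewrite -dvdp_size_eqp // eqn_leq dvdp_leq //= leqNgt.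
apply/negP => ld; apply: H; exists d; split=> //.
have : (0 < size d)%N by rewrite size_poly_gt0 (dvdpN0 dp).
by case: (size d) d1 => [|[|]].
Qed.

Section RootSequence.
Variable k : closedFieldType.

Definition rootseq (p : {poly k}) : seq k := sval (closed_field_poly_normal p).

Lemma rootseqP (p : {poly k}) n : p \is monic -> size p = n.+1 ->
  (forall x, root p x -> p^`().[x] != 0) ->
  [/\ uniq (rootseq p), size (rootseq p) = n & forall x, (x \in rootseq p) = root p x].
Proof.
move=> pm sp H; rewrite /rootseq; case: closed_field_poly_normal => rs /= pE.
rewrite (monicP pm) scale1r in pE.
have rE x : (x \in rs) = root p x by rewrite pE root_prod_XsubC.
split=> //; last by move: sp; rewrite pE size_prod_XsubC => -[].
apply: count_mem_uniq => x; rewrite -mu_prod_XsubC -pE.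
have [xr|xr] := boolP (x \in rs); last by rewrite mupNroot // -rE.
have p0 : p != 0 by rewrite monic_neq0.
apply/eqP; rewrite eqn_leq -XsubC_dvd // dvdp_XsubCl -rE xr andbT leqNgt.
by apply/negP => /mup_deriv /eqP; apply/negP/H; rewrite -rE.
Qed.
End RootSequence.

Section RootsOfUnity.
Variables (q : nat) (k : closedFieldType) (hk : pchar_power q k).
Let N := (q ^ 3).+1.

Lemma roots_of_unity : exists zs : seq k,
  [/\ uniq zs, size zs = N & forall x, (x \in zs) = (x ^+ N == 1)].
Proof.
have [||x|ru sr rE] := @rootseqP k ('X^N - 1) N.
- by rewrite monicXnsubC.
- by rewrite size_XnsubC.
- rewrite rootE !hornerE subr_eq0 => /eqP xN.
  rewrite derivB derivXn derivC subr0 hornerMn hornerXn /=.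
  rewrite -mulr_natr -natr1 (natqX0 hk) add0r mulr1.
  apply/eqP => x0; move/eqP: xN; rewrite /N exprS x0 mulr0 eq_sym oner_eq0.
  by [].
by exists (rootseq ('X^N - 1)); split=> // x; rewrite rE rootE !hornerE subr_eq0.
Qed.

Lemma XnsubC_split (K : fieldType) (kap : {rmorphism k -> K}) (z : K) : z != 0 ->
  exists rs : seq K, [/\ uniq rs, z \in rs &
   'X^N - (z ^+ N)%:P = \prod_(r <- rs) ('X - r%:P)].
Proof.
move=> z0; have [zs [zu sz zE]] := roots_of_unity.
exists [seq kap y * z | y <- zs].
have ru : uniq [seq kap y * z | y <- zs].
  by rewrite map_inj_uniq // => x y /(mulIf z0) /fmorph_inj.
split=> //.
  by apply/mapP; exists 1; rewrite ?zE ?expr1n // rmorph1 mul1r.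
apply: prod_roots => //; rewrite ?monicXnsubC ?size_XnsubC // ?size_map ?sz //.
move=> _ /mapP[y + ->]; rewrite zE => /eqP yN.
by rewrite rootE !hornerE exprMn -rmorphXn yN rmorph1 mul1r subrr.
Qed.
End RootsOfUnity.

(** * The function field *)

Section FunctionField.
Variables (q : nat) (k : closedFieldType) (hk : pchar_power q k).
Let q1 : (1 < q)%N := pchar_power_gt1 hk.
Let q0 : (0 < q)%N := ltnW q1.
Let N := (q ^ 3).+1.
Lemma degree_curve_A : size (curve_A q ('X : {poly k})) = N.
Proof.
have st : size (trace_q q ('X : {poly k})) = q.+1.
  by rewrite /trace_q size_polyDl ?size_polyXn // size_polyX.
have q10 : (0 < q - 1)%N by rewrite subn_gt0.
have [t0 al0 _] := size_trace_alpha hk.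
have stq : size (trace_q q ('X : {poly k}) ^+ (q - 1)) = (q * (q - 1)).+1.
  have n0 : trace_q q ('X : {poly k}) ^+ (q - 1) != 0 by rewrite expf_neq0.
  by rewrite (polySpred n0) size_exp st.
have sal : size (alpha q ('X : {poly k})) = (q * (q - 1)).+1.
  rewrite /alpha addrC size_polyDl size_polyN stq // size_poly1 ltnS.
  by rewrite muln_gt0 q0.
have n0 : alpha q ('X : {poly k}) ^+ q != 0 by rewrite expf_neq0.
have q2 : (1 < q ^ 2)%N by rewrite -{1}(exp1n 2) ltn_exp2r.
have sB : size ('X - 'X^(q ^ 2) : {poly k}) = (q ^ 2).+1.
  by rewrite addrC size_polyDl size_polyN size_polyXn // size_polyX ltnS.
have B0 : 'X - 'X^(q ^ 2) != 0 :> {poly k} by rewrite -size_poly_eq0 sB.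
have sq : size (alpha q ('X : {poly k}) ^+ q) = (q * (q - 1) * q).+1.
  by rewrite (polySpred n0) size_exp sal.
rewrite /curve_A size_mul // sB sq addnS /= addSn; congr _.+1.
by rewrite !expnS expn0 muln1 mulnBr muln1 mulnBl mulnA subnK // leq_mul // leq_pmulr.
Qed.

(** Every root of the factor is an [N]-th root of [A]. The constant term of the monic factor is a
    signed product of such roots, so its [N]-th power is known. *)
Lemma kummer_factor_norm (F : fieldType) (kap : {rmorphism k -> F}) (A : F)
    (m : {poly F}) : A != 0 -> irreducible_poly m -> m %| 'X^N - A%:P ->
  exists c, c ^+ N = ((-1) ^+ N * A) ^+ (size m).-1.
Proof.
move=> A0 irr_m mP0; have [L _ [z rz _]] := irredp_FAdjoin irr_m.
pose iota : {rmorphism F -> L} := in_alg L.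
have PE : map_poly iota ('X^N - A%:P) = 'X^N - (iota A)%:P.
  by rewrite rmorphB rmorphXn /= map_polyX map_polyC.
have zN : z ^+ N = iota A.
  have : root (map_poly iota ('X^N - A%:P)) z.
    by apply: root_dvdp rz; rewrite dvdp_map.
  by rewrite PE rootE !hornerE subr_eq0 => /eqP.
have z0 : z != 0.
  by apply/eqP => z0; move/eqP: zN; rewrite z0 /N exprS mul0r eq_sym fmorph_eq0 (negPf A0).
have m0 : m != 0 := irredp_neq0 irr_m.
have lc0 : (lead_coef m)^-1 != 0 by rewrite invr_eq0 lead_coef_eq0.
pose M := (lead_coef m)^-1 *: m.
have Mm : M \is monic by rewrite monicE lead_coefZ mulVf // lead_coef_eq0.
have [rs [_ _ rsE]] := XnsubC_split hk (iota \o kap) z0.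
have : map_poly iota M %| \prod_(r <- rs) ('X - r%:P).
  by rewrite -rsE zN -PE dvdp_map /M dvdpZl.
case/dvdp_prod_XsubC => b; set s := mask b rs => Ms.
have MsE : map_poly iota M = \prod_(r <- s) ('X - r%:P).
  by apply/eqP; rewrite -eqp_monic ?monic_prod_XsubC ?monic_map.
have sr y : y \in s -> y ^+ N = iota A.
  move=> /mem_mask yr; have : root ('X^N - (z ^+ N)%:P) y.
    by rewrite rsE root_prod_XsubC.
  by rewrite rootE !hornerE subr_eq0 zN => /eqP.
have szm : size m = (size s).+1.
  by rewrite -(size_prod_XsubC s id) -MsE size_map_poly size_scale.
exists M`_0; rewrite szm; apply: (fmorph_inj iota).
rewrite rmorphXn -coef_map -horner_coef0 MsE.
rewrite horner_prod big_seq (eq_bigr (fun y => - y)); last first.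
  by move=> y _; rewrite hornerXsubC sub0r.
rewrite -big_seq -prodrXl big_seq (eq_bigr (fun=> iota ((-1) ^+ N * A))).
  by rewrite -big_seq big_const_seq count_predT rmorphXn -Monoid.iteropE.
by move=> y ys; rewrite (exprNn y) (sr _ ys) (rmorphM iota) (rmorphXn iota) rmorphN1.
Qed.

Section RationalFunctions.
Variables (F : fieldType) (toF : {rmorphism {poly k} -> F}).
Hypothesis toF_inj : injective toF.
Hypothesis F_frac : forall a, exists n d, d != 0 /\ a = toF n / toF d.
Let toF_eq0 p : (toF p == 0) = (p == 0).
Proof. by rewrite -(rmorph0 toF) (inj_eq toF_inj). Qed.

(** Degrees in [x] give that [N] divides [q ^ 3 * r], hence [r]: the degree [q ^ 3] of [curve_A] is
    prime to [N]. *)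
Lemma norm_degree (c : F) r (s : k) : (0 < r)%N -> s != 0 ->
  c ^+ N = toF (s *: curve_A q 'X) ^+ r -> (N <= r)%N.
Proof.
move=> r0 s0; have [n [d [d0 ->]]] := F_frac c.
have A0 : curve_A q ('X : {poly k}) != 0 by rewrite -size_poly_eq0 degree_curve_A.
move=> e; have : toF (n ^+ N) = toF ((s *: curve_A q 'X) ^+ r * d ^+ N).
  rewrite rmorphM !rmorphXn -e expr_div_n divfK // expf_neq0 //.
  by rewrite toF_eq0.
move/toF_inj/(congr1 (fun p : {poly k} => (size p).-1)).
have sA0 : s *: curve_A q ('X : {poly k}) != 0 by rewrite scaler_eq0 negb_or s0.
have sz1 := polySpred (expf_neq0 r sA0); have sz2 := polySpred (expf_neq0 N d0).
rewrite !size_exp size_scale // degree_curve_A /= in sz1 sz2.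
rewrite size_mul ?expf_neq0 // size_exp sz1 sz2 addSn addnS /= => e'.
have : (N %| q ^ 3 * r)%N.
  have := dvdn_mull (size n).-1 (dvdnn N).
  by rewrite e' dvdn_addl // dvdn_mull.
rewrite Gauss_dvdr ?coprimeSn // => /dvdn_leq; exact.
Qed.

(** By the two preceding lemmas an irreducible factor of [X ^ N - curve_A] over [k(x)] has degree at
    least [N], so adjoining one of its roots adds no relation of lower degree in [z]. Division by
    the monic equation then shows that the kernel is generated by the curve. *)
Lemma function_field_over : exists (K : fieldType) (phi : {rmorphism {mpoly k[2]} -> K}),
  is_function_field (gk_plane_model k q) phi.
Proof.
pose A : F := toF (curve_A q 'X).
have Ap0 : curve_A q ('X : {poly k}) != 0 by rewrite -size_poly_eq0 degree_curve_A.
have A0 : A != 0 by rewrite toF_eq0.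
have [|m irr_m mP0] := @irreducible_factor _ ('X^N - A%:P); first by rewrite size_XnsubC.
have m0 : m != 0 := irredp_neq0 irr_m.
have size_m : (N < size m)%N.
  have [c cE] := kummer_factor_norm (toF \o polyC) A0 irr_m mP0.
  have m1 : (1 < size m)%N by case: irr_m.
  have r0 : (0 < (size m).-1)%N by case: (size m) m1.
  have s0 : (-1 : k) ^+ N != 0 by rewrite expf_neq0 // oppr_eq0 oner_neq0.
  rewrite (polySpred m0) ltnS; apply: (norm_degree r0 s0 (c := c)).
  rewrite cE -mul_polyC rmorphM; congr ((_ * _) ^+ _).
  by rewrite rmorphXn rmorphXn !rmorphN1.
have [L _ [z rz full]] := irredp_FAdjoin irr_m.
pose iota : {rmorphism F -> L} := in_alg L.
have zN : z ^+ N = iota A.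
  have : root (map_poly iota ('X^N - A%:P)) z.
    by apply: root_dvdp rz; rewrite dvdp_map.
  by rewrite rootE rmorphB rmorphXn /= map_polyX map_polyC !hornerE subr_eq0 => /eqP.
have ker_z (h : {poly F}) : root (map_poly iota h) z -> (size h <= N)%N -> h = 0.
  move=> rh; apply: contraTeq => h0; rewrite -ltnNge.
  apply: leq_trans size_m _.
  exact: (iffRL (subfx_irreducibleP rz m0) irr_m).
pose phi : {rmorphism {mpoly k[2]} -> L} :=
  mmap (iota \o toF \o polyC : {rmorphism k -> L})
    (fun i : 'I_2 => if i == 0 then iota (toF 'X) else z).
have phiC c : phi c%:MP = iota (toF c%:P) by exact: mmapC.
have phi0 : phi 'X_0 = iota (toF 'X) by rewrite /phi /= mmapX mmap1U.
have phi1 : phi 'X_1 = z by rewrite /phi /= mmapX mmap1U.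
pose psi := eval_tz (@mpolyC 2 k : {rmorphism k -> {mpoly k[2]}}) 'X_0 'X_1.
have psiC c : phi (psi c%:P) = iota (toF c).
  rewrite /psi eval_tzC; set pt := eval_t _ _.
  elim/poly_ind: c => [|c a IHc]; first by rewrite (rmorph0 pt) !rmorph0.
  rewrite (rmorphD pt) (rmorphM pt) (rmorphD phi) (rmorphM phi) IHc.
  by rewrite /pt eval_tC eval_tX phi0 phiC !(rmorphD, rmorphM).
have psiX : psi 'X = 'X_1 by rewrite /psi eval_tzX.
have psiE g : phi (psi g) = (map_poly iota (map_poly toF g)).[z].
  elim/poly_ind: g => [|g c IH]; first by rewrite (rmorph0 psi) !rmorph0 horner0.
  rewrite (rmorphD psi) (rmorphM psi) (rmorphD phi) (rmorphM phi) IH psiX psiC phi1.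
  by rewrite !(rmorphD, rmorphM) /= !map_polyX !map_polyC hornerD hornerM hornerX hornerC.
have psi_surj g : exists g', g = psi g'.
  elim/mpolyind: g => [|c m' g _ _ [g' ->]]; first by exists 0; rewrite rmorph0.
  exists (c%:P%:P * ('X%:P ^+ m' 0 * 'X ^+ m' 1) + g').
  rewrite (rmorphD psi) !(rmorphM psi) !(rmorphXn psi) psiX /psi !eval_tzC eval_tC eval_tX.
  rewrite mul_mpolyC mpolyXE_id !big_ord_recl big_ord0 mulr1.
  by have -> : lift ord0 ord0 = 1 :> 'I_2 by apply/val_inj.
pose P1 : {poly {poly k}} := 'X^N - (curve_A q 'X)%:P.
have P1m : P1 \is monic by rewrite monicXnsubC.
have psiP1 : psi P1 = - gk_plane_model k q.
  rewrite gk_plane_modelE // /P1 (rmorphB psi) (rmorphXn psi) psiX /psi eval_tzC.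
  by rewrite rmorph_curve_A eval_tX opprB.
exists L, phi; split=> [g|t].
  split=> [g0|[h ->]]; last first.
    rewrite rmorphM -[gk_plane_model k q]opprK -psiP1 rmorphN psiE /P1.
    rewrite !(rmorphB, rmorphXn) /= !map_polyX !map_polyC hornerD hornerN hornerXn hornerC.
    by rewrite zN subrr oppr0 mulr0.
  have [g' gE] := psi_surj g.
  have := Pdiv.RingMonic.rdivp_eq P1m g'.
  set Q := Pdiv.Ring.rdivp _ _; set r := Pdiv.Ring.rmodp _ _ => gE'.
  have szr : (size r <= N)%N.
    rewrite -ltnS -(@size_XnsubC {poly k} N (curve_A q 'X)) //.
    by rewrite Pdiv.Ring.ltn_rmodpN0 // monic_neq0.
  have r0 : r = 0.
    have e : map_poly toF r = 0.
      apply: ker_z; last by rewrite (leq_trans (size_poly _ _)).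
      rewrite rootE -psiE; move: g0; rewrite gE gE' (rmorphD psi) (rmorphM psi).
      rewrite psiP1 rmorphD rmorphM rmorphN.
      have -> : phi (gk_plane_model k q) = 0.
        rewrite -[gk_plane_model k q]opprK -psiP1 rmorphN psiE /P1.
        rewrite !(rmorphB, rmorphXn) /= !map_polyX !map_polyC hornerD hornerN hornerXn hornerC.
        by rewrite zN subrr oppr0.
      by rewrite oppr0 mulr0 add0r => ->.
    apply/polyP => j; apply: toF_inj; rewrite -coef_map e !coef0 rmorph0.
    by [].
  by exists (- psi Q); rewrite gE gE' r0 addr0 (rmorphM psi) psiP1; ring.
have F_phi (a : F) : exists g h, phi h != 0 /\ iota a = phi g / phi h.
  have [n [d [d0 ->]]] := F_frac a; exists (psi n%:P), (psi d%:P).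
  by rewrite !psiC fmorph_eq0 toF_eq0 fmorph_div.
have : t \in <<1; z>>%VS by rewrite full memvf.
case/Fadjoin_polyP => r /polyOverP r1 ->.
elim/poly_ind: r r1 => [|r c IH] r1.
  by exists 0, 1; rewrite horner0 rmorph0 rmorph1 oner_neq0 mul0r.
have [|g [h [h0 e]]] := IH.
  by move=> j; have := r1 j.+1; rewrite coefD coefMX coefC /= addr0.
have := r1 0%N; rewrite coefD coefMX coefC /= add0r => /vlineP[a aE].
have [g' [h' [h'0 e']]] := F_phi a.
exists (g * h' * 'X_1 + g' * h), (h * h').
rewrite rmorphM mulf_neq0 //; split=> //.
rewrite rmorphD !rmorphM phi1 hornerD hornerM hornerX hornerC e.
have -> : c = phi g' / phi h' by rewrite -e' aE.
by field; rewrite h0 h'0.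
Qed.
End RationalFunctions.

Lemma function_field_exists : exists (K : fieldType) (phi : {rmorphism {mpoly k[2]} -> K}),
  is_function_field (gk_plane_model k q) phi.
Proof.
apply: (@function_field_over {fraction {poly k}} (@tofrac {poly k})).
  by move=> x y /eqP; rewrite tofrac_eq => /eqP.
exact: fraction_quotient.
Qed.
End FunctionField.

(** * Galois points *)

Lemma dep_pairs (T U : eqType) (s : seq T) (t : T -> seq U) :
  uniq s -> {in s, forall x, uniq (t x)} ->
  exists ps : seq (T * U), [/\ uniq ps, size ps = sumn [seq size (t x) | x <- s]
    & forall x y, ((x, y) \in ps) = (x \in s) && (y \in t x)].
Proof.
move=> us ut; exists [seq (x, y) | x <- s, y <- t x]; split.
- by apply: allpairs_uniq_dep => // -[x y] [x' y'] _ _ /= [-> ->].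
- exact: size_allpairs_dep.
move=> x y; apply/allpairsPdep/andP => [[x' [y' [xs yt [-> ->]]]] //|[xs yt]].
by exists x, y.
Qed.

Lemma map_XnsubC (R S : nzRingType) (f : {rmorphism R -> S}) n c :
  map_poly f ('X^n - c%:P) = 'X^n - (f c)%:P.
Proof. by rewrite rmorphB rmorphXn /= map_polyX map_polyC. Qed.

Lemma map_curve_A_subC (R S : comNzRingType) (f : {rmorphism R -> S}) q c :
  map_poly f (curve_A q 'X - c%:P) = curve_A q 'X - (f c)%:P.
Proof.
by rewrite rmorphB /= (rmorph_curve_A q (map_poly f)) /= map_polyX map_polyC.
Qed.

Section Constants.
Variables (k : closedFieldType) (K : fieldType) (kap : {rmorphism k -> K}).

Definition nonconstant (y : K) := forall c, y != kap c.

Lemma nonconstant_root (p : {poly k}) y :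
  nonconstant y -> (map_poly kap p).[y] = 0 -> p = 0.
Proof.
move=> yN; have [s ->] := closed_field_poly_normal p => /eqP.
rewrite map_polyZ hornerZ mulf_eq0 fmorph_eq0 => /orP[/eqP ->|].
  by rewrite scale0r.
rewrite rmorph_prod horner_prod prodf_seq_eq0 => /hasP[c _] /=.
by rewrite rmorphB /= map_polyX map_polyC hornerXsubC subr_eq0 (negPf (yN c)).
Qed.

(** The common frame for all centers: it leaves only to exhibit a polynomial over [k[t]] whose
    roots, all distinct, can be listed in [K], one of them generating [K] over [k(t)]. *)
Lemma galois_over_param (t w c : K) (P : {poly {poly k}}) (rs : seq K) :
  nonconstant t -> c != 0 ->
  map_poly (eval_t kap t) P = c *: \prod_(r <- rs) ('X - r%:P) ->
  uniq rs -> w \in rs ->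
  field_generated (fun a => [\/ a = t, a = w | exists b, a = kap b]) ->
  exists i : {rmorphism {fraction {poly k}} -> K},
    [/\ forall c, i (tofrac c%:P) = kap c, i (tofrac 'X) = t & galois_extension i].
Proof.
move=> tN c0 PE urs wrs gen.
have [i [iC iX]] := pullback_exists tN; exists i; split=> //.
have iE p : i (tofrac p) = eval_t kap t p.
  elim/poly_ind: p => [|p a IH]; first by rewrite (rmorph0 (eval_t kap t)) !rmorph0.
  rewrite (rmorphD (eval_t kap t)) (rmorphM (eval_t kap t)) eval_tC eval_tX -IH.
  by rewrite tofracD tofracM (rmorphD i) (rmorphM i) iC iX.
apply: (@galois_of_splitting _ _ i w c (map_poly (@tofrac _) P) rs) => //.
  by rewrite -PE -map_poly_comp; apply: eq_map_poly => p /=; rewrite iE.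
move=> S SA SD SM SV; apply: gen => // a [->|->|[b ->]]; apply: SA.
- by right; exists (tofrac 'X).
- by left.
by right; exists (tofrac b%:P).
Qed.
End Constants.

Section RootSequences.
Variables (k : closedFieldType) (q : nat) (hk : pchar_power q k).
Let q1 : (1 < q)%N := pchar_power_gt1 hk.

Definition Fq2 : seq k := rootseq ('X^(q ^ 2) - 'X).

Lemma Fq2P : [/\ uniq Fq2, size Fq2 = (q ^ 2)%N
  & forall b, (b \in Fq2) = (b ^+ (q ^ 2) == b)].
Proof.
have q2 : (1 < q ^ 2)%N by rewrite -{1}(exp1n 2) ltn_exp2r.
have s : (size (- 'X : {poly k})%R < size ('X^(q ^ 2) : {poly k}))%N.
  by rewrite size_polyN size_polyX size_polyXn ltnS.
have [|||u sz m] := @rootseqP k ('X^(q ^ 2) - 'X) (q ^ 2).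
- by rewrite monicE lead_coefDl // lead_coefXn.
- by rewrite size_polyDl // size_polyXn.
- move=> x _; rewrite derivB derivX (deriv_frob hk) sub0r hornerN hornerC.
  by rewrite oppr_eq0 oner_neq0.
by split=> // b; rewrite m rootE !hornerE subr_eq0.
Qed.

Lemma trace_fiberP (d : k) : let cs := rootseq ('X^q + 'X - d%:P) in
  [/\ uniq cs, size cs = q & forall c, (c \in cs) = (trace_q q c == d)].
Proof.
have s1 : (size ('X - d%:P : {poly k})%R < size ('X^q : {poly k})%R)%N.
  by rewrite size_XsubC size_polyXn.
have [|||u sz m] := @rootseqP k ('X^q + 'X - d%:P) q.
- by rewrite -addrA monicE lead_coefDl // lead_coefXn.
- by rewrite -addrA size_polyDl // size_polyXn.
- move=> x _; rewrite derivB derivD derivC (deriv_frob1 hk) derivX add0r subr0.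
  by rewrite hornerC oner_neq0.
by split=> // c; rewrite m rootE !hornerE subr_eq0.
Qed.

Lemma norm_fiberP (d : k) : d != 0 -> let cs := rootseq ('X^(q.+1) - d%:P) in
  [/\ uniq cs, size cs = q.+1 & forall c, (c \in cs) = (c ^+ q.+1 == d)].
Proof.
move=> d0; have [|||u sz m] := @rootseqP k ('X^(q.+1) - d%:P) q.+1.
- by rewrite monicXnsubC.
- by rewrite size_XnsubC.
- move=> x; rewrite rootE !hornerE subr_eq0 => /eqP xE.
  rewrite derivB derivXn derivC subr0 hornerMn hornerXn /=.
  rewrite -mulr_natr -natr1 (natq0 hk) add0r mulr1.
  by apply: contraNneq d0 => x0; rewrite -xE exprS x0 mulr0.
by split=> // c; rewrite m rootE !hornerE subr_eq0.
Qed.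
End RootSequences.

(** * Projections from [(0:1:0)] and [(1:0:0)] *)

Section GaloisSplitting.
Variables (q : nat) (k : closedFieldType) (hk : pchar_power q k).
Let q1 : (1 < q)%N := pchar_power_gt1 hk.
Let q0 : (0 < q)%N := ltnW q1.
Let N := (q ^ 3).+1.
Variables (K : fieldType) (kap : {rmorphism k -> K}).
Let hK : pchar_power q K := pchar_power_rmorph kap hk.
Variables (x z : K).
Hypothesis x_nonconst : nonconstant kap x.
Hypothesis on_curve : z ^+ N = curve_A q x.
Hypothesis gen : field_generated (fun a => [\/ a = x, a = z | exists b, a = kap b]).

Lemma curve_A_nonconst c : curve_A q x != kap c.
Proof.
apply/eqP => e; have := degree_curve_A hk.
suff -> : curve_A q ('X : {poly k}) = c%:P.
  rewrite size_polyC => h; have : (1 < N)%N by rewrite /N ltnS expn_gt0 q0.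
  by rewrite /N -h; case: (c != 0).
apply/eqP; rewrite -subr_eq0; apply/eqP; apply: (nonconstant_root x_nonconst).
rewrite rmorphB /= (rmorph_curve_A q (map_poly kap)) /= map_polyX map_polyC.
by rewrite hornerD hornerN hornerC horner_curve_A hornerX e subrr.
Qed.

Lemma z_neq0 : z != 0.
Proof.
apply/eqP => z0; have := curve_A_nonconst 0.
by rewrite -on_curve z0 rmorph0 /N exprS mul0r eqxx.
Qed.

Lemma galois_over_x : exists i : {rmorphism {fraction {poly k}} -> K},
  [/\ forall c, i (tofrac c%:P) = kap c, i (tofrac 'X) = x & galois_extension i].
Proof.
have [rs [urs zrs rsE]] := XnsubC_split hk kap z_neq0.
apply: (@galois_over_param _ _ kap x z 1 ('X^N - (curve_A q 'X)%:P) rs) => //.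
  by rewrite oner_neq0.
rewrite scale1r -rsE -/N on_curve map_XnsubC.
by rewrite (rmorph_curve_A q (eval_t kap x)) eval_tX.
Qed.

Let M := (q ^ 2 - q + 1)%N.
Let MN : (M * q.+1 = N)%N.
Proof.
have le : (q <= q ^ 2)%N by rewrite -{1}[q]expn1 leq_pexp2l.
have le2 : (q ^ 2 <= q ^ 3)%N by rewrite leq_pexp2l.
rewrite /M /N mulnDl mulnBl mul1n !mulnS -expnSr mulnn.
by move: le le2; move: (q ^ 3)%N (q ^ 2)%N; lia.
Qed.

(* The coordinate [y] of the space curve, from which the plane model projects. *)
Definition gk_y : K := z ^+ M / alpha q x.

Let alpha0 : alpha q x != 0.
Proof.
apply/eqP => e; have := curve_A_nonconst 0.
by rewrite (curve_A_trace hK) e exprS mul0r mulr0 rmorph0 eqxx.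
Qed.

Lemma gk_yE : gk_y ^+ q.+1 = trace_q q x.
Proof.
rewrite /gk_y exprMn exprVn -exprM MN on_curve (curve_A_trace hK).
by rewrite mulfK // expf_neq0.
Qed.

Lemma gk_y_nonconst : nonconstant kap gk_y.
Proof.
move=> c; apply/eqP => e.
have : 'X^q + 'X - (c ^+ q.+1)%:P = 0 :> {poly k}.
  apply: (nonconstant_root x_nonconst).
  rewrite rmorphB rmorphD rmorphXn /= map_polyX map_polyC /= (rmorphXn kap) -e gk_yE.
  by rewrite !hornerE /trace_q subrr.
have s1 : (size ('X - (c ^+ q.+1)%:P : {poly k})%R < size ('X^q : {poly k})%R)%N.
  by rewrite size_XsubC size_polyXn.
move/(congr1 (fun p : {poly k} => size p)); rewrite -addrA size_polyDl //.
by rewrite size_polyXn size_poly0.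
Qed.

(** On the Hermitian curve [alpha X = 1 - Y ^ (q ^ 2 - 1)], which turns [trace_q * alpha ^ (q + 1)]
    into a single [(q + 1)]-st power. *)
Lemma curve_A_norm (X Y : K) : Y ^+ q.+1 = trace_q q X ->
  curve_A q X = (Y - Y ^+ (q ^ 2)) ^+ q.+1.
Proof.
move=> e; rewrite (curve_A_trace hK) -e -exprMn; congr (_ ^+ _).
rewrite /alpha -e mulrBr mulr1 -exprM -exprS; congr (_ - _ ^+ _).
by rewrite -mulnn; move: q0; clear; nia.
Qed.

(** The substitutions [y -> y + b], [x -> x + b ^ q * y + c] with [b ^ (q ^ 2) = b] and
    [c ^ q + c = b ^ (q + 1)] preserve the Hermitian curve and [y - y ^ (q ^ 2)], hence [z ^ N].
    Their number [q ^ 2 * q] is the degree of [curve_A], so they give all roots. *)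
Lemma galois_over_z : exists i : {rmorphism {fraction {poly k}} -> K},
  [/\ forall c, i (tofrac c%:P) = kap c, i (tofrac 'X) = z & galois_extension i].
Proof.
have yE := gk_yE; have yN := gk_y_nonconst; move: gk_y yE yN => y yE yN.
have [ub sb mb] := Fq2P hk.
pose cs b := rootseq ('X^q + 'X - (b ^+ q.+1)%:P : {poly k}).
have csP b := trace_fiberP hk (b ^+ q.+1).
have [ps [ups sps mps]] : exists ps : seq (k * k),
    [/\ uniq ps, size ps = sumn [seq size (cs b) | b <- Fq2 k q]
    & forall b c, ((b, c) \in ps) = (b \in Fq2 k q) && (c \in cs b)].
  by apply: dep_pairs => // b _; have [] := csP b.
pose rt (bc : k * k) : K := x + kap (bc.1 ^+ q) * y + kap bc.2.
pose P : {poly {poly k}} := curve_A q 'X - ('X^N)%:P.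
have PE : map_poly (eval_t kap z) P = curve_A q 'X - (z ^+ N)%:P.
  by rewrite /P map_curve_A_subC (rmorphXn (eval_t kap z)) eval_tX.
have sP : size (map_poly (eval_t kap z) P) = N.
  have sA : size (curve_A q ('X : {poly K})) = N.
    rewrite /N -(degree_curve_A hk) -(size_map_poly kap).
    by rewrite (rmorph_curve_A q (map_poly kap)) /= map_polyX.
  rewrite PE size_polyDl sA // size_polyN; apply: leq_ltn_trans (size_polyC_leq1 _) _.
  by rewrite /N ltnS expn_gt0 q0.
have P0 : map_poly (eval_t kap z) P != 0 by rewrite -size_poly_eq0 sP.
have szps : size ps = (q ^ 3)%N.
  have sumE (l : seq k) : sumn [seq size (cs b) | b <- l] = (size l * q)%N.
    by elim: l => //= b l ->; have [_ -> _] := csP b.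
  by rewrite sps sumE sb -expnSr.
(* Two equal roots with different [b] would make [y] a constant. *)
have urs : uniq (map rt ps).
  rewrite map_inj_in_uniq // => -[b c] [b' c'] _ _; rewrite /rt /= => e.
  have e1 : (kap (b ^+ q) - kap (b' ^+ q)) * y = kap c' - kap c.
    transitivity ((x + kap (b ^+ q) * y + kap c) -
      (x + kap (b' ^+ q) * y + kap c') + kap c' - kap c); first by ring.
    by rewrite e subrr add0r.
  have [bb|bb] := eqVneq (b ^+ q) (b' ^+ q).
    move: e1; rewrite bb subrr mul0r => /esym/eqP; rewrite subr_eq0.
    by rewrite (inj_eq (fmorph_inj kap)) => /eqP ->; rewrite (frob_inj hk bb).
  have := yN ((c' - c) / (b ^+ q - b' ^+ q)).
  rewrite fmorph_div !rmorphB -e1 mulrAC divff ?mul1r ?eqxx // subr_eq0.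
  by rewrite (inj_eq (fmorph_inj kap)).
have zN : nonconstant kap z.
  move=> c; apply/eqP => e; have := curve_A_nonconst (c ^+ N).
  by rewrite -on_curve e rmorphXn eqxx.
apply: (@galois_over_param _ _ kap z x (lead_coef (map_poly (eval_t kap z) P)) P (map rt ps)) => //.
- by rewrite lead_coef_eq0.
- apply: all_roots_prod_XsubC; first by rewrite sP size_map szps.
    apply/allP => _ /mapP[[b c] bc ->]; move: bc; rewrite mps => /andP[bF cC].
    rewrite rootE PE hornerD hornerN hornerC horner_curve_A hornerX subr_eq0.
    have [_ _ mc] := csP b; move: cC bF; rewrite mc mb => /eqP cE /eqP bE.
    have kb : kap b ^+ (q ^ 2) = kap b by rewrite -rmorphXn bE.
    rewrite (@curve_A_norm _ (y + kap b)).
      rewrite (frobD hK) kb on_curve (curve_A_norm yE).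
      by apply/eqP; congr (_ ^+ _); ring.
    rewrite exprS (frobD1 hK) /rt /= /trace_q !(frobD1 hK) exprMn.
    rewrite (rmorphXn kap) -exprM mulnn kb.
    transitivity (y ^+ q.+1 + kap b * y ^+ q + kap b ^+ q * y + kap b ^+ q.+1).
      by rewrite !exprS; ring.
    rewrite yE -(rmorphXn kap q.+1 b) -cE /trace_q rmorphD rmorphXn; ring.
  by rewrite uniq_rootsE.
- apply/mapP; exists (0, 0).
    have [_ _ mc] := csP 0; rewrite mps mb mc /trace_q !expr0n expn_eq0.
    by rewrite (gtn_eqF q0) /= addr0 eqxx.
  by rewrite /rt /= expr0n gtn_eqF //= rmorph0 mul0r !addr0.
move=> S SA SD SM SV; apply: gen => // a [->|->|[b ->]]; apply: SA.
- by constructor 2.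
- by constructor 1.
by constructor 3; exists b.
Qed.
End GaloisSplitting.

(* The special unitary group of the form c m^(q+1) - n^(q+1) over the field with
   q^2 elements consists of the matrices [[A, B], [c B^q, A^q]] with
   A^(q+1) - c B^(q+1) = 1. *)
Section SpecialUnitary.
Variables (q : nat) (k : closedFieldType) (hk : pchar_power q k).
Let q1 : (1 < q)%N := pchar_power_gt1 hk.
Let q0 : (0 < q)%N := ltnW q1.
Let N := (q ^ 3).+1.
Variables (K : fieldType) (kap : {rmorphism k -> K}).
Let hK : pchar_power q K := pchar_power_rmorph kap hk.
Variable c : k.
Hypotheses (cq : c ^+ q = c) (c0 : c != 0).

(** The Dickson invariant in two variables over the field with [q ^ 2] elements: a matrix over that
    field multiplies it by its determinant. *)
Definition dickson (m n : K) := n ^+ (q ^ 2) * m - n * m ^+ (q ^ 2).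

(** The form [c m ^ (q + 1) - n ^ (q + 1)] takes the value [c]; the unitary matrices preserve this
    condition. *)
Definition unitary_rel (m n : K) := n ^+ q.+1 = kap c * (m ^+ q.+1 - 1).

(** The quotient of [m ^ (q ^ 2) - m] by [m ^ (q + 1) - 1], a geometric sum because
    [q ^ 2 - 1 = (q + 1) (q - 1)]. *)
Definition quot_sum (R : nzRingType) (m : R) := m * \sum_(j < q - 1) (m ^+ q.+1) ^+ j.

(** The [(q + 1)]-st power of [dickson] as a polynomial in [m] alone, on [unitary_rel]. Its degree
    [q ^ 3 - q] is the order of the special unitary group. *)
Definition unitary_poly : {poly k} :=
  c *: (('X^(q.+1) - 1) * quot_sum ('X : {poly k}) ^+ q.+1).

Let qq : (q.+1 * (q - 1) = q ^ 2 - 1)%N.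
Proof. by rewrite -mulnn; move: q0; clear; nia. Qed.

Let q2 : (1 < q ^ 2)%N. Proof. by rewrite -{1}(exp1n 2) ltn_exp2r. Qed.

Lemma quot_sumE (R : comNzRingType) (m : R) :
  m ^+ (q ^ 2) - m = (m ^+ q.+1 - 1) * quot_sum m.
Proof.
rewrite /quot_sum mulrCA -subrX1 -exprM qq mulrBr mulr1 -exprS subn1.
by rewrite prednK // ltnW.
Qed.

Lemma size_unitary_poly : size unitary_poly = (q.+1 * (q ^ 2 - q)).+1.
Proof.
have s1 : size ('X^(q.+1) - 1 : {poly k}) = q.+2 by rewrite -polyC1 size_XnsubC.
have s2 : size ('X^(q ^ 2) - 'X : {poly k}) = (q ^ 2).+1.
  by rewrite size_polyDl size_polyXn // size_polyN size_polyX ltnS.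
have := s2; rewrite quot_sumE.
have s1n0 : 'X^(q.+1) - 1 != 0 :> {poly k} by rewrite -size_poly_eq0 s1.
have Q0 : quot_sum ('X : {poly k}) != 0.
  apply/eqP => Q0; have := quot_sumE ('X : {poly k}).
  by rewrite Q0 mulr0 => /eqP; rewrite -size_poly_eq0 s2.
rewrite size_mul // s1 addSn /= => sQ.
have sE : size (quot_sum ('X : {poly k})) = (q ^ 2 - q)%N.
  by move: sQ; rewrite addSn => -[<-]; rewrite addKn.
rewrite /unitary_poly size_scale // size_mul ?expf_neq0 // s1.
rewrite (polySpred (expf_neq0 q.+1 Q0)) size_exp sE addnS /= addSn.
have D0 : (0 < q ^ 2 - q)%N by rewrite subn_gt0 -{1}[q]expn1 ltn_exp2l.
by rewrite -mulSn prednK // mulnC.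
Qed.

Lemma horner_unitary_poly (m : K) : (map_poly kap unitary_poly).[m] =
  kap c * ((m ^+ q.+1 - 1) * quot_sum m ^+ q.+1).
Proof.
rewrite map_polyZ hornerZ rmorphM rmorphB rmorph1 rmorphXn /= map_polyX.
rewrite rmorphXn hornerM horner_exp hornerD hornerN hornerC hornerXn.
congr (_ * (_ * _ ^+ _)); rewrite /quot_sum rmorphM rmorph_sum /= map_polyX.
rewrite hornerM hornerX horner_sum; congr (_ * _); apply: eq_bigr => j _.
by rewrite !rmorphXn /= map_polyX horner_exp hornerXn.
Qed.

(** The [q]-th power of [unitary_rel] turns [dickson m n * n ^ q] into [c * (m ^ (q ^ 2) - m)].
    Raising this to the power [q + 1] and dividing by the [q]-th power of [n ^ (q + 1)], known from
    [unitary_rel], eliminates [n]. *)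
Lemma dickson_norm m n : unitary_rel m n -> n != 0 ->
  dickson m n ^+ q.+1 = (map_poly kap unitary_poly).[m].
Proof.
move=> rel n0; have kc0 : kap c != 0 by rewrite fmorph_eq0.
have s0 : m ^+ q.+1 - 1 != 0.
  by apply/eqP => s0; move: (expf_neq0 q.+1 n0); rewrite rel s0 mulr0 eqxx.
have kcq : kap c ^+ q = kap c by rewrite -rmorphXn cq.
have relq : n ^+ q.+1 ^+ q = kap c * (m ^+ q.+1 - 1) ^+ q by rewrite rel exprMn kcq.
have e : dickson m n * n ^+ q = kap c * (m ^+ (q ^ 2) - m).
  have e1 : n ^+ (q ^ 2) * n ^+ q = kap c * (m ^+ (q ^ 2) * m ^+ q - 1).
    have := relq; rewrite (frobB1 hK) expr1n -!exprM mulSn mulnn addnC !exprD.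
    by [].
  transitivity ((n ^+ (q ^ 2) * n ^+ q) * m - n ^+ q.+1 * m ^+ (q ^ 2)).
    rewrite /dickson (exprS n q).
    by move: (n ^+ (q ^ 2)) (m ^+ (q ^ 2)) (n ^+ q) => u v w; ring.
  rewrite e1 rel (exprS m q).
  by move: (m ^+ (q ^ 2)) (m ^+ q) => u v; ring.
rewrite horner_unitary_poly.
apply: (mulIf (mulf_neq0 kc0 (expf_neq0 q s0))).
transitivity ((dickson m n * n ^+ q) ^+ q.+1).
  by rewrite -[in LHS]relq exprMn -!exprM mulnC.
rewrite e quot_sumE; move: (quot_sum m) (m ^+ q.+1 - 1) => Q u.
by rewrite !exprMn (exprS (kap c)) kcq (exprS u); move: (u ^+ q) (Q ^+ q.+1) => v w; ring.
Qed.

Section Transform.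
Variables (A B : k) (m n : K).
Hypotheses (AF : A ^+ (q ^ 2) = A) (BF : B ^+ (q ^ 2) = B).
Hypothesis AB : A ^+ q.+1 - c * B ^+ q.+1 = 1.
Let m' := kap A * m + kap B * n.
Let n' := kap (c * B ^+ q) * m + kap (A ^+ q) * n.
Let kAB : kap A * kap (A ^+ q) - kap c * (kap B * kap (B ^+ q)) = 1.
Proof. by rewrite -(rmorph1 kap) -AB rmorphB !rmorphM !exprS !rmorphM. Qed.
Let frobk d : d ^+ (q ^ 2) = d -> kap d ^+ (q ^ 2) = kap d.
Proof. by move=> e; rewrite -rmorphXn e. Qed.
Let frobq d : d ^+ (q ^ 2) = d -> (kap d ^+ q) ^+ q = kap d.
Proof. by move=> e; rewrite -exprM mulnn frobk. Qed.

Lemma dickson_transform : dickson m' n' = dickson m n.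
Proof.
have cq2 : kap c ^+ (q ^ 2) = kap c by rewrite -rmorphXn -mulnn exprM !cq.
have AqF : kap (A ^+ q) ^+ (q ^ 2) = kap (A ^+ q).
  by rewrite -rmorphXn exprAC AF.
have BqF : kap (B ^+ q) ^+ (q ^ 2) = kap (B ^+ q).
  by rewrite -rmorphXn exprAC BF.
rewrite /dickson /m' /n' !(frobD hK) !exprMn (rmorphM kap c) exprMn.
rewrite AqF BqF cq2 (frobk AF) (frobk BF).
transitivity ((kap A * kap (A ^+ q) - kap c * (kap B * kap (B ^+ q))) *
   (n ^+ (q ^ 2) * m - n * m ^+ (q ^ 2))); first by ring.
by rewrite kAB mul1r.
Qed.

Lemma unitary_transform : unitary_rel m n -> unitary_rel m' n'.
Proof.
have kcq : kap c ^+ q = kap c by rewrite -rmorphXn cq.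
rewrite /unitary_rel /m' /n' !(exprS _ q) !(frobD1 hK) !exprMn !rmorphM !rmorphXn => rel.
rewrite exprMn (frobq AF) (frobq BF) kcq.
have := kAB; rewrite !rmorphXn; move: rel.
move: (m ^+ q) (n ^+ q) (kap A ^+ q) (kap B ^+ q) => M Nn Aq Bq rel h.
apply/eqP; rewrite -subr_eq0; apply/eqP.
transitivity ((kap A * Aq - kap c * (kap B * Bq)) *
   (n * Nn - kap c * (m * M)) + kap c); first by ring.
by rewrite h rel; ring.
Qed.
End Transform.

(** For each [B] the entries [A] are the [(q + 1)]-st roots of [d B]: only [0] for the [q + 1]
    values of [B] with [d B = 0], and [q + 1] roots for the others. The total is
    [(q + 1) (1 + q ^ 2 - (q + 1))]. *)
Lemma special_unitary_pairs : exists ps : seq (k * k),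
  [/\ uniq ps, size ps = (q.+1 * (q ^ 2 - q))%N &
   forall B A, (B, A) \in ps ->
     [/\ A ^+ (q ^ 2) = A, B ^+ (q ^ 2) = B & A ^+ q.+1 - c * B ^+ q.+1 = 1]]
  /\ ((0 : k), (1 : k)) \in ps.
Proof.
pose d B := 1 + c * B ^+ q.+1.
pose As B := if d B == 0 then [:: 0] else rootseq ('X^(q.+1) - (d B)%:P).
have [ub sb mb] := Fq2P hk.
have AsE B : d B != 0 -> [/\ uniq (As B), size (As B) = q.+1
    & forall A, (A \in As B) = (A ^+ q.+1 == d B)].
  by move=> dB; rewrite /As (negPf dB); exact: norm_fiberP.
have uAs B : uniq (As B).
  by have [dB|dB] := eqVneq (d B) 0; [rewrite /As dB eqxx|have [] := AsE B dB].
have [ps [ups sps mps]] := dep_pairs ub (fun B _ => uAs B).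
exists ps; split; last first.
  have d0 : d 0 = 1 by rewrite /d exprS mul0r mulr0 addr0.
  rewrite mps mb expr0n expn_eq0 (gtn_eqF q0) eqxx /=.
  have [|_ _ ->] := AsE 0; first by rewrite d0 oner_neq0.
  by rewrite d0 expr1n.
split=> // [|B A].
  have sumE (l : seq k) : sumn [seq size (As B) | B <- l] =
      (count (fun B => d B == 0%R) l + q.+1 * count (fun B => d B != 0%R) l)%N.
    elim: l => [|B l /= ->]; first by rewrite muln0.
    have [dB|dB] := eqVneq (d B) 0; first by rewrite /As dB eqxx /= add0n addnA.
    by have [_ -> _] := AsE B dB; rewrite /= !add0n mulnDr muln1 addnCA.
  have cnt : count (fun B => d B == 0) (Fq2 k q) = q.+1.
    have e0 : - c^-1 != 0 by rewrite oppr_eq0 invr_eq0.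
    have [u s mm] := norm_fiberP hk e0.
    rewrite -size_filter -s; apply: perm_size; apply: uniq_perm => //.
      exact: filter_uniq.
    move=> B; rewrite mem_filter mm mb /d.
    have -> : (1 + c * B ^+ q.+1 == 0) = (B ^+ q.+1 == - c^-1).
      rewrite addrC addr_eq0 -(inj_eq (mulfI c0) (B ^+ _)) mulrN divff //.
    case: eqP => //= e.
    have B0 : B ^+ q.+1 != 0 by rewrite e.
    have : (B ^+ q.+1) ^+ q.-1.+1 = B ^+ q.+1.
      by rewrite prednK // e (frobN1 hk) exprVn cq.
    rewrite exprS -[RHS]mulr1 => /(mulfI B0) e2.
    apply/eqP; rewrite -(prednK (ltnW q2)) -subn1 -qq exprS exprM subn1 e2 mulr1.
    by [].
  have cntN : count (fun B => d B != 0) (Fq2 k q) = (q ^ 2 - q.+1)%N.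
    have := count_predC (fun B => d B == 0) (Fq2 k q); rewrite cnt sb => <-.
    by rewrite addKn.
  have le : (q.+1 <= q ^ 2)%N by rewrite -{1}[q]expn1 ltn_exp2l.
  rewrite sps sumE cnt cntN -{1}(muln1 q.+1) -mulnDr; congr (_ * _)%N.
  by rewrite addnC addn1 -subSn.
rewrite mps mb => /andP[/eqP BF]; rewrite /As; case: ifPn => [/eqP dB|dB].
  rewrite inE => /eqP ->; split=> //.
    by rewrite expr0n expn_eq0 (gtn_eqF q0).
  rewrite expr0n /= sub0r; apply/eqP; rewrite eq_sym -subr_eq0 opprK -/(d B) dB.
  by [].
have [_ _ mA] := norm_fiberP hk dB; rewrite mA => /eqP Ad.
have A0 : A != 0.
  by apply: contraNneq dB => A0; rewrite -Ad A0 exprS mul0r.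
split=> //; last by rewrite Ad /d addrK.
(* As [d B] lies in the field with [q] elements, its [(q + 1)]-st roots lie in the field with
   [q ^ 2] elements. *)
have dq : d B ^+ q = d B.
  rewrite /d (frobD1 hk) expr1n exprMn cq -exprM mulSn mulnn addnC exprD BF.
  by rewrite exprS.
have : (A ^+ q.+1) ^+ q.-1.+1 = A ^+ q.+1 by rewrite prednK // Ad dq.
rewrite exprS -[RHS]mulr1 => /(mulfI (expf_neq0 _ A0)) e2.
by rewrite -(prednK (ltnW q2)) -subn1 -qq exprS exprM subn1 e2 mulr1.
Qed.

(** By invariance of [unitary_rel] and [dickson], every [A m + B n] is a root of
    [unitary_poly - s t ^ N]. They are as many as the degree, and distinct because [m] and [n] are
    linearly independent over [k]. *)
Lemma galois_unitary (m n t : K) (s : k) : s != 0 -> nonconstant kap m ->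
  unitary_rel m n -> dickson m n ^+ q.+1 = kap s * t ^+ N ->
  field_generated (fun a => [\/ a = t, a = m | exists b, a = kap b]) ->
  exists i : {rmorphism {fraction {poly k}} -> K},
  [/\ forall c, i (tofrac c%:P) = kap c, i (tofrac 'X) = t & galois_extension i].
Proof.
move=> s0 mN rel dE gen.
have [ps [[ups sps psP] ps1]] := special_unitary_pairs.
(* With [n = r m], [unitary_rel] would be a polynomial equation over [k] for [m], with the nonzero
   constant term [c]. *)
have indep A B : kap A * m + kap B * n = 0 -> A = 0 /\ B = 0.
  move=> e; have [B0|B0] := eqVneq B 0.
    split=> //; move/eqP: e; rewrite B0 rmorph0 mul0r addr0 mulf_eq0 fmorph_eq0.
    by case/orP => [/eqP //|/eqP m0]; have := mN 0; rewrite rmorph0 m0 eqxx.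
  exfalso; have nE : n = kap (- (A / B)) * m.
    rewrite rmorphN fmorph_div; apply: (mulIf (_ : kap B != 0)); first by rewrite fmorph_eq0.
    apply/eqP; rewrite -subr_eq0 -[X in _ == X]e; apply/eqP.
    have kB0 : kap B != 0 by rewrite fmorph_eq0.
    by field.
  set r := - (A / B) in nE.
  pose p : {poly k} := (r ^+ q.+1 - c) *: 'X^(q.+1) + c%:P.
  have p0 : p = 0.
    apply: (nonconstant_root mN); rewrite /p rmorphD /= map_polyZ map_polyXn map_polyC /=.
    rewrite hornerD hornerZ hornerXn hornerC rmorphB rmorphXn.
    by have := rel; rewrite /unitary_rel nE exprMn => h; rewrite mulrBl h; ring.
  have := congr1 (fun p : {poly k} => p`_0) p0.
  by rewrite coefD coefZ coefXn coefC mulr0 add0r coef0 => /eqP; rewrite (negPf c0).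
pose rt (BA : k * k) : K := kap BA.2 * m + kap BA.1 * n.
pose P : {poly {poly k}} := map_poly polyC unitary_poly - (s%:P * 'X^N)%:P.
have PE : map_poly (eval_t kap t) P = map_poly kap unitary_poly - (kap s * t ^+ N)%:P.
  rewrite /P rmorphB; congr (_ - _).
    rewrite /= -map_poly_comp; apply: eq_map_poly => a.
    by rewrite -[LHS]/(eval_t kap t a%:P) eval_tC.
  rewrite -[LHS]/(map_poly (eval_t kap t) _%:P) map_polyC; congr (_%:P).
  rewrite -[LHS]/(eval_t kap t (s%:P * 'X^N)) (rmorphM (eval_t kap t)).
  by rewrite (rmorphXn (eval_t kap t)) eval_tC eval_tX.
have sU : size (map_poly kap unitary_poly) = (q.+1 * (q ^ 2 - q)).+1.
  by rewrite size_map_poly size_unitary_poly.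
have U1 : (1 < size (map_poly kap unitary_poly))%N.
  by rewrite sU ltnS muln_gt0 /= subn_gt0 -{1}[q]expn1 ltn_exp2l.
have sP : size (map_poly (eval_t kap t) P) = (size ps).+1.
  rewrite PE size_polyDl ?sU ?sps // size_polyN -sU.
  exact: leq_ltn_trans (size_polyC_leq1 _) U1.
have P0 : map_poly (eval_t kap t) P != 0 by rewrite -size_poly_eq0 sP.
have tN : nonconstant kap t.
  move=> b; apply/eqP => tb.
  have : unitary_poly - (s * b ^+ N)%:P = 0.
    apply: (nonconstant_root mN); rewrite rmorphB /= map_polyC hornerD hornerN hornerC /=.
    rewrite -(dickson_norm rel); last first.
      apply/eqP => n0; have := indep 0 1; rewrite rmorph0 mul0r n0 mulr0 addr0.
      by case=> // _ /eqP; rewrite oner_eq0.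
    by rewrite dE tb rmorphM rmorphXn subrr.
  move/(congr1 (fun p : {poly k} => size p)).
  rewrite size_polyDl ?size_poly0 ?size_unitary_poly // -size_unitary_poly.
  rewrite size_polyN -(size_map_poly kap unitary_poly).
  exact: leq_ltn_trans (size_polyC_leq1 _) U1.
have urs : uniq (map rt ps).
  rewrite map_inj_uniq // => -[B A] [B' A']; rewrite /rt /= => e.
  have [/eqP + /eqP] : A - A' = 0 /\ B - B' = 0.
    apply: indep; rewrite !rmorphB.
    transitivity ((kap A * m + kap B * n) - (kap A' * m + kap B' * n)); first by ring.
    by rewrite e subrr.
  by rewrite !subr_eq0 => /eqP -> /eqP ->.
apply: (@galois_over_param _ _ kap t m (lead_coef (map_poly (eval_t kap t) P)) P (map rt ps)) => //.
- by rewrite lead_coef_eq0.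
- apply: all_roots_prod_XsubC; first by rewrite sP size_map.
    apply/allP => _ /mapP[[B A] /psP[AF BF AB] ->].
    rewrite rootE PE hornerD hornerN hornerC -dE subr_eq0 /rt /=.
    rewrite -(dickson_norm (unitary_transform AF BF AB rel)).
      by rewrite (dickson_transform _ _ AF BF AB).
    apply/eqP => /indep[e1 e2]; move: AB.
    move/eqP: e1; rewrite mulf_eq0 (negPf c0) expf_eq0 => /andP[_ /eqP ->].
    move/eqP: e2; rewrite expf_eq0 => /andP[_ /eqP ->].
    by rewrite exprS !mul0r mulr0 subrr => /esym/eqP; rewrite oner_eq0.
  by rewrite uniq_rootsE.
by apply/mapP; exists ((0 : k), (1 : k)); rewrite // /rt /= rmorph1 rmorph0 mul1r mul0r addr0.
Qed.
End SpecialUnitary.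

(** * Projections from the affine points with [z = 0] *)

Section FlexPoints.
Variables (q : nat) (k : closedFieldType) (hk : pchar_power q k).
Let q1 : (1 < q)%N := pchar_power_gt1 hk.
Let q0 : (0 < q)%N := ltnW q1.
Let N := (q ^ 3).+1.
Variables (K : fieldType) (kap : {rmorphism k -> K}).
Let hK : pchar_power q K := pchar_power_rmorph kap hk.

(** Both [X ^ (q ^ 3) + X] and [X ^ q + X] are palindromic, of weights [N] and [q + 1], and
    [(q + 1) (q ^ 2 - q + 1) = N]. *)
Lemma curve_A_inv (X : K) : X != 0 -> curve_A q X^-1 = curve_A q X / X ^+ N.
Proof.
move=> X0; apply: (canRL (mulfK _)); first by rewrite expf_neq0.
rewrite !(curve_AE hK); set M := (q ^ 2 - q + 1)%N.
have MN : (q.+1 * M = N)%N.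
  have le : (q <= q ^ 2)%N by rewrite -{1}[q]expn1 leq_pexp2l.
  have le2 : (q ^ 2 <= q ^ 3)%N by rewrite leq_pexp2l.
  rewrite /M /N mulSn !mulnDr !mulnBr muln1 -expnS mulnn.
  by move: le le2; move: (q ^ 3)%N (q ^ 2)%N; lia.
rewrite mulrBl mulrDl -{3}MN exprM -exprMn mulrDl.
have -> : X^-1 ^+ (q ^ 3) * X ^+ N = X.
  by rewrite /N exprSr mulrA -exprMn mulVf // expr1n mul1r.
have -> : X^-1 * X ^+ N = X ^+ (q ^ 3) by rewrite /N exprS mulKf.
have -> : X^-1 ^+ q * X ^+ q.+1 = X by rewrite exprSr mulrA -exprMn mulVf // expr1n mul1r.
have -> : X^-1 * X ^+ q.+1 = X ^+ q by rewrite exprS mulKf.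
by rewrite [X + X ^+ q]addrC [X + X ^+ _]addrC.
Qed.

Variables (x z : K).
Hypothesis x_nonconst : nonconstant kap x.
Hypothesis on_curve : z ^+ N = curve_A q x.
Hypothesis gen : field_generated (fun a => [\/ a = x, a = z | exists b, a = kap b]).
Variable a : k.
Let xa0 : x - kap a != 0. Proof. by rewrite subr_eq0. Qed.

(* [(x, z) |-> (1 / (x - a), z / (x - a))] is a symmetry of the curve. *)
Lemma galois_smooth_flex : trace_q q a = 0 ->
  exists i : {rmorphism {fraction {poly k}} -> K},
  [/\ forall c, i (tofrac c%:P) = kap c, i (tofrac 'X) = z / (x - kap a)
    & galois_extension i].
Proof.
move=> tr; have w0 := xa0; set w := x - kap a in w0 *.
have trw : trace_q q w = trace_q q x.
  rewrite /trace_q /w (frobB1 hK) -rmorphXn.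
  have -> : a ^+ q = - a by apply/eqP; rewrite -addr_eq0 -/(trace_q q a) tr.
  by rewrite rmorphN; ring.
have Aw : curve_A q w = curve_A q x by rewrite !(curve_A_trace hK) /alpha trw.
have xE : x = kap a + w by rewrite /w addrC subrK.
(* The symmetry moves the center [(a : 0 : 1)] to [(1 : 0 : 0)], which has been treated. *)
apply: (@galois_over_z q k hk K kap w^-1).
- move=> c; apply/eqP => e; have := x_nonconst (a + c^-1).
  by rewrite rmorphD fmorphV -e invrK -xE eqxx.
- by rewrite curve_A_inv // Aw -on_curve expr_div_n.
move=> S SA SD SM SV; apply: gen => // b [->|->|[c ->]].
- rewrite xE; apply: SD; first by apply: SA; constructor 3; exists a.
  by rewrite -[w]invrK; apply: SV; apply: SA; constructor 1.
- have -> : z = (z / w) * w by rewrite divfK.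
  apply: SM; first by apply: SA; constructor 2.
  by rewrite -[w]invrK; apply: SV; apply: SA; constructor 1.
by apply: SA; constructor 3; exists c.
Qed.

Section Singular.
Let c := trace_q q a.
Hypothesis aF : a ^+ (q ^ 2) = a.
Hypothesis c0 : c != 0.

Lemma trace_fixed : c ^+ q = c.
Proof. by rewrite /c /trace_q (frobD1 hk) -exprM mulnn aF addrC. Qed.

(* In the basis of the orthogonal complement of the pole of the line [X = a W],
   the form [x^q + x - y^(q+1)] is diagonal with coordinates [1 : m : n]. *)
Lemma galois_singular_flex : exists i : {rmorphism {fraction {poly k}} -> K},
  [/\ forall c, i (tofrac c%:P) = kap c, i (tofrac 'X) = z / (x - kap a)
    & galois_extension i].
Proof.
have kc0 : kap c != 0 by rewrite fmorph_eq0.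
have ax0 : kap a - x != 0 by rewrite -opprB oppr_eq0.
have kcE : kap c = kap a ^+ q + kap a by rewrite /c /trace_q rmorphD rmorphXn.
have kcq : kap c ^+ q = kap c by rewrite -rmorphXn trace_fixed.
have kaF : (kap a ^+ q) ^+ q = kap a by rewrite -exprM mulnn -rmorphXn aF.
have yE := gk_yE hk x_nonconst on_curve.
have zE := curve_A_norm hk kap yE; rewrite -on_curve in zE.
move: (gk_y q x z) yE zE => y yE zE.
(* Chosen so that [(x + a ^ q) ^ (q + 1) - (a - x) ^ (q + 1) = c * (x ^ q + x)], valid as
   [a ^ (q ^ 2) = a], becomes [unitary_rel]. *)
pose m : K := (x + kap a ^+ q) / (kap a - x).
pose n : K := y * kap c / (kap a - x).
have m1 : 1 + m = kap c / (kap a - x).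
  by rewrite /m kcE; field.
have mE : m * (kap a - x) = x + kap a ^+ q by rewrite divfK.
have nE : n * (kap a - x) = y * kap c by rewrite divfK.
have rel : unitary_rel q kap c m n.
  rewrite /unitary_rel; apply: (mulIf (expf_neq0 q.+1 ax0)).
  rewrite -mulrA mulrBl mul1r -!exprMn mE nE exprMn yE !(exprS _ q) (frobB1 hK) (frobD1 hK).
  rewrite kaF kcq /trace_q; move: kcE; move: (x ^+ q) (kap a ^+ q) => xq aq ->.
  ring.
set u := 1 + m in m1; have uE : u = 1 + m by [].
clearbody u.
have u0 : u != 0 by rewrite m1 mulf_neq0 ?invr_eq0.
have nyu : n = y * u by rewrite m1 /n mulrA.
have mN : nonconstant kap m.
  move=> b; apply/eqP => mb.
  have ub : u = kap (1 + b) by rewrite uE mb rmorphD rmorph1.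
  have := x_nonconst (a - c / (1 + b)); rewrite rmorphB fmorph_div -ub m1.
  by rewrite invf_div mulrCA divff // mulr1 opprB addrC subrK eqxx.
(* As [z ^ N] is the [(q + 1)]-st power of [y - y ^ (q ^ 2)], this identity and the next express
   that difference by [dickson]. *)
have d1 : m ^+ q * dickson q m n = n ^+ (q ^ 2) - n.
  have e1 : m ^+ q.+1 = n ^+ q.+1 / kap c + 1.
    by rewrite rel mulrC mulKf // subrK.
  have e2 : m ^+ (q ^ 2) * m ^+ q = n ^+ (q ^ 2) * n ^+ q / kap c + 1.
    have pq (v : K) : v ^+ (q ^ 2) * v ^+ q = (v ^+ q.+1) ^+ q.
      by rewrite -exprM mulSn mulnn addnC exprD.
    by rewrite !pq e1 (frobD1 hK) expr1n exprMn exprVn kcq.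
  rewrite /dickson mulrBr mulrCA [m ^+ q * (n * _)]mulrCA [m ^+ q * m ^+ (q ^ 2)]mulrC e2.
  rewrite -exprSr e1 exprS; move: (n ^+ (q ^ 2)) (n ^+ q) => v w.
  by field.
have d2 : (y - y ^+ (q ^ 2)) * (u ^+ (q ^ 2) * u) = - (dickson q m n * u ^+ q).
  have uq : u ^+ q = 1 + m ^+ q by rewrite uE (frobD1 hK) expr1n.
  have uq2 : u ^+ (q ^ 2) = 1 + m ^+ (q ^ 2) by rewrite uE (frobD hK) expr1n.
  have nq2 : n ^+ (q ^ 2) = y ^+ (q ^ 2) * u ^+ (q ^ 2) by rewrite nyu exprMn.
  have -> : dickson q m n * u ^+ q = dickson q m n + (n ^+ (q ^ 2) - n).
    by rewrite uq -d1; ring.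
  rewrite /dickson nq2 nyu uq2 uE.
  by move: (y ^+ (q ^ 2)) (m ^+ (q ^ 2)) => v w; ring.
(* The powers of [u] match because [(q ^ 2 + 1) (q + 1) = N + q (q + 1)]; the constant comes from
   [- c * z / (x - a) = z * u]. *)
have dE : dickson q m n ^+ q.+1 = kap ((- c) ^+ N) * (z / (x - kap a)) ^+ N.
  have uN : u ^+ (q * q.+1) != 0 by rewrite expf_neq0.
  apply: (mulIf uN); transitivity ((- (dickson q m n * u ^+ q)) ^+ q.+1).
    by rewrite [RHS]exprS (frobN1 hK) mulrNN -exprS exprMn -exprM.
  rewrite -d2 exprMn -zE -exprSr -exprM rmorphXn -exprMn.
  have -> : kap (- c) * (z / (x - kap a)) = z * u.
    by rewrite m1 rmorphN; field; rewrite ?xa0 ?ax0.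
  rewrite exprMn -mulrA -exprD; congr (_ * _ ^+ _).
  by rewrite /N mulSn mulnS -mulnn expnS -mulnn; lia.
apply: (@galois_unitary q k hk K kap c trace_fixed c0 m n _ ((- c) ^+ N)) => //.
  by rewrite expf_neq0 // oppr_eq0.
move=> S SA SD SM SV.
have SC b : S (kap b) by apply: SA; constructor 3; exists b.
have Sm : S m by apply: SA; constructor 2.
have Su : S u by rewrite uE; apply: SD => //; rewrite -(rmorph1 kap).
have Sx : S x.
  have -> : x = kap a + kap (- c) * u^-1.
    by rewrite m1 rmorphN; field; rewrite ?kc0 ?ax0.
  by apply: SD => //; apply: SM => //; apply: SV.
apply: gen => // b [->|->|[d ->]] //.
have -> : z = (z / (x - kap a)) * (x + kap (- a)).
  by rewrite rmorphN divfK.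
by apply: SM; [apply: SA; constructor 1|apply: SD].
Qed.
End Singular.
End FlexPoints.

(** * From Galois extensions to Galois points *)

Section Converse.
Variables (q : nat) (k : closedFieldType) (hk : pchar_power q k).
Let N := (q ^ 3).+1.
Variables (K : fieldType) (phi : {rmorphism {mpoly k[2]} -> K}).
Hypothesis hphi : is_function_field (gk_plane_model k q) phi.
Let kap : {rmorphism k -> K} := phi \o (@mpolyC 2 k : {rmorphism k -> {mpoly k[2]}}).

Lemma function_field_on_curve : phi 'X_1 ^+ N = curve_A q (phi 'X_0).
Proof.
have : phi (gk_plane_model k q) = 0 by apply/hphi.1; exists 1; rewrite mul1r.
rewrite gk_plane_modelE // rmorphB rmorphXn rmorph_curve_A => /eqP.
by rewrite subr_eq0 eq_sym => /eqP.
Qed.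

Lemma x_nonconst : nonconstant kap (phi 'X_0).
Proof.
move=> c; apply/eqP => e.
have [z0 zE] := @closed_field_nth_root k N (curve_A q (c + 1)) isT.
have : phi ('X_0 - c%:MP) = 0 by rewrite rmorphB e subrr.
move/(curve_pointP hk hphi)/(_ zE); rewrite mevalB mevalXU mevalC /= addrAC subrr add0r.
by move/eqP; rewrite oner_eq0.
Qed.

Lemma function_field_generated : field_generated
  (fun a => [\/ a = phi 'X_0, a = phi 'X_1 | exists b, a = kap b]).
Proof.
move=> S SA SD SM SV y; have [g [h [_ ->]]] := hphi.2 y.
suff Sphi g' : S (phi g') by apply: SM => //; apply: SV.
have SX a n : S a -> S (a ^+ n).
  move=> Sa; elim: n => [|n IH]; last by rewrite exprS; apply: SM.
  by rewrite expr0 -(rmorph1 kap); apply: SA; constructor 3; exists 1.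
elim/mpolyind: g' => [|c m g' _ _ IH].
  by rewrite rmorph0 -(rmorph0 kap); apply: SA; constructor 3; exists 0.
rewrite rmorphD -mul_mpolyC rmorphM; apply: SD => //; apply: (SM _ _).
  by apply: SA; constructor 3; exists c.
rewrite mpolyXE_id !big_ord_recl big_ord0 mulr1 rmorphM !rmorphXn.
have -> : lift ord0 ord0 = 1 :> 'I_2 by apply/val_inj.
by apply: (SM _ _); apply: (SX _ _); apply: SA; [constructor 1|constructor 2].
Qed.

Lemma galois_point_of_forms (P : 'rV[k]_3) (l1 l2 : 'cV[k]_3) (r s : 'I_3)
    (i : {rmorphism {fraction {poly k}} -> K}) :
  P *m l1 = 0 -> P *m l2 = 0 -> l1 r 0 * l2 s 0 - l1 s 0 * l2 r 0 != 0 ->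
  (forall c, i (tofrac c%:P) = kap c) ->
  i (tofrac 'X) = phi (affine_form l1) / phi (affine_form l2) ->
  galois_extension i -> galois_point (gk_plane_model k q) P.
Proof.
move=> Pl1 Pl2 minor iC iX gal.
pose L : 'M[k]_(3, 2) := \matrix_(j, c) (if c == 0 then l1 j 0 else l2 j 0).
have L0 : col 0 L = l1 by apply/matrixP => j c; rewrite !mxE ord1.
have L1 : col 1 L = l2 by apply/matrixP => j c; rewrite !mxE ord1.
exists K, phi, L, i; split=> //; last by split; rewrite ?L0 ?L1.
split.
  have Lf : row_free L^T.
    apply: inj_row_free => v vL.
    have e j : v 0 0 * l1 j 0 + v 0 1 * l2 j 0 = 0.
      have := congr1 (fun M : 'rV_3 => M 0 j) vL.
      rewrite !mxE !big_ord_recl big_ord0 !mxE /= addr0 => <-.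
      by congr (_ + v _ _ * _); apply/val_inj.
    have e0 : v 0 0 * (l1 r 0 * l2 s 0 - l1 s 0 * l2 r 0) = 0.
      transitivity ((v 0 0 * l1 r 0 + v 0 1 * l2 r 0) * l2 s 0 -
        (v 0 0 * l1 s 0 + v 0 1 * l2 s 0) * l2 r 0); first by ring.
      by rewrite !e !mul0r subrr.
    have e1 : v 0 1 * (l1 r 0 * l2 s 0 - l1 s 0 * l2 r 0) = 0.
      transitivity ((v 0 0 * l1 s 0 + v 0 1 * l2 s 0) * l1 r 0 -
        (v 0 0 * l1 r 0 + v 0 1 * l2 r 0) * l1 s 0); first by ring.
      by rewrite !e !mul0r subrr.
    apply/rowP => c; rewrite mxE.
    have [->|->] : c = 0 \/ c = 1.
      by case: c => [[|[|[]]] //= lt]; [left|right]; apply/val_inj.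
      by move/eqP: e0; rewrite mulf_eq0 (negPf minor) orbF => /eqP.
    by move/eqP: e1; rewrite mulf_eq0 (negPf minor) orbF => /eqP.
  by rewrite -mxrank_tr; exact/eqP.
apply/matrixP => j c; rewrite [j]ord1.
have -> : (P *m L) 0 c = (P *m col c L) 0 0.
  by rewrite !mxE; apply: eq_bigr => j' _; rewrite !mxE.
rewrite [RHS]mxE; have [->|->] : c = 0 \/ c = 1.
  by case: c => [[|[|[]]] //= lt]; [left|right]; apply/val_inj.
  by rewrite L0 Pl1 mxE.
by rewrite L1 Pl2 mxE.
Qed.

Definition form3 (u v w : k) : 'cV[k]_3 := \col_(j < 3) [:: u; v; w]`_j.

Lemma affine_form3 u v w :
  phi (affine_form (form3 u v w)) = kap u * phi 'X_0 + kap v * phi 'X_1 + kap w.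
Proof. by rewrite affine_formE !mxE. Qed.

Lemma mul_form3 (P : 'rV[k]_3) u v w :
  P 0 0 * u + P 0 1 * v + P 0 2 * w = 0 -> P *m form3 u v w = 0.
Proof.
move=> e; apply/matrixP => j c; rewrite [j]ord1 [c]ord1 !mxE !big_ord_recl big_ord0.
rewrite !mxE /= addr0 addrA -[RHS]e.
by congr (_ + P _ _ * _ + P _ _ * _); apply/val_inj.
Qed.

Lemma outer_center_galois (P : 'rV[k]_3) :
  (P == proj_pt 0 1 0)%MS -> galois_point (gk_plane_model k q) P.
Proof.
case/andP => /submxP[D PE] _.
have P0 : P 0 0 = 0 by rewrite PE !mxE big_ord_recl big_ord0 !mxE /= mulr0 addr0.
have P2 : P 0 2 = 0 by rewrite PE !mxE big_ord_recl big_ord0 !mxE /= mulr0 addr0.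
have [i [iC iX gal]] := galois_over_x hk x_nonconst function_field_on_curve
  function_field_generated.
apply: (@galois_point_of_forms P (form3 1 0 0) (form3 0 0 1) 0 2 i) => //.
- by apply: mul_form3; rewrite P0 P2; ring.
- by apply: mul_form3; rewrite P0 P2; ring.
- by rewrite !mxE /= mulr1 mul0r subr0 oner_neq0.
by rewrite iX !affine_form3 !rmorph0 rmorph1 !mul0r mul1r !addr0 !add0r divr1.
Qed.

Lemma infinite_flex_galois (P : 'rV[k]_3) : P 0 1 = 0 -> P 0 2 = 0 ->
  galois_point (gk_plane_model k q) P.
Proof.
move=> P1 P2.
have [i [iC iX gal]] := galois_over_z hk x_nonconst function_field_on_curve
  function_field_generated.
apply: (@galois_point_of_forms P (form3 0 1 0) (form3 0 0 1) 1 2 i) => //.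
- by apply: mul_form3; rewrite P1 P2; ring.
- by apply: mul_form3; rewrite P1 P2; ring.
- by rewrite !mxE /= mulr1 mul0r subr0 oner_neq0.
by rewrite iX !affine_form3 !rmorph0 rmorph1 !mul0r mul1r !addr0 !add0r divr1.
Qed.

Lemma affine_flex_galois (P : 'rV[k]_3) : P 0 1 = 0 -> P 0 2 != 0 ->
  curve_A q (P 0 0 / P 0 2) = 0 -> galois_point (gk_plane_model k q) P.
Proof.
move=> P1 P2; set a := P 0 0 / P 0 2 => /eqP; rewrite (curve_A_eq0 hk) => /eqP aF.
have [i [iC iX gal]] : exists i : {rmorphism {fraction {poly k}} -> K},
    [/\ forall c, i (tofrac c%:P) = kap c,
        i (tofrac 'X) = phi 'X_1 / (phi 'X_0 - kap a) & galois_extension i].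
  (* Zeros of [trace_q] are smooth points, as [alpha] is [1] there; the other elements of the field
     with [q ^ 2] elements are zeros of [alpha] and give singular points. *)
  have [tr|tr] := eqVneq (trace_q q a) 0.
    exact: (galois_smooth_flex hk x_nonconst function_field_on_curve
      function_field_generated tr).
  exact: (galois_singular_flex hk x_nonconst function_field_on_curve
    function_field_generated aF tr).
apply: (@galois_point_of_forms P (form3 0 1 0) (form3 1 0 (- a)) 1 0 i) => //.
- by apply: mul_form3; rewrite P1; ring.
- by apply: mul_form3; rewrite P1 /a; field.
- by rewrite !mxE /= mulr1 mul0r subr0 oner_neq0.
by rewrite iX !affine_form3 !rmorph0 rmorph1 rmorphN !mul0r !mul1r !addr0 !add0r.
Qed.
End Converse.

Theorem theorem2 (p e q : nat) (k : closedFieldType)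
    (hp : prime p) (he : (0 < e)%N) (hq : q = (p ^ e)%N)
    (hk : p \in [pchar k]) (P : 'rV[k]_3) (hP : P != 0) :
  galois_point (gk_plane_model k q) P <->
  (P == proj_pt 0 1 0)%MS
  \/ (on_proj_closure (gk_plane_model k q) P /\ P 0 1 = 0).
Proof.
have hk' : pchar_power q k by exists p, e.
split; first exact: galois_point_only.
(* Since [galois_point] asks for some model of the function field, this direction has to supply
   one. *)
have [K [phi hphi]] := function_field_exists hk'.
case=> [|[onP P1]]; first exact: (outer_center_galois hk' hphi).
have [P2|P2] := eqVneq (P 0 2) 0; first exact: (infinite_flex_galois hk' hphi).
apply: (affine_flex_galois hk' hphi) => //.
have := (on_closure_affine hk' P2).1 onP.
by rewrite P1 mul0r exprS mul0r.
Qed.
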